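(* Let $A\subset\wedge^3W$ be a maximal isotropic subspace such that $\mathbb P(A)\cdot\mathbb G=h\cup F'$, with $\langle h\rangle\cdot\mathbb G=h$ and $F'$ finite, where $h=\{h_1,\dots,h_5\}$ is the Del Pezzo $5$-tuple of planes of the hyperplane $\mathbb H\subset\mathbb P(W)$. Let $u=h_5$ and let $V_A\subset P_u\times P_u^\perp\subset\mathbb P^8$ be the bidegree $(2,2)$ hypersurface associated to $(A,u)$. Let $P_h:=p(\langle h\rangle)$ be the image of $\langle h\rangle$ under the projection $p:\mathbb P(A)\dashrightarrow\mathbb P^8$ from $u$. Then $V_A$ contains the plane $P_h$; in particular $V_A$ is rational.
   Context: The base field is $\mathbb C$. $W$ is a $6$-dimensional vector space and $\mathbb G\subset\mathbb P(\wedge^3W)$ is the Grassmannian of planes of $\mathbb P(W)$; isotropy is with respect to the symplectic wedge pairing $\wedge^3W\times\wedge^3W\to\wedge^6W$. Let $Y\subset\mathbb P^5$ be a smooth quintic Del Pezzo surface, $W_Y:=H^0(\mathcal I_Y(2))$ (dimension $5$), $\mathbb H:=\mathbb P(W_Y)=|\mathcal I_Y(2)|$, and fix a linear embedding $W_Y\subset W$. The locus of quadrics of rank $\le4$ in $\mathbb H$ is a union of five planes $P_1,\dots,P_5$, and $h=\{h_1,\dots,h_5\}\subset\mathbb G$ is the set of corresponding points. It is a transversal $0$-dimensional linear section of the Grassmannian of planes of $\mathbb H$; it spans a $3$-space $\langle h\rangle$, in which its points are in general position. $F':=\mathbb P(A)\cdot\mathbb G\cap(\mathbb P(\wedge^3W)-\mathbb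 P(\wedge^3W_Y))$. It is assumed throughout that the scheme $\mathbb P(A)\cdot\mathbb G$ is smooth and $0$-dimensional at $u$. $V_A$: let $P_u=\mathbb P(U)$ and let $P_u^\perp=\mathbb P(\wedge^2(W/U))$ be the net of hyperplanes through $P_u$. Let $W^i_u$ be the image of $\wedge^iU\otimes\wedge^{3-i}W$ in $\wedge^3W$; then $A\subset W_u^1$, $A\cap W^2_u=\wedge^3U$, and $A/\wedge^3U\cong W_u^1/W_u^2\cong U\otimes\wedge^2(W/U)$. So projection from $u$ is a map $p:\mathbb P(A)\dashrightarrow\mathbb P^8=\mathbb P(W^1_u/W^2_u)$, and $\mathbb P^8$ contains the Segre variety $P_u\times P_u^\perp$. Choose a complement $V$ of $U$ and write $a\in A$ as $a=a_1+a_2+a_3$, $a_1\in U\wedge(\wedge^2V)$, $a_2\in(\wedge^2U)\wedge V$, $a_3\in\wedge^3U$. For $a\in A$ lying over $(x,y)\in P_u\times P_u^\perp$, $a_1\wedge a_2\in\wedge^6W$ defines a section of $\mathcal O(2,2)$ independent of $V$; $V_A$ is its divisor of zeros. *)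

(* Defs.v *)
From HB Require Import structures.
From mathcomp Require Import all_boot all_order all_algebra.
From mathcomp Require Import reals complex mpoly.

Set Implicit Arguments.
Unset Strict Implicit.
Unset Printing Implicit Defensive.

Import GRing.Theory.
Local Open Scope ring_scope.

(* Points of a projective space P(E) are represented by nonzero vectors of E,
   or by lines <[v]>; linear subspaces of P(E) by vector subspaces of E, so
   that a projective d-space is a {vspace E} of dimension d.+1. *)

Section ExteriorAlgebra.
Variables (K : fieldType) (n : nat).

(* The exterior algebra of K^n; the value at S = {i1 < ... < ik} is the
   coefficient of e_i1 /\ ... /\ e_ik. *)
Definition ext := {ffun {set 'I_n} -> K^o}.

Definition ebase (S : {set 'I_n}) : ext := [ffun T => (T == S)%:R].

(* e_T /\ e_T' = (-1)^(number of inversions of the word TT') e_(T :|: T')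
   for disjoint T and T'. *)
Definition inversions (T T' : {set 'I_n}) : nat :=
  #|[set p : 'I_n * 'I_n | [&& p.1 \in T, p.2 \in T' & (p.2 < p.1)%N]]|.

Definition wedge (a b : ext) : ext :=
  [ffun S : {set 'I_n} => \sum_(T : {set 'I_n} | T \subset S)
     (-1) ^+ inversions T (S :\: T) * (a T * b (S :\: T))].

Definition vec (v : 'rV[K]_n) : ext := \sum_i v 0 i *: ebase [set i].

Definition emb (U : {vspace 'rV[K]_n}) : {vspace ext} :=
  <<[seq vec u | u <- vbasis U]>>%VS.

Definition wedgev (E F : {vspace ext}) : {vspace ext} :=
  <<[seq wedge a b | a <- vbasis E, b <- vbasis F]>>%VS.

Definition extpow (U : {vspace 'rV[K]_n}) (k : nat) : {vspace ext} :=
  iter k (wedgev (emb U)) <[ebase set0]>%VS.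

End ExteriorAlgebra.

Section Polynomials.
Variable K : fieldType.

Definition ev n (v : 'rV[K]_n) (p : {mpoly K[n]}) : K := p.@[fun i => v 0 i].

Definition bihomog (d e : nat) (p : {mpoly K[3 + 3]}) : Prop :=
  forall m, m \in msupp p ->
    (\sum_(i < 3) m (lshift 3 i) = d)%N /\ (\sum_(i < 3) m (rshift 3 i) = e)%N.

Definition irreducible_mpoly n (p : {mpoly K[n]}) : Prop :=
  [/\ p != 0, p \isn't a GRing.unit &
      forall q r, p = q * r -> q \is a GRing.unit \/ r \is a GRing.unit].

Definition same_point n (x y : 'rV[K]_n) : Prop :=
  [/\ x != 0, y != 0 & <[x]>%VS = <[y]>%VS].

Definition poly_map m n (f : 'I_n -> {mpoly K[m]}) (v : 'rV[K]_m) : 'rV[K]_n :=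
  \row_i ev v (f i).

(* The divisor of F in P^2 x P^2 is a rational threefold: it is integral and
   there are mutually inverse rational maps t |-> (f1 t, f2 t) from P^3 and
   (x, y) |-> g (x, y) to P^3, defined and inverse to each other on the
   nonempty open sets a != 0 of P^3 and b != 0 of the divisor. *)
Definition rational_hypersurface (F : {mpoly K[3 + 3]}) : Prop :=
  irreducible_mpoly F /\
  exists (f1 f2 : 'I_3 -> {mpoly K[4]}) (g : 'I_4 -> {mpoly K[3 + 3]})
         (a : {mpoly K[4]}) (b : {mpoly K[3 + 3]}),
  [/\ (exists d, forall i, f1 i \is d.-homog) /\
      (exists d, forall i, f2 i \is d.-homog),
      (exists d e, forall i, bihomog d e (g i)),
      (exists d, a \is d.-homog) /\ (exists d e, bihomog d e b),
      a != 0 /\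
      (forall t : 'rV[K]_4, ev t a != 0 ->
         let x := poly_map f1 t in let y := poly_map f2 t in
         [/\ x != 0, y != 0, ev (row_mx x y) F = 0 &
             same_point t (poly_map g (row_mx x y))])
    & (exists x y : 'rV[K]_3,
         [/\ x != 0, y != 0, ev (row_mx x y) F = 0 & ev (row_mx x y) b != 0]) /\
      (forall x y : 'rV[K]_3,
         x != 0 -> y != 0 -> ev (row_mx x y) F = 0 -> ev (row_mx x y) b != 0 ->
         let t := poly_map g (row_mx x y) in
         [/\ t != 0, same_point x (poly_map f1 t) &
             same_point y (poly_map f2 t)])].

End Polynomials.

Section DelPezzo.
Variable K : fieldType.

(* Y is given by its affine cone in K^6. *)
Implicit Type Y : 'rV[K]_6 -> Prop.

Definition vanishes Y (p : {mpoly K[6]}) : Prop := forall v, Y v -> ev v p = 0.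

Definition projective_closed Y : Prop :=
  exists s : seq {mpoly K[6]},
    (forall p, p \in s -> exists d, p \is d.-homog) /\
    (forall v, Y v <-> forall p, p \in s -> ev v p = 0).

Definition irreducible Y : Prop :=
  (exists2 v, v != 0 & Y v) /\
  (forall p q, vanishes Y (p * q) -> vanishes Y p \/ vanishes Y q).

Definition nondegenerate Y : Prop :=
  forall l : 'cV[K]_6, (forall v, Y v -> v *m l = 0) -> l = 0.

(* w belongs to the Zariski tangent space of the affine cone at v. *)
Definition tangent Y (v w : 'rV[K]_6) : Prop :=
  forall p, vanishes Y p -> \sum_i ev v (mderiv i p) * w 0 i = 0.

Definition smooth_surface Y : Prop :=
  forall v, v != 0 -> Y v ->
    exists2 T : {vspace 'rV[K]_6}, \dim T = 3%N &
      forall w, w \in T <-> tangent Y v w.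

(* The general linear subspace of codimension 2 of P^5 meets Y in exactly
   5 points; in particular Y has dimension 2. *)
Definition surface_of_degree5 Y : Prop :=
  exists2 D : {mpoly K[6 * 2]}, D != 0 &
    forall L : 'M[K]_(6, 2), ev (mxvec L) D != 0 ->
      exists2 s : 5.-tuple {vspace 'rV[K]_6}, uniq s &
        forall l, l \in s <->
          exists v, [/\ v != 0, Y v, v *m L = 0 & l = <[v]>%VS].

(* The canonical sheaf of Y is O_Y(-1).  Contraction with the Euler vector
   field identifies the sections of omega_Y(1) with the regular 3-forms w of
   weight 1 on the punctured affine cone over Y, and omega_Y is O_Y(-1) if and
   only if there is such a form which vanishes nowhere.  Locally w is the
   restriction of the sum of the (N_S / G) dx_S over the 3-subsets S; as dx_S
   has weight 3, N_S / G has degree -2.  Note that (t1 /\ t2 /\ t3)_S is the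
   value of dx_S on (t1, t2, t3). *)
Definition anticanonical Y : Prop :=
  exists w : 'rV[K]_6 -> 'rV[K]_6 -> 'rV[K]_6 -> 'rV[K]_6 -> K,
    forall v, v != 0 -> Y v ->
    (exists t1 t2 t3,
       [/\ tangent Y v t1, tangent Y v t2, tangent Y v t3 &
           w v t1 t2 t3 != 0]) /\
    (exists (d : nat) (G : {mpoly K[6]}) (N : {set 'I_6} -> {mpoly K[6]}),
       [/\ G \is d.+2.-homog, (forall S, N S \is d.-homog), ev v G != 0 &
           forall v' t1 t2 t3, Y v' -> ev v' G != 0 ->
             tangent Y v' t1 -> tangent Y v' t2 -> tangent Y v' t3 ->
             ev v' G * w v' t1 t2 t3 =
             \sum_(S : {set 'I_6} | #|S| == 3%N)
                ev v' (N S) * wedge (vec t1) (wedge (vec t2) (vec t3)) S]).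

(* A smooth quintic surface Y in P^5 with -K_Y = O_Y(1). *)
Definition quintic_del_pezzo Y : Prop :=
  [/\ projective_closed Y, irreducible Y, nondegenerate Y &
      [/\ smooth_surface Y, surface_of_degree5 Y & anticanonical Y]].

(* Quadratic forms on K^6 are given by symmetric matrices. *)
Definition is_quadrics_through Y (WY : {vspace 'M[K]_6}) : Prop :=
  forall q, q \in WY <->
    q^T = q /\ forall v : 'rV[K]_6, Y v -> v *m q *m v^T = 0.

(* H is the image of W_Y under a linear embedding (the restriction to W_Y of
   phi) and the h i are the images of the five planes of P(W_Y) whose union is
   the locus of quadrics of rank at most 4. *)
Definition del_pezzo_tuple (H : {vspace 'rV[K]_6})
    (h : 'I_5 -> {vspace 'rV[K]_6}) : Prop :=
  exists (Y : 'rV[K]_6 -> Prop) (WY : {vspace 'M[K]_6})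
         (phi : 'Hom('M[K]_6, 'rV[K]_6)) (P : 'I_5 -> {vspace 'M[K]_6}),
  [/\ quintic_del_pezzo Y,
      is_quadrics_through Y WY,
      (WY :&: lker phi = 0)%VS /\ H = (phi @: WY)%VS,
      [/\ injective P, (forall i, \dim (P i) = 3%N),
          (forall i, (P i <= WY)%VS) &
          forall q, q \in WY -> ((\rank q <= 4)%N <-> exists i, q \in P i)]
    & forall i, h i = (phi @: P i)%VS].

End DelPezzo.

(* W is K^6.  A point of the Grassmannian G in P(/\^3 W) is a 3-dimensional
   subspace U of W, embedded as the line /\^3 U = extpow U 3. *)
Section VerraThreefold.
Variable K : fieldType.
Notation W := 'rV[K]_6.
Notation extW := (ext K 6).
Implicit Types (A L : {vspace extW}) (U V H : {vspace W}).

Definition isotropic A : Prop :=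
  (A <= extpow fullv 3)%VS /\
  forall a b, a \in A -> b \in A -> wedge a b = 0.

Definition maximal_isotropic A : Prop :=
  isotropic A /\ forall B, isotropic B -> (A <= B)%VS -> B = A.

(* W_u^i, the image of /\^i U (x) /\^(3-i) W in /\^3 W. *)
Definition Wfil U (i : nat) : {vspace extW} :=
  wedgev (extpow U i) (extpow fullv (3 - i)).

Definition in_G L U : Prop := \dim U = 3%N /\ (extpow U 3 <= L)%VS.

(* P(W_u^2) is the projective tangent space of G at u, so this says that the
   Zariski tangent space at u of the scheme P(L).G is zero, that is, P(L).G is
   smooth and 0-dimensional at u. *)
Definition smooth_at L U : Prop := (L :&: Wfil U 2 = extpow U 3)%VS.

Definition hspan (h : 'I_5 -> {vspace W}) : {vspace extW} :=
  (\sum_i extpow (h i) 3)%VS.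

(* The points of P(A).G outside P(/\^3 H). *)
Definition residual A H U : Prop :=
  in_G A U /\ ~~ (extpow U 3 <= extpow H 3)%VS.

Definition finite_points (F : {vspace W} -> Prop) : Prop :=
  exists s : seq {vspace W}, forall U, F U -> U \in s.

(* P(L).G is, as a scheme, the disjoint union of F and of the reduced scheme
   h. *)
Definition section_is L (h : 'I_5 -> {vspace W}) (F : {vspace W} -> Prop) :
    Prop :=
  [/\ (forall U, in_G L U <-> (exists i, U = h i) \/ F U),
      (forall i, ~ F (h i)) & forall i, smooth_at L (h i)].

(* Given a complement V of U, W_u^1 is the direct sum of the grade U V i for
   i = 1, 2, 3, W_u^2 is the sum of the last two and comp1, comp2 give the
   components a_1 and a_2.  The space W_u^1 / W_u^2 is identified with
   grade U V 1, hence /\^2 (W / U) with /\^2 V = extpow V 2, and the projection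
   p from u with comp1. *)
Definition grade U V (i : nat) : {vspace extW} :=
  wedgev (extpow U i) (extpow V (3 - i)).

Definition comp1 U V : 'End(extW) :=
  daddv_pi (grade U V 1) (grade U V 2 + grade U V 3).

Definition comp2 U V : 'End(extW) :=
  daddv_pi (grade U V 2) (grade U V 1 + grade U V 3).

Definition complement U V : Prop := (U + V = fullv)%VS /\ (U :&: V = 0)%VS.

(* Coordinates on a 3-dimensional subspace E. *)
Definition pt (E : {vspace extW}) (x : 'rV[K]_3) : extW :=
  \sum_(i < 3) x 0 i *: (vbasis E)`_i.

(* The point of the Segre variety of P(U) x P(/\^2 V) in P(grade U V 1) with
   coordinates (x, y). *)
Definition segre U V (x y : 'rV[K]_3) : extW :=
  wedge (pt (emb U) x) (pt (extpow V 2) y).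

(* F is the section of O(2, 2) on P(U) x P(/\^2 V), in coordinates, defining
   V_A. *)
Definition VA_section A U V (F : {mpoly K[3 + 3]}) : Prop :=
  bihomog 2 2 F /\
  forall (x y : 'rV[K]_3) (a : extW), a \in A -> comp1 U V a = segre U V x y ->
    ev (row_mx x y) F = wedge (comp1 U V a) (comp2 U V a) [set: 'I_6].

(* The support in P(grade U V 1) of the divisor of F. *)
Definition in_VA U V (F : {mpoly K[3 + 3]}) (t : extW) : Prop :=
  exists x y : 'rV[K]_3,
    [/\ x != 0, y != 0, t = segre U V x y & ev (row_mx x y) F = 0].

Definition Ph U V (h : 'I_5 -> {vspace W}) : {vspace extW} :=
  (comp1 U V @: hspan h)%VS.

End VerraThreefold.

(* Main.v *)
(* Each plane h_i with i < 5 meets u = h_5 in one point x_i and spans with u the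
   hyperplane H, so it projects to (x_i, H) in the Segre variety.  The x_i span
   u: otherwise the quadrics which the Grassmannian cuts out on <h> would
   contain a line of points and <h>.G would be infinite.  Hence
   P_h = P_u x {H}, and V_A contains it because a_1 /\ a_2 is computed in
   /\^6 H = 0.

   For the rationality, the differential of the equation F of V_A at (x, y)
   vanishes exactly when a + t u is decomposable for some t, so by finiteness
   only finitely many x lie below singular points of V_A.  Writing y = s H + z,
   F(x, y) = s B(x, z) + C(x, z) with B = z_1 c_1 + z_2 c_2, where the common
   zeros of the conics c_1 and c_2 are singular points of V_A.  A factorization
   of F would give a common component of c_1 and c_2, or a factor B of F; both
   give singular points over infinitely many x.  So F is irreducible, and
   s = - C / B makes V_A birational to P^2 x P^1. *)

Require Import Defs.
From HB Require Import structures.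
From mathcomp Require Import all_boot all_order all_algebra.
From mathcomp Require Import reals complex mpoly ring lra zify.

Set Implicit Arguments.
Unset Strict Implicit.
Unset Printing Implicit Defensive.

Import Order.TTheory GRing.Theory Num.Theory.
Local Open Scope ring_scope.

(** * Polynomials as functions of one variable *)

(** The divisor is studied through a polar form [q x y z w]: the Segre point over [(x, y)] is paired
    with a lift to [A] of the Segre point over [(z, w)]. Lifts exist by maximality of [A], their
    second component is determined because [A] meets [W_u^2] only in [/\^3 U], and isotropy makes
    [q] symmetric in the two pairs. The derivatives of [F] are then twice values of [q], so at a
    singular point the lift [a] is orthogonal to the 5-dimensional tangent space of the Segre cone.
    In a frame adapted to [(x, y)] this means five vanishing coefficients, just those that obstruct
    writing [a] as a decomposable trivector up to [/\^3 U]. The same computation inside [<h>] shows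
    that the [x_i] span [u]; there finiteness enters as a count, six planes against five. For
    irreducibility, each polynomial to be factored is linear in some variable, so degrees in one
    variable at a time control the factors. The contradictions need a plane curve to have points
    outside a given finite set, which is where algebraic closedness enters. *)

Lemma poly_nonroot (D : idomainType) (f : nat -> D) (p : {poly D}) :
  injective f -> p != 0 -> exists k, p.[f k] != 0.
Proof.
move=> f_inj p0; have [/allP roots_p|] := boolP (all (root p) (mkseq f (size p))).
  have := max_poly_roots p0 (introT allP roots_p).
  by rewrite mkseq_uniq // size_mkseq ltnn => /(_ isT).
by case/allPn => x /mapP [k _ ->]; rewrite rootE; exists k.
Qed.

(** Compare coefficients: [b != 0] forces [q != 0], and then the vanishing of the higher
    coefficients of [q%:P * P] bounds the degree of [P]. *)
Lemma poly_linear_mul (D : idomainType) (b c q : D) (P : {poly D}) :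
  b != 0 -> 'X * b%:P + c%:P = q%:P * P ->
  exists r1 r0, [/\ forall a, P.[a] = a * r1 + r0, b = q * r1 & c = q * r0].
Proof.
move=> b0 E; have coef k := congr1 (fun P : {poly _} => P`_k) E.
have E0 : c = q * P`_0.
  by have := coef 0%N; rewrite coefD coefXM !coefCM !coefC /= add0r.
have E1 : b = q * P`_1.
  by have := coef 1%N; rewrite coefD coefXM !coefCM !coefC /= addr0.
have q0 : q != 0 by apply: contraNneq b0 => q0; rewrite E1 q0 mul0r.
have sz : (size P <= 2)%N.
  apply/leq_sizeP => -[|[|k]] // _; have := coef k.+2.
  rewrite coefD coefXM !coefCM !coefC /= addr0 => /esym/eqP.
  by rewrite mulf_eq0 (negbTE q0) => /eqP.
exists P`_1, P`_0; split=> // a.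
rewrite (horner_coef_wide _ sz) !big_ord_recr big_ord0 /= add0r.
by rewrite expr0 expr1 mulr1 addrC mulrC.
Qed.

Lemma poly_linear_const (D : idomainType) (b c d : D) :
  'X * b%:P + c%:P = d%:P -> b = 0.
Proof.
move=> /(congr1 (fun P : {poly _} => P`_1)).
by rewrite coefD coefXM !coefC /= addr0.
Qed.

Lemma poly_linear_size (D : idomainType) (b c : D) (P Q : {poly D}) :
  b != 0 -> 'X * b%:P + c%:P = P * Q -> (size P <= 1)%N \/ (size Q <= 1)%N.
Proof.
move=> b0 E; have sE : size ('X * b%:P + c%:P) = 2%N.
  by rewrite mulrC size_MXaddC polyC_eq0 (negbTE b0) size_polyC b0.
have : P * Q != 0 by rewrite -E -size_poly_gt0 sE.
rewrite mulf_eq0 negb_or => /andP [P0 Q0]; move: sE; rewrite E size_mul //.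
move: P0 Q0; rewrite -!size_poly_gt0; lia.
Qed.

(* [p] as a polynomial in ['X_i]; the coefficients stay in [{mpoly K[n]}], so
   that being free of ['X_i] is the equality of [uni i p] with [p%:P]. *)
HB.lock Definition uni (K : fieldType) n (i : 'I_n) (p : {mpoly K[n]}) :
    {poly {mpoly K[n]}} :=
  mmap (polyC \o @mpolyC n K) (fun j => if j == i then 'X else ('X_j)%:P) p.

Section OneVariable.
Variables (K : fieldType) (n : nat).
Implicit Types (i j : 'I_n) (p q : {mpoly K[n]}).

(** Constants and variables generate the ring, so this suffices to compare ring morphisms such as
    [uni], [peval] and evaluations. *)
Lemma mpoly_ring_ind (P : {mpoly K[n]} -> Prop) :
  (forall c, P c%:MP) -> (forall i, P 'X_i) ->
  (forall p q, P p -> P q -> P (p + q)) ->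
  (forall p q, P p -> P q -> P (p * q)) -> forall p, P p.
Proof.
move=> PC PX PD PM; elim/mpolyind => [|c m p _ _ Pp]; first by rewrite -mpolyC0.
apply: (PD) => //; rewrite -mul_mpolyC; apply: (PM) => //.
rewrite mpolyXE_id; elim/big_ind: _ => [|//|i _]; first by rewrite -mpolyC1.
by elim: (m i) => [|k IH]; [rewrite expr0 -mpolyC1 | rewrite exprS; apply: PM].
Qed.

Lemma uni_is_additive i : additive (@uni K n i).
Proof. by move=> p q; rewrite unlock; exact: mmapB. Qed.

Lemma uni_is_multiplicative i : multiplicative (@uni K n i).
Proof. by rewrite unlock; exact: mmap_is_multiplicative. Qed.

HB.instance Definition _ i := GRing.isAdditive.Build _ _ (@uni K n i)
  (uni_is_additive i).
HB.instance Definition _ i := GRing.isMultiplicative.Build _ _ (@uni K n i)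
  (uni_is_multiplicative i).

Lemma uniD i p q : uni i (p + q) = uni i p + uni i q.
Proof. exact: raddfD. Qed.

Lemma uniM i p q : uni i (p * q) = uni i p * uni i q.
Proof. exact: rmorphM. Qed.

Lemma uniC i (c : K) : uni i c%:MP = (c%:MP)%:P.
Proof. by rewrite unlock mmapC. Qed.

Lemma uniX i j : @uni K n i 'X_j = if j == i then 'X else ('X_j)%:P.
Proof. by rewrite unlock mmapX mmap1U. Qed.

Lemma uniK i p : (uni i p).['X_i] = p.
Proof.
elim/mpoly_ring_ind: p => [c|j|p q IHp IHq|p q IHp IHq].
- by rewrite uniC hornerC.
- by rewrite uniX; case: eqP => [->|_]; rewrite ?hornerX ?hornerC.
- by rewrite uniD hornerD IHp IHq.
- by rewrite uniM hornerM IHp IHq.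
Qed.

Definition upd (v : 'I_n -> K) i c := fun j => if j == i then c else v j.

Lemma meval_upd v i c p :
  p.@[upd v i c] = (map_poly (meval v) (uni i p)).[c].
Proof.
elim/mpoly_ring_ind: p => [d|j|p q IHp IHq|p q IHp IHq].
- by rewrite uniC map_polyC hornerC /= !mevalC.
- rewrite mevalXU uniX /upd; case: eqP => _; first by rewrite map_polyX hornerX.
  by rewrite map_polyC hornerC /= mevalXU.
- by rewrite mevalD uniD rmorphD hornerD IHp IHq.
- by rewrite mevalM uniM rmorphM hornerM IHp IHq.
Qed.

Definition free_of i p := uni i p = p%:P.

Lemma free_size i p : (size (uni i p) <= 1)%N -> free_of i p.
Proof. by move=> /size1_polyC E; rewrite /free_of -{2}(uniK i p) E hornerC. Qed.

Lemma freeC i (c : K) : free_of i c%:MP.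
Proof. exact: uniC. Qed.

Lemma freeX i j : j != i -> free_of i 'X_j.
Proof. by move=> /negbTE ji; rewrite /free_of uniX ji. Qed.

Lemma freeD i p q : free_of i p -> free_of i q -> free_of i (p + q).
Proof. by rewrite /free_of uniD polyCD => -> ->. Qed.

Lemma freeM i p q : free_of i p -> free_of i q -> free_of i (p * q).
Proof. by rewrite /free_of uniM polyCM => -> ->. Qed.

Lemma free_sum i (I : Type) (r : seq I) (P : pred I) (F : I -> {mpoly K[n]}) :
  (forall k, P k -> free_of i (F k)) -> free_of i (\sum_(k <- r | P k) F k).
Proof.
move=> Ff; elim/big_ind: _ => //; last exact: freeD.
by rewrite -mpolyC0; apply: freeC.
Qed.

Lemma uni_inj i : injective (@uni K n i).
Proof. by move=> p q E; rewrite -(uniK i p) E uniK. Qed.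

Lemma uni_eq0 i p : (uni i p == 0) = (p == 0).
Proof. by rewrite -(inj_eq (@uni_inj i)) rmorph0. Qed.

Lemma uni_size_mul i p q : p * q != 0 ->
  (size (uni i (p * q))).+1 = (size (uni i p) + size (uni i q))%N.
Proof.
rewrite mulf_eq0 negb_or -!(uni_eq0 i) => /andP [p0 q0].
rewrite uniM size_mul //.
by move: p0; rewrite -size_poly_gt0; case: (size (uni i p)).
Qed.

Lemma free_mul i p q : p * q != 0 -> free_of i (p * q) -> free_of i p /\ free_of i q.
Proof.
move=> pq0 fpq; have := uni_size_mul i pq0.
move: pq0; rewrite mulf_eq0 negb_or -!(uni_eq0 i) -!size_poly_gt0.
move=> /andP [p0 q0]; rewrite fpq size_polyC => E.
by split; apply: free_size; move: E p0 q0; case: (_ != 0); lia.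
Qed.

Lemma free_linear_mul i b c q r : b != 0 -> free_of i b -> free_of i c -> free_of i q ->
  'X_i * b + c = q * r ->
  exists r1 r0, [/\ r = 'X_i * r1 + r0, b = q * r1 & c = q * r0].
Proof.
move=> b0 fb fc fq E; have: uni i ('X_i * b + c) = uni i (q * r) by rewrite E.
rewrite uniD !uniM uniX eqxx fb fc fq => {E} E.
have [r1 [r0 [sr -> ->]]] := poly_linear_mul b0 E.
by exists r1, r0; split=> //; rewrite -(uniK i r) sr.
Qed.

Lemma linear_mul_free i b c q r : b != 0 -> free_of i b -> free_of i c ->
  'X_i * b + c = q * r -> free_of i q \/ free_of i r.
Proof.
move=> b0 fb fc E.
have : uni i ('X_i * b + c) = uni i (q * r) by rewrite E.
rewrite uniD !uniM uniX eqxx fb fc => {}E.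
by case: (poly_linear_size b0 E) => /free_size; [left | right].
Qed.

Lemma free_linear i b c : free_of i b -> free_of i c ->
  free_of i ('X_i * b + c) -> b = 0.
Proof.
move=> fb fc; rewrite {1}/free_of uniD uniM uniX eqxx fb fc.
exact: poly_linear_const.
Qed.

End OneVariable.

(** * Polynomials as functions on an infinite field *)

Section Evaluation.
Variables (K : numFieldType) (n : nat).
Implicit Types (i : 'I_n) (p q : {mpoly K[n]}) (v : 'I_n -> K).

Lemma mpolyC_nat_inj : injective (fun k => (k%:R : K)%:MP : {mpoly K[n]}).
Proof. by move=> a b /eqP; rewrite -subr_eq0 -mpolyCB mpolyC_eq0 subr_eq0 eqr_nat => /eqP. Qed.

(** Partial evaluation stays in the same ring, so that the variables can be specialized one at a
    time. *)
Definition peval (s : seq 'I_n) v : {mpoly K[n]} -> {mpoly K[n]} :=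
  mmap (@mpolyC n K) (fun i => if i \in s then (v i)%:MP else 'X_i).

Lemma pevalD s v p q : peval s v (p + q) = peval s v p + peval s v q.
Proof. exact: mmapD. Qed.

Lemma pevalM s v p q : peval s v (p * q) = peval s v p * peval s v q.
Proof. exact: (rmorphM (mmap _ _)). Qed.

Lemma pevalC s v c : peval s v c%:MP = c%:MP.
Proof. exact: mmapC. Qed.

Lemma pevalX s v i : peval s v 'X_i = if i \in s then (v i)%:MP else 'X_i.
Proof. by rewrite /peval mmapX mmap1U. Qed.

Lemma peval_cons i s v c p : i \notin s ->
  peval (i :: s) (upd v i c) p = (uni i (peval s v p)).[c%:MP].
Proof.
move=> si; elim/mpoly_ring_ind: p => [d|j|p q IHp IHq|p q IHp IHq].
- by rewrite !pevalC uniC hornerC.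
- rewrite !pevalX inE /upd; case: eqP => [->|ji] /=.
    by rewrite (negbTE si) uniX eqxx hornerX.
  case: ifP => _; first by rewrite uniC hornerC.
  by rewrite uniX; case: eqP => // _; rewrite hornerC.
- by rewrite !pevalD uniD hornerD IHp IHq.
- by rewrite !pevalM uniM hornerM IHp IHq.
Qed.

(** The variables are specialized in turn; at each stage [poly_nonroot], over the domain [{mpoly
    K[n]}], yields a natural number that keeps the polynomial nonzero. *)
Lemma mpoly_nonroot p : p != 0 -> exists v, p.@[v] != 0.
Proof.
move=> p0; suff [v] : exists v, peval (enum 'I_n) v p != 0.
  have -> : peval (enum 'I_n) v p = (p.@[v])%:MP.
    elim/mpoly_ring_ind: p {p0} => [d|j|p q IHp IHq|p q IHp IHq].
    - by rewrite pevalC mevalC.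
    - by rewrite pevalX mem_enum mevalXU.
    - by rewrite pevalD IHp IHq mevalD mpolyCD.
    - by rewrite pevalM IHp IHq mevalM mpolyCM.
  by rewrite mpolyC_eq0; exists v.
elim: (enum 'I_n) (enum_uniq 'I_n) => [_|i s IHs /= /andP [si /IHs [v pv]]].
  exists (fun=> 0); suff -> : peval [::] (fun=> 0) p = p by [].
  elim/mpoly_ring_ind: p {p0} => [d|j|p q IHp IHq|p q IHp IHq].
  - by rewrite pevalC.
  - by rewrite pevalX.
  - by rewrite pevalD IHp IHq.
  - by rewrite pevalM IHp IHq.
have [k pk] : exists k : nat, (uni i (peval s v p)).[(k%:R : K)%:MP] != 0.
  by apply: poly_nonroot; [exact: mpolyC_nat_inj | rewrite uni_eq0].
by exists (upd v i k%:R); rewrite peval_cons.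
Qed.

Lemma mpoly_ev_inj p q : (forall v : 'rV_n, ev v p = ev v q) -> p = q.
Proof.
move=> E; apply/eqP; rewrite -subr_eq0; apply/negPn/negP => /mpoly_nonroot [v].
have := E (\row_i v i); rewrite /ev => {}E.
rewrite mevalB subr_eq0 => /eqP[]; move: E.
by rewrite !(@meval_eq _ _ (fun i => (\row_i v i) 0 i) v) // => i; rewrite mxE.
Qed.

End Evaluation.

(** * Irreducibility of polynomials linear in a variable *)

Section Irreducibility.
Variables (K : fieldType) (n : nat).
Implicit Types (i : 'I_n) (p q r : {mpoly K[n]}).

Lemma mpolyX_neq0 i : 'X_i != 0 :> {mpoly K[n]}.
Proof. by rewrite -msize_poly_eq0 msizeX. Qed.

(* A factor of ['X_s * B + C] free of ['X_s] divides [B]; and as [B] is linear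
   in ['X_a], either this factor or its cofactor in [B] divides both [c1] and
   [c2]. *)
Lemma irreducible_bilinear (s a b : 'I_n) c1 c2 C :
  a != s -> b != s -> a != b ->
  c1 != 0 ->
  [/\ free_of s c1, free_of a c1 & free_of b c1] ->
  [/\ free_of s c2, free_of a c2 & free_of b c2] -> free_of s C ->
  (forall r w1 w2, c1 = r * w1 -> c2 = r * w2 -> r \is a GRing.unit) ->
  (forall q, 'X_s * ('X_a * c1 + 'X_b * c2) + C =
             ('X_a * c1 + 'X_b * c2) * q -> False) ->
  irreducible_mpoly ('X_s * ('X_a * c1 + 'X_b * c2) + C).
Proof.
move=> as_ bs ab c10 [fs1 fa1 fb1] [fs2 fa2 fb2] fsC prim noB.
set B := _ + 'X_b * c2.
have ba : b != a by rewrite eq_sym.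
have fbB : free_of a ('X_b * c2) by apply: freeM => //; apply: freeX.
have fsB : free_of s B by apply: freeD; apply: freeM => //; apply: freeX.
(* [d] divides the coefficients [c1] and ['X_b * c2] of [B] in ['X_a]. It is free of ['X_b] since it
   divides [c1], hence it divides [c2] as well. *)
have unit_dvd d w : free_of a d -> B = d * w -> d \is a GRing.unit.
  move=> fd E; have [w1 [w0 [_ E1 E0]]] := free_linear_mul c10 fa1 fbB fd E.
  have [c20|c20] := eqVneq c2 0; first by apply: (prim _ w1 0); rewrite ?mulr0.
  have [fbd _] : free_of b d /\ free_of b w1 by apply: free_mul; rewrite -E1.
  have := @free_linear_mul _ _ b c2 0 d w0 c20 fb2.
  rewrite addr0 => /(_ _ fbd E0) [|r1 [_ [_ E2 _]]].
    by rewrite -mpolyC0; apply: freeC.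
  exact: prim E1 E2.
(* If [B] were 0, then 0 would be a divisor of [B] free of ['X_a], hence a unit. *)
have B0 : B != 0.
  apply: contraTneq isT => B0; have /unit_dvd : free_of a (0 : {mpoly K[n]}).
    by rewrite -mpolyC0; apply: freeC.
  by move=> /(_ 0); rewrite mulr0 unitr0 B0 => /(_ erefl).
(* [r] divides [B], with cofactor [q1], and one of the two is free of ['X_a], hence a unit. If it is
   [q1], then [B] divides the whole polynomial, against [noB]. *)
have half r q : free_of s r -> 'X_s * B + C = r * q ->
    r \is a GRing.unit \/ q \is a GRing.unit.
  move=> fr E; have [q1 [q0 [Eq E1 E0]]] := free_linear_mul B0 fsB fsC fr E.
  have [fa|fa] := linear_mul_free c10 fa1 fbB E1; first by left; apply: unit_dvd E1.
  have uq1 : q1 \is a GRing.unit by apply: (unit_dvd q1 r) => //; rewrite mulrC.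
  by case: (noB (q1^-1 * q)); rewrite -/B E E1 -mulrA mulVKr.
have F0 : 'X_s * B + C != 0.
  apply/eqP => F0; move: B0; rewrite (free_linear fsB fsC) ?eqxx // F0.
  by rewrite -mpolyC0; apply: freeC.
split=> //; last first.
  move=> q r E; have [fq|fr] := linear_mul_free B0 fsB fsC E; first exact: half.
  by rewrite [RHS]mulrC in E; case: (half r q fr E) => u; [right | left].
(* A unit divides 1, so it is free of ['X_s], and then [B] would be 0. *)
apply/negP => uF; have E : ('X_s * B + C) * ('X_s * B + C)^-1 = 1 by apply: mulrV.
have fF : free_of s ('X_s * B + C).
  apply: (@free_mul _ _ s _ ('X_s * B + C)^-1 _ _).1; rewrite E ?oner_neq0 //.
  by rewrite -mpolyC1; apply: freeC.
by move: B0; rewrite (free_linear fsB fsC fF) eqxx.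
Qed.

End Irreducibility.

(** * Zeros over an algebraically closed field *)

Section Zeros.
Variables (K : numClosedFieldType) (n : nat).
Implicit Types (i : 'I_n) (p q r : {mpoly K[n]}).

Lemma meval_upd_free i p v c : free_of i p -> p.@[upd v i c] = p.@[v].
Proof. by move=> fp; rewrite meval_upd fp map_polyC hornerC. Qed.

(** Fix the other coordinates so that neither [m] nor the leading coefficient of [r] in ['X_i]
    vanishes. What remains of [r] has positive degree in ['X_i], hence a root, and moving to it does
    not affect [m]. *)
Lemma root_avoiding i r m : ~ free_of i r -> m != 0 -> free_of i m ->
  exists v, r.@[v] = 0 /\ m.@[v] != 0.
Proof.
move=> nfr m0 fm; set P := uni i r.
have szP : (1 < size P)%N by rewrite ltnNge; apply/negP => /free_size.
have P0 : P != 0 by rewrite -size_poly_gt0 ltnW.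
have [v] : exists v, (lead_coef P * m).@[v] != 0.
  by apply: mpoly_nonroot; rewrite mulf_neq0 // lead_coef_eq0.
rewrite mevalM mulf_eq0 negb_or => /andP [lv mv].
have [c rc] : exists c, root (map_poly (meval v) P) c.
  by apply/closed_rootP; rewrite size_map_poly_id0 // gtn_eqF.
exists (upd v i c); rewrite (meval_upd_free _ _ fm); split=> //.
by rewrite meval_upd; apply/eqP.
Qed.

Lemma free_const p : (forall i, free_of i p) -> exists c, p = c%:MP.
Proof.
move=> fp; exists p.@[fun=> 0]; apply: mpoly_ev_inj => v; rewrite /ev mevalC.
suff E (s : seq 'I_n) : p.@[fun j => if j \in s then 0 else v 0 j] = p.@[v 0].
  by rewrite -(E (enum 'I_n)); apply: meval_eq => i; rewrite mem_enum.
elim: s => [|i s <-]; first exact: meval_eq.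
rewrite -[RHS](meval_upd_free _ 0 (fp i)); apply: meval_eq => j.
by rewrite /upd inE; case: (j == i).
Qed.

End Zeros.

Section ThreePlusThree.
Variable K : numClosedFieldType.
Implicit Types (p q r : {mpoly K[3 + 3]}) (x y : 'rV[K]_3).

Lemma ord3_cases (P : 'I_3 -> Prop) :
  P (@Ordinal 3 0 isT) -> P (@Ordinal 3 1 isT) -> P (@Ordinal 3 2 isT) ->
  forall i, P i.
Proof.
move=> P0 P1 P2 [[|[|[|//]]] lti].
- by have -> : Ordinal lti = @Ordinal 3 0 isT by apply: val_inj.
- by have -> : Ordinal lti = @Ordinal 3 1 isT by apply: val_inj.
- by have -> : Ordinal lti = @Ordinal 3 2 isT by apply: val_inj.
Qed.

(** A plane curve has points outside any finite set. If the coordinate [i] occurs in [r], the lines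
    joining the [i]-th coordinate point to the points of [ds] have equations free of that
    coordinate, and [root_avoiding] gives a zero of [r] off all of them. The case [r = 0] is
    included. *)
Lemma nonunit_zeros r (ds : seq 'rV[K]_3) :
  r \isn't a GRing.unit -> (forall j : 'I_3, free_of (rshift 3 j) r) ->
  exists x y, [/\ x != 0, ev (row_mx x y) r = 0 &
                  forall d c, d \in ds -> x <> c *: d].
Proof.
move=> ur fr; pose X (i : 'I_3) : {mpoly K[3 + 3]} := 'X_(lshift 3 i).
have [i nfi] : exists i : 'I_3, ~ free_of (lshift 3 i) r \/ r = 0.
  have [/forallP fx|/existsP [i /eqP nf]] :=
      boolP [forall i : 'I_3, uni (lshift 3 i) r == r%:P]; last first.
    by exists i; left.
  have [|c Ec] := @free_const _ _ r.
    by move=> k; case: (split_ordP k) => j ->; [apply/eqP/fx | apply: fr].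
  exists ord0; right; apply/eqP; move: ur; apply: contraNT.
  by rewrite Ec mpolyC_eq0 => c0; apply: rmorph_unit; rewrite unitfE.
have [j [k [ji ki jk]]] : exists j k : 'I_3, [/\ j != i, k != i & j != k].
  move: i {nfi}; apply: ord3_cases;
    [exists (@Ordinal 3 1 isT), (@Ordinal 3 2 isT)
    |exists (@Ordinal 3 0 isT), (@Ordinal 3 2 isT)
    |exists (@Ordinal 3 0 isT), (@Ordinal 3 1 isT)]; by [].
(* A nonzero form in [X j] and [X k] vanishing at [d]. *)
pose l (d : 'rV[K]_3) : {mpoly K[3 + 3]} := if (d 0 j == 0) && (d 0 k == 0) then X j
            else d 0 k *: X j - d 0 j *: X k.
have lsh_neq (a b : 'I_3) : a != b -> lshift 3 a != lshift 3 b.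
  by apply: contra_neq; apply: lshift_inj.
have fX a : a != i -> free_of (lshift 3 i) (X a).
  by move=> ai; apply: freeX; apply: lsh_neq.
have fl d : free_of (lshift 3 i) (l d).
  rewrite /l; case: ifP => _; first exact: fX.
  rewrite -scaleNr -!mul_mpolyC.
  by apply: freeD; (apply: freeM; [exact: freeC | exact: fX]).
have l0 d : l d != 0.
  rewrite /l; case: ifP => [_|/negbT]; first exact: mpolyX_neq0.
  apply: contraNneq => E; pose pt a : 'rV[K]_(3 + 3) := delta_mx 0 (lshift 3 a).
  have ptE a b : ev (pt a) (X b) = (a == b)%:R.
    by rewrite /ev mevalXU mxE eqxx /= (inj_eq (@lshift_inj _ _)) eq_sym.
  have := congr1 (ev (pt j)) E; have := congr1 (ev (pt k)) E.
  rewrite /ev !mevalB !mevalZ !meval0 -!/(ev _ _) !ptE !eqxx (eq_sym k) (negbTE jk).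
  rewrite !mulr0 !mulr1 sub0r subr0 => Ej Ek.
  by rewrite Ek -(opprK (d 0 j)) Ej oppr0 eqxx.
(* The factor [X j] makes the point that is found different from 0. *)
pose m := X j * \prod_(d <- ds) l d.
have fm : free_of (lshift 3 i) m.
  apply: freeM; first exact: fX.
  elim/big_ind: _ => [|p q|d _]; [|exact: freeM|exact: fl];
    rewrite -mpolyC1; apply: freeC.
have m0 : m != 0.
  rewrite mulf_neq0 ?mpolyX_neq0 //.
  by elim/big_ind: _ => [|p q|d _]; [exact: oner_neq0 | exact: mulf_neq0 | exact: l0].
have [v [rv mv]] : exists v, r.@[v] = 0 /\ m.@[v] != 0.
  case: nfi => [nfi|->]; first exact: root_avoiding nfi m0 fm.
  by have [v mv] := mpoly_nonroot m0; exists v; rewrite meval0.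
exists (\row_a v (lshift 3 a)), (\row_a v (rshift 3 a)).
have vE p : ev (row_mx (\row_a v (lshift 3 a)) (\row_a v (rshift 3 a))) p = p.@[v].
  apply: meval_eq => a; case: (split_ordP a) => b ->.
    by rewrite row_mxEl mxE.
  by rewrite row_mxEr mxE.
move: mv; rewrite mevalM mevalXU mulf_eq0 negb_or => /andP [vj mv].
split; last move=> d c dds E.
- by apply: contraNneq vj => /rowP /(_ j); rewrite !mxE => ->.
- by rewrite vE.
have va a : v (lshift 3 a) = c * d 0 a.
  by move/rowP/(_ a): E; rewrite !mxE.
case/eqP: mv; rewrite (perm_big _ (perm_to_rem dds)) big_cons mevalM /l.
case: ifP => [/andP [/eqP dj0 _]|_].
  by rewrite mevalXU va dj0 mulr0 mul0r.
by rewrite mevalB !mevalZ !mevalXU !va; ring.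
Qed.
End ThreePlusThree.

(** * Bidegrees of sums and products *)

Section Bihomogeneous.
Variable K : fieldType.
Implicit Types p q : {mpoly K[3 + 3]}.

Lemma bihomogD d e p q : bihomog d e p -> bihomog d e q -> bihomog d e (p + q).
Proof. by move=> hp hq m /msuppD_le; rewrite mem_cat => /orP [/hp|/hq]. Qed.

Lemma bihomogZ d e c p : bihomog d e p -> bihomog d e (c *: p).
Proof. by move=> hp m /msuppZ_le /hp. Qed.

Lemma bihomogM d e d' e' p q :
  bihomog d e p -> bihomog d' e' q -> bihomog (d + d') (e + e') (p * q).
Proof.
move=> hp hq m /msuppM_le /allpairsP [[m1 m2] /= [/hp [<- <-] /hq [<- <-] ->]].
by split; rewrite -big_split; apply: eq_bigr => i _; rewrite mnmDE.
Qed.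

Lemma bihomog_sum d e (I : Type) (r : seq I) (P : pred I)
    (F : I -> {mpoly K[3 + 3]}) :
  (forall i, P i -> bihomog d e (F i)) -> bihomog d e (\sum_(i <- r | P i) F i).
Proof.
move=> hF; elim/big_ind: _ => //; last exact: bihomogD.
by move=> m; rewrite msupp0.
Qed.

Lemma bihomogXl i : bihomog 1 0 ('X_(lshift 3 i) : {mpoly K[3 + 3]}).
Proof.
move=> m; rewrite msuppX inE => /eqP ->; split.
  rewrite (bigD1 i) //= mnm1E eqxx big1 // => j ji.
  by rewrite mnm1E (inj_eq (@lshift_inj _ _)) eq_sym (negbTE ji).
by rewrite big1 // => j _; rewrite mnm1E eq_lrshift.
Qed.

Lemma bihomogXr i : bihomog 0 1 ('X_(rshift 3 i) : {mpoly K[3 + 3]}).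
Proof.
move=> m; rewrite msuppX inE => /eqP ->; split.
  by rewrite big1 // => j _; rewrite mnm1E eq_rlshift.
rewrite (bigD1 i) //= mnm1E eqxx big1 // => j ji.
by rewrite mnm1E (inj_eq (@rshift_inj _ _)) eq_sym (negbTE ji).
Qed.

End Bihomogeneous.

Section TangentProduct.
Variables (K : numFieldType) (n : nat).
Implicit Types (p q : {mpoly K[n]}) (v w : 'rV[K]_n).

Lemma mpoly_line p v w :
  exists P : {poly K}, forall e, P.[e] = ev (v + e *: w) p.
Proof.
elim/mpoly_ring_ind: p => [c|i|p q [P hP] [Q hQ]|p q [P hP] [Q hQ]].
- by exists c%:P => e; rewrite hornerC /ev mevalC.
- exists ((v 0 i)%:P + (w 0 i) *: 'X) => e.
  by rewrite hornerD hornerZ hornerC hornerX /ev mevalXU !mxE mulrC.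
- by exists (P + Q) => e; rewrite hornerD hP hQ /ev mevalD.
- by exists (P * Q) => e; rewrite hornerM hP hQ /ev mevalM.
Qed.

Lemma poly_ev_inj (P Q : {poly K}) : (forall a, P.[a] = Q.[a]) -> P = Q.
Proof.
move=> E; apply/eqP; rewrite -subr_eq0; apply/negPn/negP => PQ.
have [k|k] := @poly_nonroot _ (fun k : nat => k%:R : K) _ _ PQ.
  by move=> l /eqP; rewrite eqr_nat => /eqP.
by rewrite hornerD hornerN E subrr eqxx.
Qed.

(** At a common zero of its factors a product vanishes to second order along every line. Restriction
    to the line through [v] directed by [w] turns derivatives into coefficients of univariate
    polynomials. *)
Lemma tangent_mul p q v w a b : ev v p = 0 -> ev v q = 0 ->
  (forall e, ev (v + e *: w) (p * q) = a * e + b * e ^+ 2) -> a = 0.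
Proof.
move=> pv qv E; have [P hP] := mpoly_line p v w; have [Q hQ] := mpoly_line q v w.
have hv : v + 0 *: w = v by rewrite scale0r addr0.
have P0 : P`_0 = 0 by rewrite -horner_coef0 hP hv.
have Q0 : Q`_0 = 0 by rewrite -horner_coef0 hQ hv.
have /(congr1 (fun P : {poly K} => P`_1)) : P * Q = a *: 'X + b *: 'X^2.
  apply: poly_ev_inj => e; rewrite hornerM hP hQ hornerD !hornerZ hornerX hornerXn.
  by rewrite -E /ev mevalM.
rewrite coefM !big_ord_recr big_ord0 /= P0 Q0 coefD !coefZ coefX coefXn /=.
by rewrite mul0r mulr0 mulr1 mulr0 !addr0.
Qed.

End TangentProduct.

(** * Conic bundles in P^2 x P^2 with a constant section *)

Section ConicBundle.
Variable K : numClosedFieldType.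
Local Notation V3 := 'rV[K]_3.
Implicit Types (x y z w : V3) (a b c s : K).

Local Notation o0 := (@Ordinal 3 0 isT).
Local Notation o1 := (@Ordinal 3 1 isT).
Local Notation o2 := (@Ordinal 3 2 isT).

Lemma sum3 (M : nmodType) (f : 'I_3 -> M) : \sum_i f i = f o0 + f o1 + f o2.
Proof.
rewrite !big_ord_recr big_ord0 /= add0r.
by congr (f _ + f _ + f _); apply: val_inj.
Qed.

(** In the rank factorization of [x] the left factor is an invertible scalar, so [x] is a multiple
    of the first row of the invertible matrix [row_ebase x]. *)
Lemma unitmx_first_row x : x != 0 ->
  exists N : 'M[K]_3, N \in unitmx /\ row o0 N = x.
Proof.
move=> x0; have rx : \rank x = 1%N by apply/eqP; rewrite rank_rV x0.
have cu := col_ebase_unit x; have := mulmx_ebase x; rewrite rx => Ex.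
exists ((col_ebase x) 0 0 *: row_ebase x); split.
  rewrite unitmxZ ?row_ebase_unit // unitfE.
  by move: cu; rewrite unitmxE det_mx11 unitfE.
rewrite -[RHS]Ex (mx11_scalar (col_ebase x)) mxE eqxx mulr1n mul_scalar_mx -scalemxAl.
apply/rowP => j; rewrite !mxE; congr (_ * _).
by rewrite sum3 !mxE /= mul1r !mul0r !addr0.
Qed.

(** [q] is the polar form of the equation [q x y x y = 0]: by [q_sym], its derivatives in the
    directions of [x] and [y] are twice [q z y x y] and twice [q x z x y]. So [singular_finite] says
    that the singular points lie over points of [ds], and [q_eta] puts [eta] on every fibre over
    [x]. *)
Variables (q : V3 -> V3 -> V3 -> V3 -> K) (eta : V3) (ds : seq V3).
Hypothesis qx : forall a x x' y z w,
  q (a *: x + x') y z w = a * q x y z w + q x' y z w.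
Hypothesis qy : forall a x y y' z w,
  q x (a *: y + y') z w = a * q x y z w + q x y' z w.
Hypothesis q_sym : forall x y z w, q x y z w = q z w x y.
Hypothesis eta0 : eta != 0.
Hypothesis q_eta : forall x z, q x eta z eta = 0.
Hypothesis singular_finite : forall x y, x != 0 -> y != 0 ->
  (forall z, q z y x y = 0) -> (forall z, q x z x y = 0) ->
  exists2 d, d \in ds & exists c, x = c *: d.

Let q0x y z w : q 0 y z w = 0.
Proof.
by apply/(addrI (q 0 y z w)); have := qx 1 0 0 y z w; rewrite scaler0 !addr0 mul1r.
Qed.

Let q0y x z w : q x 0 z w = 0.
Proof.
by apply/(addrI (q x 0 z w)); have := qy 1 x 0 0 z w; rewrite scaler0 !addr0 mul1r.
Qed.

Let qxD x x' y z w : q (x + x') y z w = q x y z w + q x' y z w.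
Proof. by rewrite -[x]scale1r qx mul1r scale1r. Qed.

Let qyD x y y' z w : q x (y + y') z w = q x y z w + q x y' z w.
Proof. by rewrite -[y]scale1r qy mul1r scale1r. Qed.

Let qxZ a x y z w : q (a *: x) y z w = a * q x y z w.
Proof. by rewrite -[a *: x]addr0 qx q0x addr0. Qed.

Let qyZ a x y z w : q x (a *: y) z w = a * q x y z w.
Proof. by rewrite -[a *: y]addr0 qy q0y addr0. Qed.

Let qzD x z z' y w : q x y (z + z') w = q x y z w + q x y z' w.
Proof. by rewrite !(q_sym x) qxD. Qed.

Let qwD x z y w w' : q x y z (w + w') = q x y z w + q x y z w'.
Proof. by rewrite !(q_sym x) qyD. Qed.

Let qzZ a x z y w : q x y (a *: z) w = a * q x y z w.
Proof. by rewrite !(q_sym x) qxZ. Qed.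

Let qwZ a x z y w : q x y z (a *: w) = a * q x y z w.
Proof. by rewrite !(q_sym x) qyZ. Qed.

Let qx_sum x y z w : q x y z w = \sum_i x 0 i * q (delta_mx 0 i) y z w.
Proof. by rewrite {1}(row_sum_delta x) !sum3 !qxD !qxZ. Qed.

Let qz_sum x y z w : q x y z w = \sum_i z 0 i * q x y (delta_mx 0 i) w.
Proof. by rewrite q_sym qx_sum; apply: eq_bigr => i _; rewrite q_sym. Qed.

(** * The equation in a basis starting with the constant section *)

Section Basis.
Variable N : 'M[K]_3.
Hypothesis uN : N \in unitmx.
Hypothesis N0 : row o0 N = eta.

Let nn j := row j N.
Let pt s a b := s *: nn o0 + a *: nn o1 + b *: nn o2.
Let ptE y : y *m N = pt (y 0 o0) (y 0 o1) (y 0 o2).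
Proof. by rewrite mulmx_sum_row sum3. Qed.

(** In the coordinates of [pt s a b], the fibre over [x] has no term in [s ^ 2], by [q_eta]; [Bf] is
    the coefficient of [s] and [Cf] is the rest. *)
Let Bf x a b := a * (q x eta x (nn o1) *+ 2) + b * (q x eta x (nn o2) *+ 2).
Let Cf x a b := a * a * q x (nn o1) x (nn o1)
  + a * b * (q x (nn o1) x (nn o2) *+ 2) + b * b * q x (nn o2) x (nn o2).

Let qpt x s a b : q x (pt s a b) x (pt s a b) = s * Bf x a b + Cf x a b.
Proof.
rewrite /pt !(qyD, qwD, qyZ, qwZ) /Bf /Cf.
rewrite (q_sym _ (nn o1) _ (nn o0)) (q_sym _ (nn o2) _ (nn o0)).
by rewrite (q_sym _ (nn o2) _ (nn o1)) /nn N0 q_eta; ring.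
Qed.

Let BfZ c x a b : Bf (c *: x) a b = c ^+ 2 * Bf x a b.
Proof. by rewrite /Bf !(qxZ, qzZ); ring. Qed.
Let BfZr c x a b : Bf x (c * a) (c * b) = c * Bf x a b.
Proof. by rewrite /Bf; ring. Qed.
Let CfZ c x a b : Cf (c *: x) a b = c ^+ 2 * Cf x a b.
Proof. by rewrite /Cf !(qxZ, qzZ); ring. Qed.
Let CfZr c x a b : Cf x (c * a) (c * b) = c ^+ 2 * Cf x a b.
Proof. by rewrite /Cf; ring. Qed.

Section Polynomials.
Variables (n : nat) (Z : 'I_3 -> {mpoly K[n]}).

(** The coordinates [Z] are a parameter because these forms are needed both in the ring of P^2 x P^2
    and in that of P^3. *)
Definition qcoef (j l : 'I_3) : {mpoly K[n]} :=
  \sum_i \sum_k q (delta_mx 0 i) (nn j) (delta_mx 0 k) (nn l) *: (Z i * Z k).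
Definition qlin (a b : {mpoly K[n]}) : {mpoly K[n]} :=
  a * (qcoef o0 o1 *+ 2) + b * (qcoef o0 o2 *+ 2).
Definition qquad (a b : {mpoly K[n]}) : {mpoly K[n]} :=
  a * a * qcoef o1 o1 + a * b * (qcoef o1 o2 *+ 2) + b * b * qcoef o2 o2.

Lemma ev_qcoef v j l : ev v (qcoef j l) =
  let z := \row_i ev v (Z i) in q z (nn j) z (nn l).
Proof.
rewrite /= {1}/ev /qcoef raddf_sum /= qx_sum; apply: eq_bigr => i _.
rewrite raddf_sum /= qz_sum mulr_sumr; apply: eq_bigr => k _.
by rewrite mevalZ mevalM !mxE /ev; ring.
Qed.

Lemma ev_qlin v (a b : {mpoly K[n]}) : ev v (qlin a b) = Bf (\row_i ev v (Z i)) (ev v a) (ev v b).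
Proof. by rewrite /ev mevalD !mevalM !mevalMn -!/(ev _ _) !ev_qcoef /= /nn N0. Qed.

Lemma ev_qquad v (a b : {mpoly K[n]}) : ev v (qquad a b) = Cf (\row_i ev v (Z i)) (ev v a) (ev v b).
Proof. by rewrite /ev !mevalD !mevalM !mevalMn -!/(ev _ _) !ev_qcoef. Qed.

Lemma qcoef_free i j l : (forall k, free_of i (Z k)) -> free_of i (qcoef j l).
Proof.
move=> fZ; apply: free_sum => a _; apply: free_sum => b _.
by rewrite -mul_mpolyC; apply: freeM; [exact: freeC | exact: freeM].
Qed.

Lemma qcoef_homog j l : (forall k, Z k \is 1.-homog) -> qcoef j l \is 2.-homog.
Proof.
move=> hZ; apply: rpred_sum => a _; apply: rpred_sum => b _.
by apply: rpredZ; apply: (dhomogM (hZ a) (hZ b)).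
Qed.

End Polynomials.

Let X (i : 'I_3) : {mpoly K[3 + 3]} := 'X_(lshift 3 i).
Let Y (i : 'I_3) : {mpoly K[3 + 3]} := 'X_(rshift 3 i).
(** [L] gives the coordinates of [y] in the basis of the rows of [N]. [F] is the equation itself,
    and [F'] is the equation in these adapted coordinates, where it is linear in the single variable
    [Y o0]. *)
Let L (j : 'I_3) : {mpoly K[3 + 3]} := \sum_m invmx N m j *: Y m.
Let F' := Y o0 * qlin X (Y o1) (Y o2) + qquad X (Y o1) (Y o2).
Let F := L o0 * qlin X (L o1) (L o2) + qquad X (L o1) (L o2).

Let evX x y i : ev (row_mx x y) (X i) = x 0 i.
Proof. by rewrite /ev mevalXU row_mxEl. Qed.
Let evY x y i : ev (row_mx x y) (Y i) = y 0 i.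
Proof. by rewrite /ev mevalXU row_mxEr. Qed.
Let evL x y j : ev (row_mx x y) (L j) = (y *m invmx N) 0 j.
Proof.
rewrite /ev /L raddf_sum mxE; apply: eq_bigr => m _.
by rewrite /= mevalZ -/(ev _ _) evY mulrC.
Qed.
Let rowX x y : \row_i ev (row_mx x y) (X i) = x.
Proof. by apply/rowP => i; rewrite mxE evX. Qed.

Let evF' x y : ev (row_mx x y) F' = q x (y *m N) x (y *m N).
Proof.
rewrite ptE qpt /ev /F' mevalD mevalM -!/(ev _ _).
by rewrite ev_qlin ev_qquad rowX !evY.
Qed.

Let evF x y : ev (row_mx x y) F = q x y x y.
Proof.
rewrite -[in RHS](mulmxKV uN y) ptE qpt /ev /F mevalD mevalM -!/(ev _ _).
by rewrite ev_qlin ev_qquad rowX !evL.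
Qed.

Lemma qcoef_bihomog j l : bihomog 2 0 (qcoef X j l).
Proof.
apply: bihomog_sum => a _; apply: bihomog_sum => b _; apply: bihomogZ.
by apply: (@bihomogM _ 1 0 1 0); apply: bihomogXl.
Qed.

Let bL j : bihomog 0 1 (L j).
Proof. by apply: bihomog_sum => m _; apply: bihomogZ; apply: bihomogXr. Qed.

Let b2cc j l : bihomog 2 0 (qcoef X j l *+ 2).
Proof. by rewrite mulr2n; apply: bihomogD; apply: qcoef_bihomog. Qed.

Let bBB : bihomog 2 1 (qlin X (L o1) (L o2)).
Proof. by apply: bihomogD; apply: (@bihomogM _ 0 1 2 0) => //. Qed.

Let bF : bihomog 2 2 F.
Proof.
apply: bihomogD; first exact: (@bihomogM _ 0 1 2 1).
apply: bihomogD; first apply: bihomogD; apply: (@bihomogM _ 0 2 2 0) => //;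
  by [apply: (@bihomogM _ 0 1 0 1) | apply: qcoef_bihomog].
Qed.

Let fY i j : free_of (rshift 3 j) (X i).
Proof. by apply: freeX; rewrite eq_lrshift. Qed.

Let fYY i j : i != j -> free_of (rshift 3 j) (Y i).
Proof. by move=> ij; apply: freeX; rewrite (inj_eq (@rshift_inj _ _)). Qed.

Let fcc2 m j l : free_of (rshift 3 m) (qcoef X j l *+ 2).
Proof. by rewrite mulr2n; apply: freeD; apply: qcoef_free. Qed.

Let ev_cc2 x y j l : ev (row_mx x y) (qcoef X j l *+ 2) = q x (nn j) x (nn l) *+ 2.
Proof. by rewrite /ev mevalMn -/(ev _ _) ev_qcoef rowX. Qed.

(** At [(x, eta)] the derivatives in the direction of [x] vanish by [q_eta], and those in the
    direction of [y] are combinations of [q_eta] and the two given values. *)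
Let eta_singular x : x != 0 -> q x (nn o0) x (nn o1) *+ 2 = 0 ->
  q x (nn o0) x (nn o2) *+ 2 = 0 -> exists2 d, d \in ds & exists c, x = c *: d.
Proof.
move=> x0 /eqP; rewrite mulrn_eq0 /= => /eqP q1 /eqP; rewrite mulrn_eq0 /= => /eqP q2.
apply: (singular_finite x0 eta0) => [z|z]; first exact: q_eta.
rewrite q_sym -N0 -/(nn o0) -(mulmxKV uN z) ptE /pt !(qwD, qwZ) q1 q2 /nn N0.
by rewrite q_eta !mulr0 !addr0.
Qed.

Let c1_neq0 : qcoef X o0 o1 *+ 2 != 0.
Proof.
apply/eqP => c10; have nu : qcoef X o0 o2 *+ 2 \isn't a GRing.unit.
  (* A polynomial vanishing at the origin is not a unit. *)
  have E : ev (row_mx 0 0) (qcoef X o0 o2 *+ 2) = 0 by rewrite ev_cc2 q0x mul0rn.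
  apply/negP => /(rmorph_unit (meval (fun i => (row_mx 0 0 : 'rV[K]_(3 + 3)) 0 i))).
  by rewrite [X in X \is a _]E unitr0.
have [x [y [x0 xr xds]]] := nonunit_zeros ds nu (fun j => fcc2 j _ _).
have [||d dds [c Ex]] := eta_singular x0; last exact: (xds d c).
  by rewrite -(ev_cc2 x y) c10 /ev meval0.
by rewrite -(ev_cc2 x y).
Qed.

Let prim (r w1 w2 : {mpoly K[3 + 3]}) : qcoef X o0 o1 *+ 2 = r * w1 -> qcoef X o0 o2 *+ 2 = r * w2 ->
  r \is a GRing.unit.
Proof.
move=> E1 E2; apply/negPn/negP => nu.
have fr j : free_of (rshift 3 j) r.
  by apply: (@free_mul _ _ _ r w1 _ _).1; rewrite -E1.
have [x [y [x0 xr xds]]] := nonunit_zeros ds nu fr.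
have [||d dds [c Ex]] := eta_singular x0; last exact: (xds d c).
  by rewrite -(ev_cc2 x y) E1 /ev mevalM -/(ev _ _) xr mul0r.
by rewrite -(ev_cc2 x y) E2 /ev mevalM -/(ev _ _) xr mul0r.
Qed.

Let fsC : free_of (rshift 3 o0) (qquad X (Y o1) (Y o2)).
Proof.
by do 2?[apply: freeD]; apply: freeM; rewrite ?mulr2n;
  do ?[apply: freeD | apply: freeM | exact: qcoef_free | exact: fYY].
Qed.

Let B0 : qlin X (Y o1) (Y o2) != 0.
Proof.
apply: contraNneq c1_neq0 => B0; apply/eqP.
apply: (@free_linear _ _ (rshift 3 o1) _ (Y o2 * (qcoef X o0 o2 *+ 2))).
- exact: fcc2.
- by apply: freeM => //; apply: fYY.
- by rewrite -/(qlin X (Y o1) (Y o2)) B0 -mpolyC0; apply: freeC.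
Qed.

Let fsB : free_of (rshift 3 o0) (qlin X (Y o1) (Y o2)).
Proof. by apply: freeD; apply: freeM => //; apply: fYY. Qed.

(* At a common zero of [qlin] and [r] the differential of [F' = qlin * r]
   vanishes; there is one above every point [x]. *)
Let no_BB_factor (r : {mpoly K[3 + 3]}) : F' = qlin X (Y o1) (Y o2) * r -> False.
Proof.
move=> E; have nu0 : (0 : {mpoly K[3 + 3]}) \isn't a GRing.unit by rewrite unitr0.
have [|x [_ [x0 _ xds]]] := nonunit_zeros ds nu0.
  by move=> j; rewrite -mpolyC0; apply: freeC.
(* Comparing the coefficients of [Y o0] on both sides gives [r = Y o0 + r0] with [r0] free of
   [Y o0]. *)
have [r1 [r0 [Er Er1 Er0]]] := free_linear_mul B0 fsB fsC fsB E.
have {Er1} r11 : r1 = 1 by apply: (mulfI B0); rewrite -Er1 mulr1.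
have fr0 : free_of (rshift 3 o0) r0.
  have [->|nz] := eqVneq r0 0; first by rewrite -mpolyC0; apply: freeC.
  by apply: (@free_mul _ _ _ (qlin X (Y o1) (Y o2)) r0 _ _).2;
    rewrite -?Er0 // Er0 mulf_neq0.
(* A linear form in two variables has a nontrivial zero; the remaining coordinate [s] is then free
   to make [Y o0 + r0] vanish. *)
have [a [b [ab0 Bab]]] : exists a b, (a, b) != (0, 0) /\ Bf x a b = 0.
  rewrite /Bf; set u1 := _ *+ 2; set u2 := _ *+ 2.
  have [u20|u20] := eqVneq u2 0.
    have [u10|u10] := eqVneq u1 0.
      by exists 1, 0; rewrite u10 u20 !mulr0 addr0 xpair_eqE oner_eq0.
    by exists 0, 1; rewrite u20 mulr0 mul0r addr0 xpair_eqE oner_eq0 andbF.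
  exists u2, (- u1); rewrite xpair_eqE (negbTE u20) mulNr mulrC subrr.
  by split.
pose yy s : V3 := \row_j (if j == o0 then s else if j == o1 then a else b).
pose s := - ev (row_mx x (yy 0)) r0.
have yr : ev (row_mx x (yy s)) r = 0.
  rewrite Er r11 mulr1 /ev mevalD -!/(ev _ _) evY mxE eqxx.
  suff -> : ev (row_mx x (yy s)) r0 = ev (row_mx x (yy 0)) r0 by rewrite addNr.
  rewrite /ev -[RHS](meval_upd_free _ s fr0); apply: meval_eq => k.
  rewrite /upd; case: (split_ordP k) => j ->.
    by rewrite eq_lrshift !row_mxEl.
  rewrite (inj_eq (@rshift_inj _ _)) !row_mxEr !mxE.
  by case: eqP.
have yB : ev (row_mx x (yy s)) (qlin X (Y o1) (Y o2)) = 0.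
  by rewrite ev_qlin rowX !evY !mxE.
have y0 : yy s *m N != 0.
  apply/eqP => yN0; have : yy s = 0 by rewrite -(mulmxK uN (yy s)) yN0 mul0mx.
  move=> /rowP yE; move: ab0; rewrite xpair_eqE.
  by have := yE o1; have := yE o2; rewrite !mxE /= => -> ->; rewrite eqxx.
have q0 : q x (yy s *m N) x (yy s *m N) = 0.
  by rewrite -evF' E /ev mevalM -/(ev _ _) yB mul0r.
have [||d dds [c Ex]] := singular_finite x0 y0; last exact: (xds d c).
  move=> z; have := @tangent_mul _ _ _ _ (row_mx x (yy s)) (row_mx z 0)
    (q z (yy s *m N) x (yy s *m N) *+ 2) (q z (yy s *m N) z (yy s *m N)) yB yr.
  rewrite -E => H; suff /eqP : q z (yy s *m N) x (yy s *m N) *+ 2 = 0.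
    by rewrite mulrn_eq0 /= => /eqP.
  apply: H => e.
  rewrite scale_row_mx add_row_mx scaler0 addr0 evF' !(qxD, qzD, qxZ, qzZ) q0.
  by rewrite (q_sym x _ z); ring.
move=> z; have := @tangent_mul _ _ _ _ (row_mx x (yy s)) (row_mx 0 (z *m invmx N))
  (q x z x (yy s *m N) *+ 2) (q x z x z) yB yr.
rewrite -E => H; suff /eqP : q x z x (yy s *m N) *+ 2 = 0.
  by rewrite mulrn_eq0 /= => /eqP.
apply: H => e.
rewrite scale_row_mx add_row_mx scaler0 addr0 evF' mulmxDl -scalemxAl mulmxKV //.
by rewrite !(qyD, qwD, qyZ, qwZ) q0 (q_sym x (yy s *m N) x z); ring.
Qed.

Let F'_irreducible : irreducible_mpoly F'.
Proof.
apply: irreducible_bilinear c1_neq0 _ _ fsC prim no_BB_factor;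
  by rewrite ?(inj_eq (@rshift_inj _ _)); split; apply: fcc2.
Qed.

(** Substitution of [y *m M] for [y]; being invertible for [M = N], it carries the irreducibility of
    [F'] over to [F]. *)
Let sub (M : 'M[K]_3) : {mpoly K[3 + 3]} -> {mpoly K[3 + 3]} :=
  comp_mpoly [tuple match split i with
    | inl j => X j | inr m => \sum_j M j m *: Y j end | i < 3 + 3].

Let ev_sub M x y p : ev (row_mx x y) (sub M p) = ev (row_mx x (y *m M)) p.
Proof.
rewrite /ev /sub comp_mpoly_meval; apply: meval_eq => k; rewrite tnth_mktuple.
case: (split_ordP k) => j ->; first by rewrite -/(ev _ _) evX row_mxEl.
rewrite row_mxEr mxE raddf_sum; apply: eq_bigr => m _.
by rewrite /= mevalZ -/(ev _ _) evY mulrC.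
Qed.

Let sub_unit M p : p \is a GRing.unit -> sub M p \is a GRing.unit.
Proof. exact: (rmorph_unit (comp_mpoly _)). Qed.

Let mpoly_ev_inj2 (p r : {mpoly K[3 + 3]}) :
  (forall x y, ev (row_mx x y) p = ev (row_mx x y) r) -> p = r.
Proof. by move=> E; apply: mpoly_ev_inj => v; rewrite -(hsubmxK v). Qed.

Let F_irreducible : irreducible_mpoly F.
Proof.
have subF : sub N F = F' by apply: mpoly_ev_inj2 => x y; rewrite ev_sub evF evF'.
have subK p : sub (invmx N) (sub N p) = p.
  by apply: mpoly_ev_inj2 => x y; rewrite !ev_sub mulmxKV.
have [F'0 nuF' irr] := F'_irreducible.
split=> [||p r E].
- by apply: contraNneq F'0 => F0; rewrite -subF F0 /sub comp_mpoly0.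
- by apply: contra nuF' => /(sub_unit N); rewrite subF.
have EN : F' = sub N p * sub N r by rewrite -subF E /sub rmorphM.
have [u|u] := irr _ _ EN.
- by left; rewrite -(subK p); apply: sub_unit.
- by right; rewrite -(subK r); apply: sub_unit.
Qed.

Let same_pointZ m c (v : 'rV[K]_m) : v != 0 -> c != 0 -> same_point v (c *: v).
Proof.
move=> v0 c0; split; rewrite ?scaler_eq0 ?negb_or ?c0 ?v0 //.
apply/vspaceP => w; apply/vlineP/vlineP => -[k ->].
  by exists (k / c); rewrite scalerA divfK.
by exists (k * c); rewrite scalerA.
Qed.

(* A birational parametrization of P^2 x P^1: [t] is sent to
   [(t0 : t1 : t2), (t0 : t3)]. *)
Let TX (i : 'I_3) : {mpoly K[4]} := 'X_(lshift 1 i : 'I_4).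
Let TZ : {mpoly K[4]} := 'X_(rshift 3 ord0 : 'I_4).

Let evTX (x : V3) (b : 'rV[K]_1) i : ev (row_mx x b : 'rV[K]_4) (TX i) = x 0 i.
Proof. by rewrite /ev mevalXU (row_mxEl x b). Qed.
Let evTZ (x : V3) (b : 'rV[K]_1) : ev (row_mx x b : 'rV[K]_4) TZ = b 0 0.
Proof. by rewrite /ev mevalXU (row_mxEr x b). Qed.
Let rowTX (x : V3) (b : 'rV[K]_1) :
  \row_i ev (row_mx x b : 'rV[K]_4) (TX i) = x.
Proof. by apply/rowP => i; rewrite mxE evTX. Qed.

Let f1 := TX.
(** With [B] and [C] for the values of [qlin] and [qquad], this is the point [(- C / B, t0, t3)] of
    the conic over [(t0 : t1 : t2)], multiplied by [B] to clear the denominator. *)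
Let LT (j : 'I_3) : {mpoly K[4]} :=
  if j == o0 then - qquad TX (TX o0) TZ
  else qlin TX (TX o0) TZ * (if j == o1 then TX o0 else TZ).
Let f2 (m : 'I_3) : {mpoly K[4]} := \sum_j N j m *: LT j.
(** As [t0] serves both for P^2 and for P^1, [x] is scaled by [L o1]: then [t0] and [t3] are in the
    ratio of [L o1] to [L o2]. *)
Let g (k : 'I_4) : {mpoly K[3 + 3]} :=
  match split (k : 'I_(3 + 1)) with
  | inl i => X i * L o1 | inr _ => X o0 * L o2 end.
Let a0 := TX o0 * qlin TX (TX o0) TZ.
Let b0 := X o0 * L o1 * qlin X (L o1) (L o2).

Let TX_homog i : TX i \is 1.-homog. Proof. by rewrite dhomogX /= mdeg1. Qed.
Let TZ_homog : TZ \is 1.-homog. Proof. by rewrite dhomogX /= mdeg1. Qed.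
Let cc2_homog j l : qcoef TX j l *+ 2 \is 2.-homog.
Proof. by rewrite rpredMn // qcoef_homog. Qed.
Let BB_homog : qlin TX (TX o0) TZ \is 3.-homog.
Proof.
by apply: rpredD; [apply: (dhomogM (TX_homog _)) | apply: (dhomogM TZ_homog)].
Qed.
Let CC_homog : qquad TX (TX o0) TZ \is 4.-homog.
Proof.
apply: rpredD; first apply: rpredD.
- by apply: (dhomogM (dhomogM (TX_homog _) (TX_homog _)) (qcoef_homog _ _ TX_homog)).
- by apply: (dhomogM (dhomogM (TX_homog _) TZ_homog)).
- by apply: (dhomogM (dhomogM TZ_homog TZ_homog) (qcoef_homog _ _ TX_homog)).
Qed.
Let f2_homog m : f2 m \is 4.-homog.
Proof.
apply: rpred_sum => j _; apply: rpredZ; rewrite /LT; case: ifP => _.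
  by rewrite rpredN.
by apply: (dhomogM BB_homog); case: ifP.
Qed.

Let f1E (x : V3) (b : 'rV[K]_1) : poly_map f1 (row_mx x b : 'rV[K]_4) = x.
Proof. exact: rowTX. Qed.

Let f2E (x : V3) (b : 'rV[K]_1) (B := Bf x (x 0 o0) (b 0 0)) :
  poly_map f2 (row_mx x b : 'rV[K]_4) =
  pt (- Cf x (x 0 o0) (b 0 0)) (B * x 0 o0) (B * b 0 0).
Proof.
apply/rowP => m; rewrite mxE /ev /f2 raddf_sum sum3 /= !mevalZ /LT /=.
rewrite mevalN !mevalM -!/(ev _ _) !evTX !evTZ !ev_qlin !ev_qquad rowTX !evTX !evTZ.
by rewrite !mxE /B; ring.
Qed.

Let gE x y (z := y *m invmx N) :
  poly_map g (row_mx x y) =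
  row_mx (z 0 o1 *: x) (x 0 o0 * z 0 o2)%:M :> 'rV[K]_(3 + 1).
Proof.
apply/rowP => k; rewrite mxE /g -[in RHS](splitK (k : 'I_(3 + 1))).
case: (split _) => j /=.
  by rewrite row_mxEl mxE /ev mevalM -!/(ev _ _) evX evL mulrC.
rewrite row_mxEr mxE /ev mevalM -!/(ev _ _) evX evL.
by rewrite !ord1 eqxx mulr1n.
Qed.

Let ev_a0 (x : V3) (b : 'rV[K]_1) :
  ev (row_mx x b : 'rV[K]_4) a0 = x 0 o0 * Bf x (x 0 o0) (b 0 0).
Proof. by rewrite /ev mevalM -!/(ev _ _) ev_qlin rowTX !evTX evTZ. Qed.

Let ev_b0 x y (z := y *m invmx N) :
  ev (row_mx x y) b0 = x 0 o0 * z 0 o1 * Bf x (z 0 o1) (z 0 o2).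
Proof. by rewrite /ev !mevalM -!/(ev _ _) ev_qlin rowX evX !evL. Qed.

Let qz x y (z := y *m invmx N) :
  q x y x y = z 0 o0 * Bf x (z 0 o1) (z 0 o2) + Cf x (z 0 o1) (z 0 o2).
Proof. by rewrite -qpt -ptE mulmxKV. Qed.

Let ptK s a b (z := pt s a b *m invmx N) : [/\ z 0 o0 = s, z 0 o1 = a & z 0 o2 = b].
Proof.
pose w : V3 := \row_j (if j == o0 then s else if j == o1 then a else b).
have : pt s a b = w *m N by rewrite ptE !mxE.
by rewrite /z => ->; rewrite mulmxK // !mxE.
Qed.

(** Where [x0], [a] and [B] do not vanish, the equation [s * B + C = 0] can be solved for [s]. *)
Let generic_point : exists x y, ev (row_mx x y) F = 0 /\ ev (row_mx x y) b0 != 0.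
Proof.
have : X o0 * Y o1 * qlin X (Y o1) (Y o2) != 0 by rewrite !mulf_neq0 ?mpolyX_neq0.
move=> /mpoly_nonroot [v].
have -> p : p.@[v] = ev (row_mx (\row_i v (lshift 3 i)) (\row_i v (rshift 3 i))) p.
  by apply: meval_eq => k; case: (split_ordP k) => j ->; rewrite ?row_mxEl ?row_mxEr mxE.
set x := \row_i v _; set y := \row_i v _.
rewrite /ev !mevalM -!/(ev _ _) ev_qlin rowX evX !evY => nz.
have B_neq0 : Bf x (y 0 o1) (y 0 o2) != 0 by apply: contraNneq nz => ->; rewrite mulr0.
exists x, (pt (- Cf x (y 0 o1) (y 0 o2) / Bf x (y 0 o1) (y 0 o2)) (y 0 o1) (y 0 o2)).
rewrite -!/(ev _ _) evF qpt divfK // addNr ev_b0; split=> //.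
by have [_ -> ->] := ptK (- Cf x (y 0 o1) (y 0 o2) / Bf x (y 0 o1) (y 0 o2))
  (y 0 o1) (y 0 o2).
Qed.

Let F_rational : rational_hypersurface F.
Proof.
split; first exact: F_irreducible.
have [x [y [xyF xyb]]] := generic_point.
exists f1, f2, g, a0, b0; split.
- by split; [exists 1%N => i; apply: TX_homog | exists 4%N].
- exists 1%N, 1%N => k; rewrite /g; by case: (split _) => [i|_];
    apply: (@bihomogM _ 1 0 0 1) => //; apply: bihomogXl.
- split; first by exists 4%N; apply: (dhomogM (TX_homog _) BB_homog).
  exists 3%N, 2%N; apply: (@bihomogM _ 1 1 2 1) => //.
  by apply: (@bihomogM _ 1 0 0 1) => //; apply: bihomogXl.
- split.
    set z := y *m invmx N; have /andP [/andP [x0 z1] B_neq0] :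
        [&& x 0 o0 != 0 & z 0 o1 != 0] && (Bf x (z 0 o1) (z 0 o2) != 0).
      by move: xyb; rewrite ev_b0 !mulf_eq0 !negb_or.
    (* [a0] does not vanish at the image under [g] of the generic point. *)
    clearbody z; apply/eqP => a00; have := ev_a0 (z 0 o1 *: x) (x 0 o0 * z 0 o2)%:M.
    rewrite a00 /ev meval0 !mxE eqxx mulr1n [_ * x 0 o0]mulrC BfZ BfZr => /esym/eqP.
    by rewrite !mulf_eq0 /= (negbTE x0) (negbTE z1) (negbTE B_neq0).
  move=> t; rewrite -[t](@hsubmxK _ 1 3 1).
  move: (@lsubmx _ 1 3 1 t) (@rsubmx _ 1 3 1 t) => {}x b {t xyF xyb y}.
  rewrite ev_a0 f1E f2E mulf_eq0 negb_or => /andP [x0 B_neq0] /=.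
  set B := Bf _ _ _; set C := Cf _ _ _.
  have [z0 z1 z2] := ptK (- C) (B * x 0 o0) (B * b 0 0).
  have xn0 : x != 0 by apply: contraNneq x0 => ->; rewrite mxE.
  split=> //.
  + apply/eqP => pt0; move: z1; rewrite pt0 mul0mx mxE => /esym/eqP.
    by rewrite mulf_eq0 (negbTE x0) orbF; apply/negP.
  + by rewrite evF qpt BfZr CfZr -/B -/C; ring.
  have -> : poly_map g (row_mx x (pt (- C) (B * x 0 o0) (B * b 0 0)))
      = (B * x 0 o0) *: (row_mx x b : 'rV[K]_(3 + 1)).
    have Eb : (x 0 o0 * (B * b 0 0))%:M = (B * x 0 o0) *: b.
      by apply/rowP => j; rewrite !mxE !ord1 eqxx mulr1n; ring.
    by rewrite gE z1 z2 Eb scale_row_mx.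
  apply: same_pointZ; last by rewrite mulf_neq0.
  apply: contraNneq xn0 => E; rewrite -[x](@row_mxKl _ 1 3 1 x b).
  by rewrite [row_mx _ _]E linear0.
split.
  exists x, y; split=> //.
    by apply: contraNneq xyb => ->; rewrite ev_b0 mxE !mul0r.
  by apply: contraNneq xyb => ->; rewrite ev_b0 mul0mx !mxE mulr0 mul0r.
move=> {xyF xyb}{}x {}y x0 y0; rewrite evF qz ev_b0 gE.
have Ey := mulmxKV uN y; move: (y *m invmx N) Ey => z Ey.
set B := Bf _ _ _; set C := Cf _ _ _ => EF.
rewrite !mulf_eq0 !negb_or => /andP [/andP [x00 z1] B_neq0] t.
have Et : t = row_mx (z 0 o1 *: x) (x 0 o0 * z 0 o2)%:M by [].
split.
- apply/eqP => E; have := @row_mxKl _ 1 3 1 (z 0 o1 *: x) (x 0 o0 * z 0 o2)%:M.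
  rewrite -Et [t]E linear0 => /esym/eqP.
  by rewrite scaler_eq0 (negbTE z1) (negbTE x0).
- by rewrite Et f1E; apply: same_pointZ.
(* On the hypersurface [C = - z0 * B], so all three coordinates acquire the common factor, which
   collects the degrees of [B] and [C] in their arguments. *)
have -> : poly_map f2 t = ((z 0 o1 * x 0 o0) ^+ 2 * B) *: y.
  rewrite Et f2E !mxE eqxx mulr1n [_ * x 0 o0]mulrC BfZ BfZr CfZ CfZr -/B -/C.
  have -> : C = - (z 0 o0 * B) by apply/eqP; rewrite -addr_eq0 addrC EF.
  rewrite -Ey ptE /pt !scalerDr !scalerA.
  by congr (_ *: _ + _ *: _ + _ *: _); ring.
by apply: same_pointZ => //; rewrite mulf_neq0 ?expf_neq0 ?mulf_neq0.
Qed.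

Lemma conic_bundle_rational_basis : exists p : {mpoly K[3 + 3]},
  [/\ bihomog 2 2 p, forall x y, ev (row_mx x y) p = q x y x y &
      rational_hypersurface p].
Proof. by exists F. Qed.

End Basis.

Theorem conic_bundle_rational : exists p : {mpoly K[3 + 3]},
  [/\ bihomog 2 2 p, forall x y, ev (row_mx x y) p = q x y x y &
      rational_hypersurface p].
Proof.
have [N [uN N0]] := unitmx_first_row eta0.
exact: conic_bundle_rational_basis uN N0.
Qed.

End ConicBundle.

(** * The exterior algebra in coordinates *)

Section ExteriorProduct.
Variables (K : fieldType) (n : nat).
Local Notation ext := (ext K n).
Implicit Types (a b c : ext) (S T : {set 'I_n}) (i j : 'I_n) (k : K).

Lemma wedge_linearl b : linear (fun a => wedge a b).
Proof.
move=> k a a'; apply/ffunP => S; rewrite !ffunE scaler_sumr -big_split /=.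
by apply: eq_bigr => T _; rewrite !ffunE /GRing.scale /=; ring.
Qed.

Lemma wedge_linearr a : linear (wedge a).
Proof.
move=> k b b'; apply/ffunP => S; rewrite !ffunE scaler_sumr -big_split /=.
by apply: eq_bigr => T _; rewrite !ffunE /GRing.scale /=; ring.
Qed.

HB.instance Definition _ a := GRing.isLinear.Build K ext ext _ (wedge a)
  (wedge_linearr a).

Lemma wedgeDl a a' b : wedge (a + a') b = wedge a b + wedge a' b.
Proof. by have := wedge_linearl b 1 a a'; rewrite !scale1r. Qed.

Lemma wedge0l b : wedge 0 b = 0.
Proof. by apply: (addrI (wedge 0 b)); rewrite -wedgeDl !addr0. Qed.

Lemma wedgeZl k a b : wedge (k *: a) b = k *: wedge a b.
Proof. by have := wedge_linearl b k a 0; rewrite wedge0l !addr0. Qed.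

Lemma wedgeDr a b b' : wedge a (b + b') = wedge a b + wedge a b'.
Proof. exact: linearD. Qed.

Lemma wedgeZr k a b : wedge a (k *: b) = k *: wedge a b.
Proof. exact: linearZ. Qed.

Lemma wedgeNr a b : wedge a (- b) = - wedge a b.
Proof. exact: linearN. Qed.

Lemma wedge0r a : wedge a 0 = 0.
Proof. exact: linear0. Qed.

Lemma wedge_suml (I : Type) (r : seq I) (P : pred I) (F : I -> ext) b :
  wedge (\sum_(i <- r | P i) F i) b = \sum_(i <- r | P i) wedge (F i) b.
Proof. by elim/big_rec2: _ => [|i x y _ <-]; rewrite ?wedge0l ?wedgeDl. Qed.

Lemma ebaseE S T : ebase K S T = (T == S)%:R.
Proof. by rewrite ffunE. Qed.

Lemma ext_sum a : a = \sum_S a S *: ebase K S.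
Proof.
apply/ffunP => T; rewrite sum_ffunE (bigD1 T) //= !ffunE eqxx big1 => [|S ST].
  by rewrite addr0 /GRing.scale /= mulr1.
by rewrite !ffunE eq_sym (negbTE ST) scaler0.
Qed.

Lemma wedge_ebase S b T : wedge (ebase K S) b T =
  if S \subset T then (-1) ^+ inversions S (T :\: S) * b (T :\: S) else 0.
Proof.
rewrite ffunE; case: ifP => ST.
  rewrite (bigD1 S) //= ebaseE eqxx mul1r big1 ?addr0 // => S' /andP [_ S'S].
  by rewrite ebaseE (negbTE S'S) mul0r mulr0.
rewrite big1 // => S' S'T; rewrite ebaseE; case: eqP => [E|]; last by rewrite mul0r mulr0.
by rewrite -E S'T in ST.
Qed.

Lemma ext_scaleE k a S : (k *: a) S = k * a S.
Proof. by rewrite ffunE. Qed.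

Lemma wedge_disjoint S T : [disjoint S & T] ->
  wedge (ebase K S) (ebase K T) = (-1) ^+ inversions S T *: ebase K (S :|: T).
Proof.
move=> dST; have TE : (S :|: T) :\: S = T.
  rewrite setDUl setDv set0U; apply/setDidPl; by rewrite disjoint_sym.
apply/ffunP => X; rewrite wedge_ebase ext_scaleE !ebaseE.
case: (X =P S :|: T) => [->|XST]; first by rewrite subsetUl TE eqxx.
case: ifP => [SX|_]; last by rewrite mulr0.
case: eqP => [E|_]; last by rewrite !mulr0.
by case: XST; rewrite -E -{1}(setIidPr SX) setID.
Qed.

Lemma wedge_meet S T : ~~ [disjoint S & T] -> wedge (ebase K S) (ebase K T) = 0.
Proof.
move=> nd; apply/ffunP => X; rewrite wedge_ebase ebaseE ffunE.
case: ifP => // _; case: eqP => [E|_]; last by rewrite mulr0.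
by case/negP: nd; rewrite -E disjoints_subset setCD subsetUr.
Qed.

Lemma inversionsUr S T T' : [disjoint T & T'] ->
  inversions S (T :|: T') = (inversions S T + inversions S T')%N.
Proof.
move=> d; rewrite /inversions -cardsUI [X in (_ + X)%N](_ : _ = 0)%N ?addn0.
  by apply: eq_card => p; rewrite !inE andb_orl ?andb_orr.
apply/eqP; rewrite cards_eq0; apply/eqP/setP => p; rewrite !inE.
case: (boolP (p.2 \in T)) => [pT|_]; last by rewrite /= andbF.
by rewrite (disjointFr d pT) /= !andbF.
Qed.

Lemma inversionsUl S S' T : [disjoint S & S'] ->
  inversions (S :|: S') T = (inversions S T + inversions S' T)%N.
Proof.
move=> d; rewrite /inversions -cardsUI [X in (_ + X)%N](_ : _ = 0)%N ?addn0.
  by apply: eq_card => p; rewrite !inE andb_orl ?andb_orr.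
apply/eqP; rewrite cards_eq0; apply/eqP/setP => p; rewrite !inE.
case: (boolP (p.1 \in S)) => [pS|//].
by rewrite (disjointFr d pS) /= !andbF.
Qed.

(** An element of [S] and an element of [T] form an inversion in exactly one of the two orders. *)
Lemma inversions_sym S T : [disjoint S & T] ->
  (inversions S T + inversions T S)%N = (#|S| * #|T|)%N.
Proof.
move=> d; pose sw (p : 'I_n * 'I_n) := (p.2, p.1).
have sw_inj : injective sw by apply: (can_inj (g := sw)); case.
rewrite -cardsX /inversions -(card_preimset [set p | [&& p.1 \in T, _ & _]] sw_inj).
rewrite -cardsUI [X in (_ + X)%N](_ : _ = 0)%N ?addn0.
  apply: eq_card => -[i j]; rewrite !inE /=.
  case: (boolP (i \in S)) => [iS|]; last by rewrite andbF.
  case: (boolP (j \in T)) => [jT|//] /=.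
  have : i != j by apply: contraTneq jT => <-; rewrite (disjointFr d iS).
  by rewrite -val_eqE /= neq_ltn orbC.
apply/eqP; rewrite cards_eq0; apply/eqP/setP => -[i j].
by rewrite !inE /=; case: ltngtP; rewrite ?andbF.
Qed.

(** On basis elements both sides are zero unless the three sets are pairwise disjoint, and then both
    exponents add up the inversions of the three pairs of sets. *)
Lemma wedgeA a b c : wedge a (wedge b c) = wedge (wedge a b) c.
Proof.
rewrite (ext_sum a) !wedge_suml; apply: eq_bigr => S _; rewrite !wedgeZl; congr (_ *: _).
rewrite (ext_sum b) !wedge_suml !linear_sum wedge_suml; apply: eq_bigr => T _.
rewrite !wedgeZl !linearZ /= wedgeZl; congr (_ *: _).
rewrite (ext_sum c) !linear_sum; apply: eq_bigr => U _; rewrite !linearZ /=; congr (_ *: _).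
have [dTU|mTU] := boolP [disjoint T & U]; last first.
  rewrite [wedge (ebase K T) _]wedge_meet // linear0.
  have [dST|mST] := boolP [disjoint S & T]; last by rewrite wedge_meet ?wedge0l.
  rewrite wedge_disjoint // wedgeZl wedge_meet ?scaler0 //.
  by apply: contra mTU; rewrite -!setI_eq0 setIUl setU_eq0 => /andP [].
rewrite (wedge_disjoint dTU) linearZ /=.
have [dST|mST] := boolP [disjoint S & T]; last first.
  rewrite (wedge_meet mST) wedge0l wedge_meet ?scaler0 //.
  by apply: contra mST; rewrite -!setI_eq0 setIUr setU_eq0 => /andP [].
rewrite (wedge_disjoint dST) wedgeZl.
have [dSU|mSU] := boolP [disjoint S & U]; last first.
  rewrite !wedge_meet ?scaler0 //; apply: contra mSU; rewrite -!setI_eq0.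
    by rewrite setIUl setU_eq0 => /andP [].
  by rewrite setIUr setU_eq0 => /andP [].
rewrite !wedge_disjoint; first last.
- by rewrite -setI_eq0 setIUr setU_eq0 !setI_eq0 dST.
- by rewrite -setI_eq0 setIUl setU_eq0 !setI_eq0 dSU.
rewrite !scalerA -!exprD inversionsUr // inversionsUl // setUA.
by congr (_ ^+ _ *: _); lia.
Qed.

Lemma wedge1l a : wedge (ebase K set0) a = a.
Proof.
apply/ffunP => S; rewrite wedge_ebase sub0set setD0 [inversions _ _](_ : _ = 0)%N ?mul1r //.
by apply/eqP; rewrite cards_eq0; apply/eqP/setP => p; rewrite !inE.
Qed.

Lemma wedge1r a : wedge a (ebase K set0) = a.
Proof.
rewrite [in RHS](ext_sum a) {1}(ext_sum a) wedge_suml; apply: eq_bigr => S _.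
rewrite wedgeZl wedge_disjoint ?setU0; last by rewrite -setI_eq0 setI0.
rewrite [inversions _ _](_ : _ = 0)%N ?scale1r //.
by apply/eqP; rewrite cards_eq0; apply/eqP/setP => p; rewrite !inE andbF.
Qed.

Lemma wedge_anticomm (d e : nat) a b :
  (forall S, #|S| != d -> a S = 0) -> (forall S, #|S| != e -> b S = 0) ->
  wedge a b = (-1) ^+ (d * e) *: wedge b a.
Proof.
move=> ha hb; rewrite (ext_sum a) wedge_suml linear_sum scaler_sumr; apply: eq_bigr => S _.
rewrite wedgeZl linearZ /= (ext_sum b) wedge_suml linear_sum !scaler_sumr.
apply: eq_bigr => T _; rewrite linearZ /= wedgeZl !scalerA.
have [cS|/ha ->] := eqVneq #|S| d; last by rewrite !(mul0r, mulr0, scale0r).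
have [cT|/hb ->] := eqVneq #|T| e; last by rewrite !(mul0r, mulr0, scale0r).
have [dST|mST] := boolP [disjoint S & T]; last first.
  by rewrite !wedge_meet ?scaler0 // disjoint_sym.
rewrite !wedge_disjoint // ?[[disjoint T & S]]disjoint_sym // setUC !scalerA.
rewrite -cS -cT -(inversions_sym dST) exprD; congr (_ *: _).
have sq : (-1) ^+ inversions T S * (-1) ^+ inversions T S = 1 :> K.
  by rewrite -expr2 sqrr_sign.
by rewrite -[LHS]mulr1 -[X in _ * X = _]sq; ring.
Qed.

End ExteriorProduct.

(** * Algebra endomorphisms induced by matrices *)

Section ChangeOfBasis.
Variables (K : numFieldType) (n : nat).
Local Notation ext := (ext K n).
Local Notation e := (ebase K).
Implicit Types (a b c : ext) (S T : {set 'I_n}) (i j : 'I_n) (k : K).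
Implicit Types (v w : 'rV[K]_n) (M N : 'M[K]_n).

Lemma vec_linear : linear (@vec K n).
Proof.
move=> k v w; rewrite /vec scaler_sumr -big_split; apply: eq_bigr => i _ /=.
by rewrite !mxE scalerDl scalerA.
Qed.

HB.instance Definition _ := GRing.isLinear.Build K 'rV[K]_n ext _ (@vec K n)
  vec_linear.

Lemma vec_delta i : vec (delta_mx 0 i) = e [set i].
Proof.
rewrite /vec (bigD1 i) //= mxE !eqxx scale1r big1 ?addr0 // => j ji.
by rewrite mxE (negbTE ji) andbF scale0r.
Qed.

Lemma vec_coord v i : vec v [set i] = v 0 i.
Proof.
rewrite /vec sum_ffunE (bigD1 i) //= !ext_scaleE ebaseE eqxx mulr1 big1 ?addr0 // => j ji.
by rewrite ext_scaleE ebaseE (inj_eq set1_inj) eq_sym (negbTE ji) mulr0.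
Qed.

Lemma vec_inj : injective (@vec K n).
Proof. by move=> v w E; apply/rowP => i; rewrite -!vec_coord E. Qed.

Lemma vec_degree v S : #|S| != 1%N -> vec v S = 0.
Proof.
move=> S1; rewrite /vec sum_ffunE big1 // => i _; rewrite ext_scaleE ebaseE.
by case: eqP => [E|]; rewrite ?mulr0 //; rewrite E cards1 in S1.
Qed.

Lemma vec_anticomm v w : wedge (vec v) (vec w) = - wedge (vec w) (vec v).
Proof.
rewrite (@wedge_anticomm _ _ 1 1); first by rewrite scaleN1r.
  exact: vec_degree.
exact: vec_degree.
Qed.

Lemma vec_sq v : wedge (vec v) (vec v) = 0.
Proof.
have := vec_anticomm v v; move/eqP; rewrite -addr_eq0 -mulr2n -scaler_nat.
by rewrite scaler_eq0 pnatr_eq0 => /eqP.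
Qed.

Definition wprod (s : seq 'rV[K]_n) : ext :=
  foldr (fun v a => wedge (vec v) a) (e set0) s.

Definition mon M S : ext := wprod [seq row i M | i <- enum S].

Lemma enum_min i S : (forall j, j \in S -> (i < j)%N) ->
  enum (i |: S) = i :: enum S.
Proof.
move=> iS; pose r (a b : 'I_n) := (a < b)%N.
have r_tr : transitive r by move=> a b c; apply: ltn_trans.
have r_irr : irreflexive r by move=> a; apply: ltnn.
have srt A : sorted r (enum A).
  rewrite /enum_mem sorted_filter // -enumT.
  have := iota_ltn_sorted 0 n; rewrite -val_enum_ord sorted_map.
  exact: sub_sorted.
apply: (irr_sorted_eq r_tr r_irr); first exact: srt.
  rewrite /= path_min_sorted ?srt //; apply/allP => j; rewrite mem_enum; exact: iS.
by move=> j; rewrite mem_enum !inE mem_enum.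
Qed.

(** Peeling off the least index introduces no sign: [e (i |: S)] is then the product of [e [set i]]
    and [e S]. *)
Lemma set_min_ind (P : {set 'I_n} -> Prop) :
  P set0 ->
  (forall i S, (forall j, j \in S -> (i < j)%N) -> P S -> P (i |: S)) ->
  forall S, P S.
Proof.
move=> P0 PS S; move: {2}#|S| (erefl #|S|) => m.
elim: m S => [S /eqP|m IHm S cS]; first by rewrite cards_eq0 => /eqP ->.
have [i0 i0S] : exists i, i \in S by apply/set0Pn; rewrite -card_gt0 cS.
have [i iS mini] := arg_minnP (fun i : 'I_n => val i) i0S.
rewrite -(setD1K iS); apply: PS; last first.
  by apply: IHm; have := cardsD1 i S; rewrite [i \in S]iS cS => -[].
move=> j; rewrite !inE => /andP [ji /mini].
by rewrite leq_eqVlt => /orP [/eqP /val_inj ij|//]; rewrite ij eqxx in ji.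
Qed.

Lemma min_notin i S : (forall j, j \in S -> (i < j)%N) -> [disjoint [set i] & S].
Proof.
by move=> iS; rewrite disjoints1; apply/negP => /iS; rewrite ltnn.
Qed.

Lemma ebase_min i S : (forall j, j \in S -> (i < j)%N) ->
  e (i |: S) = wedge (e [set i]) (e S).
Proof.
move=> iS; rewrite wedge_disjoint ?min_notin // [inversions _ _](_ : _ = 0)%N ?scale1r //.
apply/eqP; rewrite cards_eq0; apply/eqP/setP => -[a b]; rewrite !inE /=.
by case: eqP => //= ->; case: (boolP (b \in S)) => //= /iS; case: ltngtP.
Qed.

Lemma mon_min M i S : (forall j, j \in S -> (i < j)%N) ->
  mon M (i |: S) = wedge (vec (row i M)) (mon M S).
Proof. by move=> iS; rewrite /mon enum_min. Qed.

Lemma mon0 M : mon M set0 = e set0.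
Proof. by rewrite /mon enum_set0. Qed.

Fact gmap_key : unit. Proof. by []. Qed.

(* The algebra endomorphism mapping the i-th basis vector to the i-th row. *)
Definition gmap M : ext -> ext :=
  locked_with gmap_key (fun a => \sum_S a S *: mon M S).

Lemma gmapE M a : gmap M a = \sum_S a S *: mon M S.
Proof. by rewrite /gmap unlock. Qed.

Lemma gmap_linear M : linear (gmap M).
Proof.
move=> k a b; rewrite !gmapE scaler_sumr -big_split; apply: eq_bigr => S _ /=.
by rewrite !ffunE scalerDl scalerA.
Qed.

HB.instance Definition _ M := GRing.isLinear.Build K ext ext _ (gmap M)
  (gmap_linear M).

Lemma gmap_ebase M S : gmap M (e S) = mon M S.
Proof.
rewrite gmapE (bigD1 S) //= ebaseE eqxx scale1r big1 ?addr0 // => T TS.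
by rewrite ebaseE (negbTE TS) scale0r.
Qed.

Lemma gmap_vec M v : gmap M (vec v) = vec (v *m M).
Proof.
rewrite /vec linear_sum mulmx_sum_row -/(vec _) linear_sum; apply: eq_bigr => i _.
rewrite !linearZ /= gmap_ebase; congr (_ *: _).
by rewrite -[[set i]]setU0 mon_min ?mon0 ?wedge1r // => j; rewrite inE.
Qed.

(** The heart of multiplicativity: [i] is moved to its place in [T], by induction through the least
    element [j] of [T]. If [j < i], both sides anticommute past [j]; if [j = i], both are zero. *)
Lemma gmap_mul_ebase1 M i T :
  gmap M (wedge (e [set i]) (e T)) = wedge (vec (row i M)) (mon M T).
Proof.
elim/set_min_ind: T => [|j T jT IH].
  rewrite mon0 !wedge1r -vec_delta gmap_vec; congr vec.
  by rewrite -rowE.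
have [ij|ji|/val_inj ij] := ltngtP i j.
- have iT l : l \in j |: T -> (i < l)%N.
    by rewrite !inE => /orP [/eqP ->|/jT /(ltn_trans ij)].
  by rewrite -ebase_min // gmap_ebase mon_min.
- rewrite (mon_min M jT) (ebase_min jT) !wedgeA -!vec_delta vec_anticomm.
  rewrite [in RHS]vec_anticomm -!scaleN1r !wedgeZl linearZ /= -!wedgeA !vec_delta -IH.
  congr (_ *: _); have [iT|iT] := boolP [disjoint [set i] & T]; last first.
    by rewrite wedge_meet // linear0 !linear0.
  rewrite (wedge_disjoint K iT) !linearZ /= -ebase_min; last first.
    by move=> k; rewrite !inE => /orP [/eqP ->|/jT].
  rewrite !gmap_ebase mon_min //.
  by move=> k; rewrite !inE => /orP [/eqP ->|/jT].
- by rewrite ij (mon_min _ jT) (ebase_min jT) !wedgeA -vec_delta !vec_sq !wedge0l linear0.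
Qed.

Lemma gmap_wedge M a b : gmap M (wedge a b) = wedge (gmap M a) (gmap M b).
Proof.
have mul1 i c : gmap M (wedge (e [set i]) c) = wedge (vec (row i M)) (gmap M c).
  rewrite (ext_sum c) !linear_sum; apply: eq_bigr => T _.
  by rewrite !linearZ /= gmap_mul_ebase1 gmap_ebase.
rewrite (ext_sum a) wedge_suml !linear_sum wedge_suml; apply: eq_bigr => S _.
rewrite wedgeZl !linearZ /= wedgeZl; congr (_ *: _).
elim/set_min_ind: S => [|i S iS IH]; first by rewrite gmap_ebase mon0 !wedge1l.
by rewrite (ebase_min iS) -wedgeA 2!mul1 IH wedgeA.
Qed.

Lemma gmap_wprod M s : gmap M (wprod s) = wprod [seq v *m M | v <- s].
Proof.
elim: s => [|v s IH] /=; first by rewrite gmap_ebase mon0.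
by rewrite gmap_wedge gmap_vec IH.
Qed.

Lemma gmap_comp M N a : gmap N (gmap M a) = gmap (M *m N) a.
Proof.
rewrite (ext_sum a) !linear_sum; apply: eq_bigr => S _; rewrite !linearZ /=.
rewrite !gmap_ebase /mon gmap_wprod -map_comp; congr (_ *: wprod _).
by apply: eq_map => i /=; rewrite row_mul.
Qed.

Lemma gmap_1 a : gmap 1%:M a = a.
Proof.
rewrite [in RHS](ext_sum a) {1}(ext_sum a) linear_sum; apply: eq_bigr => S _.
rewrite linearZ /= gmap_ebase; congr (_ *: _).
elim/set_min_ind: S => [|i S iS IH]; first by rewrite mon0.
by rewrite mon_min // IH row1 vec_delta -ebase_min.
Qed.

Lemma gmapK M : M \in unitmx -> cancel (gmap M) (gmap (invmx M)).
Proof. by move=> uM a; rewrite gmap_comp mulmxV ?gmap_1. Qed.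

Lemma gmapVK M : M \in unitmx -> cancel (gmap (invmx M)) (gmap M).
Proof. by move=> uM a; rewrite gmap_comp mulVmx ?gmap_1. Qed.

End ChangeOfBasis.

(** * Subspaces spanned by monomials in a frame *)

Section CoordinateSubspaces.
Variables (K : numFieldType) (n : nat).
Local Notation ext := (ext K n).
Local Notation e := (ebase K).
Implicit Types (a b c : ext) (S T I J : {set 'I_n}) (i j : 'I_n) (k : K).
Implicit Types (v w : 'rV[K]_n) (M N : 'M[K]_n) (P Q R : pred {set 'I_n}).
Implicit Types (E F G : {vspace ext}) (U : {vspace 'rV[K]_n}).

Lemma span_linear (vT wT : vectType K) (f : {linear vT -> wT}) (X : seq vT)
    (Z : {vspace wT}) :
  (forall x, x \in X -> f x \in Z) -> forall a : vT, a \in <<X>>%VS -> f a \in Z.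
Proof.
move=> fX a aX; rewrite -(lfunE f); have := memv_img (linfun f) aX.
rewrite limg_span; apply/subvP/span_subvP => _ /mapP [x xX ->].
by rewrite lfunE fX.
Qed.

Definition wedgel b a : ext := wedge a b.
HB.instance Definition _ b := GRing.isLinear.Build K ext ext _ (wedgel b)
  (wedge_linearl b).

Lemma memv_wedgev E F a b : a \in E -> b \in F -> wedge a b \in wedgev E F.
Proof.
rewrite -{1}(span_basis (vbasisP E)) -{1}(span_basis (vbasisP F)) => aE bF.
apply: (span_linear (f := wedgel b)) aE => x xE; rewrite /= /wedgel.
apply: (span_linear (f := wedge x)) bF => y yF /=.
by apply: memv_span; apply/allpairsP; exists (x, y).
Qed.

Lemma wedgev_subP E F G :
  (forall a b, a \in E -> b \in F -> wedge a b \in G) -> (wedgev E F <= G)%VS.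
Proof.
move=> EFG; apply/span_subvP => _ /allpairsP [[a b] /= [aE bF ->]].
by apply: EFG; apply: vbasis_mem.
Qed.

Lemma emb_img U : emb U = (linfun (@vec K n) @: U)%VS.
Proof.
rewrite -[in RHS](span_basis (vbasisP U)) limg_span /emb; congr span.
by apply: eq_map => v; rewrite lfunE.
Qed.

Lemma mem_emb U v : (vec v \in emb U) = (v \in U).
Proof.
rewrite emb_img; apply/memv_imgP/idP => [[u uU]|vU]; last by exists v; rewrite ?lfunE.
by rewrite lfunE => /vec_inj ->.
Qed.

Lemma embP U a : reflect (exists2 u, u \in U & a = vec u) (a \in emb U).
Proof.
by rewrite emb_img; apply: (iffP memv_imgP) => -[u uU ->]; exists u; rewrite ?lfunE.
Qed.

(** The powers of [U] and [V], the grades and the filtration [Wfil] all have this form in a frame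
    adapted to [U] and [V], so that products, intersections and dimensions become combinatorics of
    index sets. *)
Definition coord_space M P : {vspace ext} :=
  <<[seq gmap M (e T) | T <- enum P]>>%VS.

Section Basis.
Variable M : 'M[K]_n.
Hypothesis uM : M \in unitmx.

Definition coeffs a : ext := gmap (invmx M) a.

Lemma coeffsK a : gmap M (coeffs a) = a.
Proof. exact: gmapVK. Qed.

Lemma coord_spaceP P a :
  reflect (forall S, ~~ P S -> coeffs a S = 0) (a \in coord_space M P).
Proof.
apply: (iffP idP) => [aP S PS|aP].
  move: aP; rewrite /coord_space.
  pose f := (fun a => coeffs a S : K^o) : ext -> K^o.
  have fl : linear f by move=> k x y; rewrite /f /coeffs linearP !ffunE.
  pose L := GRing.isLinear.Build _ _ _ _ f fl.
  move=> /(span_linear (f := HB.pack f L) (Z := 0%VS)) /= H.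
  suff : f a \in 0%VS by rewrite memv0 => /eqP.
  apply: H => x /mapP [T].
  rewrite mem_enum => PT ->; rewrite memv0 /f /coeffs gmapK // ebaseE.
  by case: (S =P T) => [ST|_]; [rewrite ST [P T]PT in PS | rewrite eqxx].
rewrite -(coeffsK a) (ext_sum (coeffs a)) linear_sum; apply: memv_suml => S _.
have [PS|/aP ->] := boolP (P S); last by rewrite scale0r linear0 mem0v.
rewrite linearZ memvZ //; apply: memv_span; apply/mapP; exists S => //.
by rewrite mem_enum.
Qed.

Lemma eq_coord_space P Q : P =1 Q -> coord_space M P = coord_space M Q.
Proof. by move=> PQ; rewrite /coord_space (eq_enum PQ). Qed.

Lemma sub_coord_space P Q :
  (forall S, P S -> Q S) -> (coord_space M P <= coord_space M Q)%VS.
Proof.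
move=> PQ; apply/subvP => a /coord_spaceP aP; apply/coord_spaceP => S QS.
by apply: aP; apply: contra QS; apply: PQ.
Qed.

Lemma coeffs_wedge a b : coeffs (wedge a b) = wedge (coeffs a) (coeffs b).
Proof. exact: gmap_wedge. Qed.

Lemma wedge_coord_space P Q R a b :
  (forall S T, P S -> Q T -> [disjoint S & T] -> R (S :|: T)) ->
  a \in coord_space M P -> b \in coord_space M Q ->
  wedge a b \in coord_space M R.
Proof.
move=> PQR /coord_spaceP aP /coord_spaceP bQ; apply/coord_spaceP => S RS.
rewrite coeffs_wedge ffunE big1 // => T TS.
have [PT|/aP ->] := boolP (P T); last by rewrite mul0r mulr0.
have [QT|/bQ ->] := boolP (Q (S :\: T)); last by rewrite !mulr0.
have : R (T :|: (S :\: T)).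
  by apply: PQR => //; rewrite disjoint_sym disjoints_subset setDE subsetIr.
by rewrite -{1}(setIidPr TS) setID (negbTE RS).
Qed.

Lemma wedge_coord_space0 P Q a b :
  (forall S T, P S -> Q T -> ~~ [disjoint S & T]) ->
  a \in coord_space M P -> b \in coord_space M Q -> wedge a b = 0.
Proof.
move=> PQ aP bQ; have /coord_spaceP w0 : wedge a b \in coord_space M pred0.
  by apply: wedge_coord_space aP bQ => S T PS QT d; case/negP: (PQ S T PS QT).
rewrite -(coeffsK (wedge a b)); apply/eqP; rewrite -(linear0 (gmap M)); apply/eqP.
by congr gmap; apply/ffunP => S; rewrite w0 // ffunE.
Qed.

Lemma wedgev_coord_space P Q R :
  (forall S T, P S -> Q T -> [disjoint S & T] -> R (S :|: T)) ->
  (forall W, R W -> exists S T, [/\ P S, Q T, [disjoint S & T] & W = S :|: T]) ->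
  wedgev (coord_space M P) (coord_space M Q) = coord_space M R.
Proof.
move=> PQR RPQ; apply/eqP; rewrite eqEsubv; apply/andP; split.
  by apply: wedgev_subP => a b; apply: wedge_coord_space.
apply/span_subvP => x /mapP [W]; rewrite mem_enum => RW ->.
have [S [T [PS QT d ->]]] := RPQ W RW.
have -> : e (S :|: T) = (-1) ^+ inversions S T *: wedge (e S) (e T).
  by rewrite wedge_disjoint // scalerA -expr2 sqrr_sign scale1r.
rewrite linearZ memvZ //= gmap_wedge; apply: memv_wedgev;
  by apply: memv_span; apply: map_f; rewrite mem_enum.
Qed.

Lemma coord_space1 S : coord_space M (pred1 S) = <[gmap M (e S)]>%VS.
Proof. by rewrite /coord_space enum1 span_seq1. Qed.

Lemma dim_coord_space P : \dim (coord_space M P) = #|P|.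
Proof.
suff /eqP : free [seq gmap M (e T) | T <- enum P] by rewrite size_map -cardE.
elim: (enum P) (enum_uniq P) => [|T s IHs /= /andP [Ts us]]; first by rewrite nil_free.
rewrite free_cons IHs // andbT; apply/negP => Tin.
have : gmap M (e T) \in coord_space M (mem s).
  suff -> : coord_space M (mem s) = <<[seq gmap M (e T') | T' <- s]>>%VS by [].
  apply: eq_span => x.
  by apply/mapP/mapP => -[T' T's ->]; exists T' => //; move: T's; rewrite mem_enum.
move=> /coord_spaceP /(_ T Ts) /eqP.
by rewrite /coeffs gmapK // ebaseE eqxx oner_eq0.
Qed.

Definition row_space I : {vspace 'rV[K]_n} := <<[seq row i M | i <- enum I]>>%VS.

Lemma row_spaceP I v :
  reflect (forall i, i \notin I -> (v *m invmx M) 0 i = 0) (v \in row_space I).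
Proof.
apply: (iffP idP) => [vI i iI|vI].
  pose f := (fun v : 'rV[K]_n => (v *m invmx M) 0 i : K^o).
  have fl : linear f by move=> k x y; rewrite /f mulmxDl -scalemxAl !mxE.
  pose L := GRing.isLinear.Build _ _ _ _ f fl.
  move: vI => /(span_linear (f := HB.pack f L) (Z := 0%VS)) /= H.
  suff : f v \in 0%VS by rewrite memv0 => /eqP.
  apply: H => x /mapP [j].
  rewrite mem_enum => jI ->; rewrite memv0 /f -row_mul mulmxV // !mxE.
  by case: (j =P i) => [ji|_]; [rewrite -ji jI in iI | rewrite eqxx].
rewrite -(mulmxKV uM v) mulmx_sum_row; apply: memv_suml => i _.
have [iI|/vI ->] := boolP (i \in I); last by rewrite scale0r mem0v.
by rewrite memvZ // memv_span //; apply: map_f; rewrite mem_enum.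
Qed.

Lemma row_in_space I i : i \in I -> row i M \in row_space I.
Proof. by move=> iI; apply: memv_span; apply: map_f; rewrite mem_enum. Qed.

Lemma row_space_setT : row_space setT = fullv.
Proof.
by apply/vspaceP => v; rewrite memvf; apply/row_spaceP => i; rewrite inE.
Qed.

Lemma emb_row_space I :
  emb (row_space I) = coord_space M (fun S => (S \subset I) && (#|S| == 1%N)).
Proof.
apply/vspaceP => a; apply/embP/coord_spaceP.
  move=> [u /row_spaceP uI ->] S; rewrite /coeffs gmap_vec negb_and.
  have [/cards1P [i ->]|] := boolP (#|S| == 1%N); last by move=> /vec_degree ->.
  by rewrite orbF sub1set vec_coord => /uI.
move=> aI; pose u := \row_i coeffs a [set i]; exists (u *m M).
  apply/row_spaceP => i iI; rewrite mulmxK // mxE; apply: aI.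
  by rewrite sub1set (negbTE iI).
rewrite -gmap_vec -(coeffsK a); congr gmap; apply/ffunP => S.
have [/cards1P [i ->]|S1] := boolP (#|S| == 1%N); first by rewrite vec_coord mxE.
by rewrite vec_degree // aI // (negbTE S1) andbF.
Qed.

Lemma extpow_row_space I m :
  extpow (row_space I) m = coord_space M (fun S => (S \subset I) && (#|S| == m)).
Proof.
elim: m => [|m IHm].
  have -> : extpow (row_space I) 0 = coord_space M (pred1 set0).
    by rewrite coord_space1 gmap_ebase mon0.
  apply: eq_coord_space => S /=; rewrite cards_eq0.
  by case: eqP => [->|]; rewrite ?sub0set ?andbF.
have -> : extpow (row_space I) m.+1 =
  wedgev (emb (row_space I)) (extpow (row_space I) m) by [].
rewrite IHm emb_row_space; apply: wedgev_coord_space => [S T|W].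
  move=> /andP [SI /eqP cS] /andP [TI /eqP cT] d.
  by rewrite subUset SI TI /= cardsU (disjoint_setI0 d) cards0 subn0 cS cT.
move=> /andP [WI /eqP cW]; have /set0Pn [i iW] : W != set0.
  by rewrite -card_gt0 cW.
exists [set i], (W :\ i); rewrite setD1K // cards1 sub1set (subsetP WI) // eqxx.
rewrite (subset_trans (subsetDl _ _) WI) disjoints1 !inE eqxx; split=> //=.
by have := cardsD1 i W; rewrite iW cW add1n => -[<-].
Qed.

Lemma extpow_fullv m : extpow fullv m = coord_space M (fun S => #|S| == m).
Proof.
rewrite -row_space_setT extpow_row_space; apply: eq_coord_space => S.
by rewrite subsetT.
Qed.

End Basis.
End CoordinateSubspaces.

(** * Trivectors graded by a decomposition of W *)

Section Frames.
Variables (K : numFieldType).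
Local Notation W := 'rV[K]_6.
Local Notation extW := (ext K 6).
Local Notation e := (ebase K).
Implicit Types (a b c : extW) (S T I J : {set 'I_6}) (U V H : {vspace W}).
Implicit Types (A B E F G : {vspace extW}).

Lemma frame_exists (X : seq W) : size X = 6%N -> (<<X>> = fullv)%VS ->
  exists2 M : 'M[K]_6, M \in unitmx & forall i : 'I_6, row i M = X`_i.
Proof.
move=> sX XT; pose X6 : 6.-tuple W := Tuple (introT eqP sX).
exists (\matrix_(i < 6) X`_i) => [|i]; last by rewrite rowK.
suff : (\matrix_(i < 6) \row_j coord X6 j (delta_mx 0 i)) *m
       (\matrix_(i < 6) X`_i) = 1%:M by case/mulmx1_unit.
apply/row_matrixP => i; rewrite row_mul rowK row1 mulmx_sum_row.
rewrite [RHS](coord_span (X := X6)); last by rewrite [<<_>>%VS]XT memvf.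
by apply: eq_bigr => j _; rewrite mxE rowK.
Qed.

(** The indices of the vectors of [U] in a frame adapted to [U] and [V]; the complement indexes
    [V]. *)
Definition I3 : {set 'I_6} := [set i : 'I_6 | (i < 3)%N].

Lemma card_I3 : #|I3| = 3%N.
Proof.
by rewrite cardsE -sum1_card !big_mkcond /= !big_ord_recr big_ord0.
Qed.

Lemma card_I3C : #|~: I3| = 3%N.
Proof. by have := cardsC I3; rewrite card_I3 card_ord => -[]. Qed.

Lemma card_split S : (#|S :&: I3| + #|S :&: ~: I3| = #|S|)%N.
Proof. by rewrite -setDE cardsID. Qed.

Lemma coord_space_split M (P Q R : pred {set 'I_6}) a : M \in unitmx ->
  (forall S, R S -> P S || Q S) -> a \in coord_space M R ->
  exists b c, [/\ b \in coord_space M P, c \in coord_space M Q & a = b + c].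
Proof.
move=> uM RPQ /(coord_spaceP uM) aR.
pose b : extW := [ffun S => if P S then coeffs M a S else 0].
pose c : extW := [ffun S => if P S then 0 else coeffs M a S].
exists (gmap M b), (gmap M c); split.
- by apply/(coord_spaceP uM) => S /negbTE PS; rewrite /coeffs gmapK // ffunE PS.
- apply/(coord_spaceP uM) => S QS; rewrite /coeffs gmapK // ffunE.
  by case: ifP => // PS; apply: aR; apply: contra QS => /RPQ; rewrite PS.
- rewrite -linearD -{1}(coeffsK uM a); congr gmap; apply/ffunP => S.
  by rewrite !ffunE; case: ifP; rewrite ?addr0 ?add0r.
Qed.

Lemma coord_space_cap0 M (P Q : pred {set 'I_6}) a : M \in unitmx -> (forall S, P S -> ~~ Q S) ->
  a \in coord_space M P -> a \in coord_space M Q -> a = 0.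
Proof.
move=> uM PQ /(coord_spaceP uM) aP /(coord_spaceP uM) aQ.
rewrite -(coeffsK uM a) -(linear0 (gmap M)); congr gmap; apply/ffunP => S.
rewrite ffunE; have [/PQ|] := boolP (P S); [exact: aQ | exact: aP].
Qed.

Lemma degree3P a : reflect (forall S, #|S| != 3%N -> a S = 0) (a \in extpow fullv 3).
Proof.
rewrite (extpow_fullv (unitmx1 _ _)); apply: (iffP (coord_spaceP (unitmx1 _ _) _ _)).
  by move=> a3 S /a3; rewrite /coeffs invmx1 gmap_1.
by move=> a3 S /a3; rewrite /coeffs invmx1 gmap_1.
Qed.

Lemma wedge_top0 a b : a \in extpow fullv 3 -> b \in extpow fullv 3 ->
  wedge a b [set: 'I_6] = 0 -> wedge a b = 0.
Proof.
move=> /degree3P a3 /degree3P b3 ab0; apply/ffunP => S; rewrite [RHS]ffunE.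
have [->//|ST] := eqVneq S setT; rewrite ffunE big1 // => T TS.
have [T3|/a3 ->] := eqVneq #|T| 3%N; last by rewrite mul0r mulr0.
have [D3|/b3 ->] := eqVneq #|S :\: T| 3%N; last by rewrite !mulr0.
case/eqP: ST; apply/eqP; rewrite eqEcard subsetT cardsT card_ord.
by have := cardsID T S; rewrite (setIidPr TS) T3 D3 => <-.
Qed.

Lemma wedge3_antisym a b : a \in extpow fullv 3 -> b \in extpow fullv 3 ->
  wedge a b = - wedge b a.
Proof.
move=> /degree3P a3 /degree3P b3.
by rewrite (wedge_anticomm a3 b3) -signr_odd expr1 scaleN1r.
Qed.

Definition in_grade (i : nat) S := (#|S :&: I3| == i) && (#|S| == 3%N).

Section Adapted.
Variables (U V : {vspace W}) (M : 'M[K]_6).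
Hypotheses (uM : M \in unitmx) (UE : U = row_space M I3)
  (VE : V = row_space M (~: I3)).

(** Two disjoint 3-element sets partition the six indices, and in particular the three elements of
    [I3]. *)
Lemma in_grade_disjoint i j S T : (i + j != 3)%N ->
  in_grade i S -> in_grade j T -> ~~ [disjoint S & T].
Proof.
move=> ij /andP [/eqP Si /eqP S3] /andP [/eqP Tj /eqP T3].
apply: contra ij => d; have := card_split S; have := card_split T.
have sub X : (#|(S :|: T) :&: X| = #|S :&: X| + #|T :&: X|)%N.
  rewrite setIUl cardsU -setIIl (disjoint_setI0 d) set0I cards0 subn0 //.
have := subset_leq_card (subsetIr (S :|: T) I3).
have := subset_leq_card (subsetIr (S :|: T) (~: I3)).
rewrite !sub card_I3 card_I3C Si Tj S3 T3; lia.
Qed.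

Lemma grade_coord i : (i <= 3)%N -> grade U V i = coord_space M (in_grade i).
Proof.
move=> i3; rewrite /grade UE VE !extpow_row_space //.
apply: wedgev_coord_space => // [S T|S].
  move=> /andP [SI /eqP cS] /andP [TI /eqP cT] d.
  rewrite /in_grade setIUl (setIidPl SI) [T :&: I3](_ : _ = set0) ?setU0 ?cS ?eqxx.
    by rewrite cardsU (disjoint_setI0 d) cards0 subn0 cS cT subnKC.
  by apply/eqP; rewrite setI_eq0 disjoints_subset.
move=> /andP [/eqP Si /eqP S3]; exists (S :&: I3), (S :&: ~: I3).
rewrite !subsetIr Si eqxx /= -setIUr setUCr setIT; split=> //.
  by rewrite -(eqn_add2l i) subnKC // -{1}Si card_split S3.
by rewrite -setI_eq0 setIACA setICr setI0.
Qed.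

Lemma grade3 : grade U V 3 = extpow U 3.
Proof.
rewrite grade_coord // UE extpow_row_space //; apply: eq_coord_space => S.
rewrite /in_grade; apply/andP/andP => [[/eqP SI /eqP S3]|[SI /eqP S3]].
  by rewrite S3; split=> //; apply/setIidPl/eqP; rewrite eqEcard subsetIl S3 SI.
by rewrite (setIidPl SI) S3.
Qed.

Lemma wedge_grade0 i j a b : (i <= 3)%N -> (j <= 3)%N -> (i + j != 3)%N ->
  a \in grade U V i -> b \in grade U V j -> wedge a b = 0.
Proof.
move=> i3 j3 ij; rewrite !grade_coord // => ai bj.
apply: wedge_coord_space0 ai bj => // S T; exact: in_grade_disjoint.
Qed.

Lemma grade_degree3 i a : (i <= 3)%N -> a \in grade U V i -> a \in extpow fullv 3.
Proof.
move=> i3; rewrite grade_coord // (extpow_fullv uM).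
by apply/subvP/sub_coord_space => // S /andP [].
Qed.

Lemma grades_cap i j k : (i <= 3)%N -> (j <= 3)%N -> (k <= 3)%N ->
  i != j -> i != k -> (grade U V i :&: (grade U V j + grade U V k) = 0)%VS.
Proof.
move=> i3 j3 k3 ij ik; apply/eqP; rewrite -subv0; apply/subvP => a.
rewrite memv_cap !grade_coord // => /andP [ai ajk]; rewrite memv0; apply/eqP.
apply: (coord_space_cap0 (P := in_grade i)
  (Q := fun S => in_grade j S || in_grade k S)) uM _ ai _ => [S|].
  by rewrite /in_grade => /andP [/eqP -> ->]; rewrite (negbTE ij) (negbTE ik).
move: ajk; apply/subvP; rewrite subv_add.
by rewrite !sub_coord_space // => S ->; rewrite ?orbT.
Qed.

Lemma daddv_pi_ker (vT : vectType K) (X Y : {vspace vT}) (v : vT) :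
  (X :&: Y = 0)%VS -> v \in Y -> daddv_pi X Y v = 0.
Proof.
move=> XY vY; have := daddv_pi_add XY (subvP (addvSr X Y) _ vY).
rewrite [daddv_pi Y X v]daddv_pi_id 1?capvC // => /eqP.
by rewrite -subr_eq0 addrK => /eqP.
Qed.

Lemma comp1E a1 a2 a3 : a1 \in grade U V 1 -> a2 \in grade U V 2 ->
  a3 \in grade U V 3 -> comp1 U V (a1 + a2 + a3) = a1.
Proof.
move=> g1 g2 g3; have cap := @grades_cap 1 2 3 isT isT isT isT isT.
rewrite -addrA linearD /= /comp1 daddv_pi_id // daddv_pi_ker ?addr0 //.
exact: memv_add.
Qed.

Lemma comp2E a1 a2 a3 : a1 \in grade U V 1 -> a2 \in grade U V 2 ->
  a3 \in grade U V 3 -> comp2 U V (a1 + a2 + a3) = a2.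
Proof.
move=> g1 g2 g3; have cap := @grades_cap 2 1 3 isT isT isT isT isT.
rewrite [a1 + a2]addrC -addrA linearD /= /comp2 daddv_pi_id // daddv_pi_ker ?addr0 //.
exact: memv_add.
Qed.

Definition W1 : {vspace extW} :=
  coord_space M (fun S => (0 < #|S :&: I3|)%N && (#|S| == 3%N)).

Lemma comp_split a : a \in W1 ->
  exists a3, [/\ comp1 U V a \in grade U V 1, comp2 U V a \in grade U V 2,
    a3 \in grade U V 3 & a = comp1 U V a + comp2 U V a + a3].
Proof.
move=> aW; have [|a1 [b [a1P bP Ea]]] := coord_space_split (P := in_grade 1)
    (Q := fun S => in_grade 2 S || in_grade 3 S) uM _ aW.
  move=> S /andP [S0 S3]; rewrite /in_grade S3 !andbT.
  have := subset_leq_card (subsetIr S I3); rewrite card_I3.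
  by case: #|_| S0 => [|[|[|[|]]]].
have [a2 [a3 [a2P a3P Eb]]] := coord_space_split uM (fun T RT => RT) bP.
have [g1 g2 g3] : [/\ a1 \in grade U V 1, a2 \in grade U V 2 & a3 \in grade U V 3].
  by rewrite !grade_coord.
by exists a3; rewrite Ea Eb addrA comp1E // comp2E.
Qed.

Lemma Wfil2E : Wfil U 2 = coord_space M (fun S => (1 < #|S :&: I3|)%N && (#|S| == 3%N)).
Proof.
rewrite /Wfil UE extpow_row_space // (extpow_fullv uM).
apply: wedgev_coord_space => // [S T|S].
  move=> /andP [SI /eqP cS] /eqP cT d.
  rewrite cardsU (disjoint_setI0 d) cards0 subn0 cS cT andbT.
  by rewrite (leq_trans _ (subset_leq_card (A := S) _)) ?cS // subsetI SI subsetUl.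
move=> /andP [/card_gt1P [i [j [iS jS ij]]] /eqP S3].
exists [set i; j], (S :\: [set i; j]); rewrite cards2 ij.
have sub (X : {set 'I_6}) : i \in X -> j \in X -> [set i; j] \subset X.
  by move=> iX jX; rewrite subUset !sub1set iX jX.
move: iS jS; rewrite !inE => /andP [iS iI] /andP [jS jI].
have SS : S :&: [set i; j] = [set i; j] by apply/setIidPr/sub.
split.
- by rewrite sub ?inE.
- by have := cardsID [set i; j] S; rewrite SS cards2 ij S3 => /eqP; rewrite eqn_add2l.
- by rewrite disjoint_sym disjoints_subset setDE subsetIr.
- by rewrite -{1}SS setID.
Qed.

(* [W1 = u^perp] *)
Lemma perp_W1 a : a \in extpow fullv 3 ->
  (forall b, b \in extpow U 3 -> wedge b a = 0) -> a \in W1.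
Proof.
rewrite (extpow_fullv uM) => /(coord_spaceP uM) a3 ua.
apply/(coord_spaceP uM) => S; rewrite negb_and -leqNgt leqn0 cards_eq0 => /orP [|/a3 //].
rewrite setI_eq0 disjoints_subset => SI; have [/eqP S3|/a3 //] := boolP (#|S| == 3%N).
have {SI} SE : S = ~: I3 by apply/eqP; rewrite eqEcard SI card_I3C S3.
have : wedge (gmap M (e I3)) a = 0.
  apply: ua; rewrite UE extpow_row_space //; apply/(coord_spaceP uM) => T.
  rewrite /coeffs gmapK // ebaseE; case: (T =P I3) => // ->.
  by rewrite subxx card_I3.
move=> /(congr1 (coeffs M)); rewrite coeffs_wedge // /coeffs gmapK // linear0.
move=> /ffunP /(_ [set: _]); rewrite wedge_ebase subsetT setTD -SE [RHS]ffunE => /eqP.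
by rewrite mulf_eq0 signr_eq0 => /eqP.
Qed.

(** Complementation of index sets exchanges the two families. *)
Lemma dim_grade12 : \dim (grade U V 1) = \dim (grade U V 2).
Proof.
rewrite !grade_coord // !dim_coord_space //.
rewrite -[RHS](card_image (can_inj (@setCK _))); apply: eq_card => S.
rewrite -[S]setCK mem_image; last exact: can_inj (@setCK _).
move: (~: S) => {}S; rewrite !unfold_in /in_grade.
have := cardsID S I3; rewrite setDE [I3 :&: S]setIC [I3 :&: ~: S]setIC card_I3.
have := cardsC S; rewrite card_ord; lia.
Qed.

(** If the projection were not onto, some nonzero [c] of grade 2 would be orthogonal to its image,
    as the two grades have the same dimension. Grade 2 is orthogonal to grades 2 and 3, so [c] would
    be orthogonal to [A], hence in [A] by maximality, hence in [/\^3 U] by smoothness, which meets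
    grade 2 in 0. *)
Lemma lagrangian_surj A : maximal_isotropic A -> (extpow U 3 <= A)%VS ->
  smooth_at A U -> (A <= W1)%VS /\ (comp1 U V @: A)%VS = grade U V 1.
Proof.
move=> [[A3 isoA] maxA] uA smA.
have AW : (A <= W1)%VS.
  apply/subvP => a aA; apply: perp_W1; first exact: (subvP A3).
  by move=> b bu; apply: isoA => //; apply: (subvP uA).
split=> //; have sub1 : (comp1 U V @: A <= grade U V 1)%VS.
  apply/subvP => _ /memv_imgP [a aA ->].
  by have [a3 []] := comp_split (subvP AW _ aA).
apply/eqP; rewrite eqEdim sub1 leqNgt; apply/negP => ltB.
set B := (comp1 U V @: A)%VS in ltB.
pose f c : 'rV[K]_(\dim B) := \row_i wedge (vbasis B)`_i c [set: 'I_6].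
have fl : linear f.
  by move=> k c c'; apply/rowP => i; rewrite !mxE linearP !ffunE.
pose fL : {linear extW -> 'rV[K]_(\dim B)} := HB.pack f (GRing.isLinear.Build _ _ _ _ f fl).
have [c [c2 c0 fc]] : exists c, [/\ c \in grade U V 2, c != 0 & f c = 0].
  pose Z := (grade U V 2 :&: lker (linfun fL))%VS.
  have Z0 : Z != 0%VS.
    rewrite -dimv_eq0; have := limg_ker_dim (linfun fL) (grade U V 2).
    have : (\dim (linfun fL @: grade U V 2) <= \dim B)%N.
      by rewrite (leq_trans (dimvS (subvf _))) // dimvf /dim /= mul1n.
    move=> leB E; apply/eqP => Z0; move: ltB.
    by rewrite dim_grade12 -E -/Z Z0 add0n ltnNge leB.
  exists (vpick Z); have := memv_pick Z; rewrite memv_cap memv_ker lfunE => /andP [z2 /eqP fz].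
  by rewrite z2 vpick0 Z0.
have Bc b : b \in B -> wedge b c [set: 'I_6] = 0.
  move=> bB; rewrite (coord_vbasis bB) wedge_suml sum_ffunE big1 // => i _.
  by rewrite wedgeZl ext_scaleE; have /rowP /(_ i) := fc; rewrite !mxE => ->; rewrite mulr0.
have c3 := grade_degree3 (isT : 2 <= 3)%N c2.
have Ac a : a \in A -> wedge a c = 0.
  move=> aA; have [a3 [g1 g2 g3 Ea]] := comp_split (subvP AW _ aA).
  rewrite Ea !wedgeDl (wedge_grade0 _ _ _ g2 c2) // (wedge_grade0 _ _ _ g3 c2) // !addr0.
  apply: wedge_top0 => //; first exact: grade_degree3 g1.
  by apply: Bc; apply: memv_img.
have cA a : a \in A -> wedge c a = 0.
  by move=> aA; rewrite wedge3_antisym ?Ac ?oppr0 // (subvP A3).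
have : c \in A.
  rewrite -(maxA (A + <[c]>)%VS) ?addvSl //; first by apply: (subvP (addvSr _ _)); apply: memv_line.
  split; first by rewrite subv_add A3 -memvE.
  move=> _ _ /memv_addP [a aA [_ /vlineP [k ->] ->]] /memv_addP [a' a'A [_ /vlineP [k' ->] ->]].
  rewrite !wedgeDl !linearD !linearZ /= !wedgeZl isoA // Ac // cA //.
  by rewrite (wedge_grade0 _ _ _ c2 c2) // !scaler0 !addr0.
move=> cA'; case/eqP: c0; apply: (coord_space_cap0 (P := in_grade 2) (Q := in_grade 3) uM).
- by move=> S; rewrite /in_grade => /andP [/eqP -> _].
- by rewrite -grade_coord.
rewrite -grade_coord // grade3 -smA memv_cap cA' Wfil2E.
move: c2; rewrite grade_coord //; apply/subvP/sub_coord_space => // S.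
by rewrite /in_grade => /andP [/eqP -> ->].
Qed.

End Adapted.
End Frames.

(** * Decomposable trivectors *)

Section Decomposable.
Variables (K : numFieldType).
Local Notation W := 'rV[K]_6.
Local Notation extW := (ext K 6).
Local Notation e := (ebase K).
Implicit Types (a b c : extW) (S T I J : {set 'I_6}) (U V H : {vspace W}).
Implicit Types (A B E F G : {vspace extW}) (v w x : W) (s t : seq W).

Lemma basis_complete U s : free s -> (<<s>> <= U)%VS ->
  exists t, basis_of U (s ++ t).
Proof.
move=> fs sU; exists (vbasis (U :\: <<s>>)%VS).
have EU : (<<s>> + (U :\: <<s>>) = U)%VS.
  by rewrite addvC addv_diff; apply/addv_idPl.
rewrite -{1}EU; apply: cat_basis; last exact: vbasisP.
  by apply/directv_addP; rewrite capvC capv_diff.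
by rewrite basisEfree fs subvv (eqP fs) /=.
Qed.

Definition initial_set (k : nat) : {set 'I_6} := [set i : 'I_6 | (i < k)%N].

Lemma enum_first k : (k <= 6)%N -> [seq val i | i <- enum (initial_set k)] = iota 0 k.
Proof.
move=> k6; rewrite /enum_mem -(eq_filter (a1 := preim val (ltn^~ k))); last first.
  by move=> i; apply/esym; apply: in_set.
rewrite -enumT -filter_map val_enum_ord.
have -> : iota 0 6 = iota 0 k ++ iota k (6 - k) by rewrite -iotaD subnKC.
rewrite filter_cat.
rewrite (all_filterP (a := ltn^~ k) _); last by apply/allP => i; rewrite mem_iota.
rewrite [X in _ ++ X](_ : _ = [::]) ?cats0 //.
apply/eqP; rewrite -(negbK (_ == _)) -has_filter -all_predC; apply/allP => i.
by rewrite mem_iota /= -leqNgt => /andP [].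
Qed.

Lemma mon_first (M : 'M[K]_6) s t : size (s ++ t) = 6%N ->
  (forall i : 'I_6, row i M = (s ++ t)`_i) ->
  mon M (initial_set (size s)) = wprod s /\ row_space M (initial_set (size s)) = <<s>>%VS.
Proof.
move=> st6 rM; have s6 : (size s <= 6)%N.
  by have := leq_addr (size t) (size s); rewrite -size_cat st6.
suff E : [seq row i M | i <- enum (initial_set (size s))] = s.
  by rewrite /mon /row_space E.
rewrite (eq_map rM) (map_comp (fun i => (s ++ t)`_i) val) enum_first //.
apply: (@eq_from_nth _ 0); rewrite size_map size_iota // => i ilt.
by rewrite (nth_map 0%N) ?size_iota // nth_iota // add0n nth_cat ilt.
Qed.

Lemma frame_of_free s : free s ->
  exists2 M : 'M[K]_6, M \in unitmx &
    mon M (initial_set (size s)) = wprod s /\ row_space M (initial_set (size s)) = <<s>>%VS.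
Proof.
move=> fs; have [t bt] := basis_complete fs (subvf _).
have st6 : size (s ++ t) = 6%N.
  have := @vector.size_basis _ _ _ _ (in_tuple (s ++ t)) bt.
  by rewrite dimvf /dim /= mul1n.
have [M uM rM] := frame_exists st6 (span_basis bt).
by exists M => //; apply: mon_first st6 rM.
Qed.

Lemma vec_wedge_coord v S i : i \notin S ->
  wedge (vec v) (e S) (i |: S) = (-1) ^+ inversions [set i] S * v 0 i.
Proof.
move=> iS; rewrite {1}/vec wedge_suml sum_ffunE (bigD1 i) //= big1 => [|j ji].
  rewrite addr0 wedgeZl ext_scaleE wedge_ebase sub1set !inE eqxx /=.
  by rewrite setU1K // ebaseE eqxx mulr1 mulrC.
rewrite wedgeZl ext_scaleE wedge_ebase; case: ifP => _; last by rewrite mulr0.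
rewrite ebaseE; case: eqP => [E|_]; last by rewrite !mulr0.
by case/negP: iS; rewrite -E !inE eqxx (eq_sym i) ji.
Qed.

(** In a frame that begins with [s], every coordinate of [v] outside [s] appears, up to sign, as a
    coefficient of the product. *)
Lemma wprod_ann s v : free s -> (wedge (vec v) (wprod s) == 0) = (v \in <<s>>%VS).
Proof.
move=> fs; have [M uM [<- <-]] := frame_of_free fs; rewrite -gmap_ebase.
set I := initial_set _; apply/eqP/(row_spaceP uM) => [vI i iI|vI].
  have := congr1 (coeffs M) vI; rewrite coeffs_wedge // /coeffs gmapK // linear0 gmap_vec.
  move=> /ffunP /(_ (i |: I)); rewrite vec_wedge_coord // ffunE => /eqP.
  by rewrite mulf_eq0 signr_eq0 => /eqP.
apply: (wedge_coord_space0 uM (P := fun S => (S \subset I) && (#|S| == 1%N)) (Q := pred1 I)).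
- move=> S T /andP [SI /cards1P [i ES]] /eqP ->; rewrite ES disjoints1 negbK.
  by rewrite -sub1set -ES.
- by rewrite -emb_row_space // mem_emb; apply/row_spaceP.
- by rewrite coord_space1 memv_line.
Qed.

Lemma wprod_neq0 s : free s -> wprod s != 0.
Proof.
move=> fs; have [M uM [<- _]] := frame_of_free fs; rewrite -gmap_ebase.
apply/eqP => /(congr1 (coeffs M)); rewrite /coeffs gmapK // linear0.
move=> /ffunP /(_ (initial_set (size s))); rewrite ebaseE eqxx ffunE => /eqP.
by rewrite oner_eq0.
Qed.

Lemma card_first k : (k <= 6)%N -> #|initial_set k| = k.
Proof. by move=> k6; rewrite cardE -(size_map val) enum_first // size_iota. Qed.

Lemma extpow_span s : free s -> extpow <<s>> (size s) = <[wprod s]>%VS.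
Proof.
move=> fs; have [M uM [<- <-]] := frame_of_free fs; rewrite -gmap_ebase.
rewrite extpow_row_space // -coord_space1; apply: eq_coord_space => S /=.
have s6 : (size s <= 6)%N.
  by have /eqP <- := fs; rewrite (leq_trans (dimvS (subvf _))) // dimvf /dim /= mul1n.
rewrite eqEcard card_first //; case SI: (S \subset _) => //=.
by rewrite eqn_leq -{1}(card_first s6) subset_leq_card.
Qed.

(** A decomposable trivector determines its plane as the space of the vectors that annihilate it. *)
Lemma extpow3_inj U V : \dim U = 3%N -> \dim V = 3%N ->
  extpow U 3 = extpow V 3 -> U = V.
Proof.
move=> dU dV E; have bE (X : {vspace W}) : \dim X = 3%N -> exists2 s, free s & X = <<s>>%VS /\ size s = 3%N.
  move=> dX; exists (vbasis X); first exact: basis_free (vbasisP X).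
  by rewrite (span_basis (vbasisP X)) size_tuple.
have [s fs [EU ss]] := bE _ dU; have [t ft [EV st]] := bE _ dV.
have Es := extpow_span fs; have Et := extpow_span ft; rewrite ss in Es; rewrite st in Et.
move: E; rewrite EU EV Es Et => E.
apply/vspaceP => v; rewrite -!wprod_ann //.
have /vlineP [k Ek] : wprod s \in <[wprod t]>%VS by rewrite -E memv_line.
have k0 : k != 0.
  by apply: contraNneq (wprod_neq0 fs) => k0; rewrite Ek k0 scale0r.
by rewrite Ek linearZ /= scaler_eq0 (negbTE k0).
Qed.

End Decomposable.

Section DecomposableLift.
Variables (K : numFieldType).
Local Notation W := 'rV[K]_6.
Local Notation extW := (ext K 6).
Local Notation e := (ebase K).
Implicit Types (a b c : extW) (S T I J : {set 'I_6}) (U V H : {vspace W}).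
Implicit Types (A B E F G : {vspace extW}) (v w x : W) (s t : seq W).
Local Notation "''o' k" := (@Ordinal 6 k isT) (at level 1, k at level 0).

(** Index sets as bit vectors, so that equality, cardinality and intersection with [I3] are computed
    when an identity is checked on all 64 sets. *)
Definition bits_set (b0 b1 b2 b3 b4 b5 : bool) : {set 'I_6} :=
  [set i : 'I_6 | nth false [:: b0; b1; b2; b3; b4; b5] i].

Lemma ord6_cases (P : 'I_6 -> Prop) :
  P 'o 0 -> P 'o 1 -> P 'o 2 -> P 'o 3 -> P 'o 4 -> P 'o 5 -> forall i, P i.
Proof.
move=> P0 P1 P2 P3 P4 P5 [[|[|[|[|[|[|//]]]]]] lti];
  by rewrite (bool_irrelevance lti isT).
Qed.

Lemma bits_setE S :
  S = bits_set ('o 0 \in S) ('o 1 \in S) ('o 2 \in S) ('o 3 \in S) ('o 4 \in S) ('o 5 \in S).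
Proof. by apply/setP; apply: ord6_cases; rewrite inE. Qed.

Lemma bits_set_eq (b0 b1 b2 b3 b4 b5 c0 c1 c2 c3 c4 c5 : bool) :
  (bits_set b0 b1 b2 b3 b4 b5 == bits_set c0 c1 c2 c3 c4 c5) =
  [&& b0 == c0, b1 == c1, b2 == c2, b3 == c3, b4 == c4 & b5 == c5].
Proof.
apply/eqP/idP => [/setP E|].
  have := E 'o 0; have := E 'o 1; have := E 'o 2; have := E 'o 3; have := E 'o 4.
  by have := E 'o 5; rewrite !inE /= => -> -> -> -> -> ->; rewrite !eqxx.
by move=> /and5P [/eqP -> /eqP -> /eqP -> /eqP -> /andP [/eqP -> /eqP ->]].
Qed.

Lemma card_bits_set (b0 b1 b2 b3 b4 b5 : bool) :
  #|bits_set b0 b1 b2 b3 b4 b5| = (b0 + b1 + b2 + b3 + b4 + b5)%N.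
Proof.
rewrite -sum1_card big_mkcond /= !big_ord_recr big_ord0 /= !inE /= add0n.
by case: b0; case: b1; case: b2; case: b3; case: b4; case: b5.
Qed.

Lemma bits_setI3 (b0 b1 b2 b3 b4 b5 : bool) :
  bits_set b0 b1 b2 b3 b4 b5 :&: I3 = bits_set b0 b1 b2 false false false.
Proof. by apply/setP; apply: ord6_cases; rewrite !inE ?andbT ?andbF. Qed.

Lemma ebase_trip (i j k : 'I_6) : (i < j)%N -> (j < k)%N ->
  wedge (e [set i]) (wedge (e [set j]) (e [set k])) = e (i |: (j |: [set k])).
Proof.
move=> ij jk; rewrite -(@ebase_min _ _ j) => [|l]; last by rewrite inE => /eqP ->.
rewrite -ebase_min // => l; rewrite !inE => /orP [/eqP -> //|/eqP ->].
exact: ltn_trans jk.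
Qed.

(** Of the nine coefficients of grade 2, the hypotheses kill the five whose index set contains 5 or
    omits 0. The other four determine the two linear corrections, and [t] adjusts the single
    coefficient of grade 3. *)
Lemma decomposable_coeffs b :
  (forall S, ~~ ((0 < #|S :&: I3|)%N && (#|S| == 3%N)) -> b S = 0) ->
  (forall S, in_grade 1 S -> b S = (S == bits_set true false false true true false)%:R) ->
  b (bits_set true true false false false true) = 0 ->
  b (bits_set true false true false false true) = 0 ->
  b (bits_set false true true false false true) = 0 ->
  b (bits_set false true true true false false) = 0 ->
  b (bits_set false true true false true false) = 0 ->
  exists t a1 a2 b1 b2 : K, b + t *: e I3 =
    wedge (e [set 'o 0])
      (wedge (e [set 'o 3] + (a1 *: e [set 'o 1] + a2 *: e [set 'o 2]))
             (e [set 'o 4] + (b1 *: e [set 'o 1] + b2 *: e [set 'o 2]))).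
Proof.
move=> b0 b1 n1 n2 n3 n4 n5.
pose p13 := b (bits_set true true false true false false).
pose p14 := b (bits_set true true false false true false).
pose p23 := b (bits_set true false true true false false).
pose p24 := b (bits_set true false true false true false).
pose p12 := b (bits_set true true true false false false).
exists (p13 * p24 - p14 * p23 - p12), p14, p24, (- p13), (- p23).
have anti (i j : 'I_6) : wedge (e [set i]) (e [set j]) = - wedge (e [set j]) (e [set i]).
  by rewrite -!vec_delta vec_anticomm.
have sq (i : 'I_6) : wedge (e [set i]) (e [set i]) = 0 by rewrite -vec_delta vec_sq.
rewrite !(wedgeDl, wedgeDr, wedgeZl, wedgeZr) !sq (anti 'o 3 'o 1) (anti 'o 3 'o 2).
rewrite (anti 'o 2 'o 1) !wedgeNr !wedge0r !ebase_trip //.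
have T034 : 'o 0 |: [set 'o 3; 'o 4] = bits_set true false false true true false.
  by apply/setP; apply: ord6_cases; rewrite !inE.
have T013 : 'o 0 |: [set 'o 1; 'o 3] = bits_set true true false true false false.
  by apply/setP; apply: ord6_cases; rewrite !inE.
have T023 : 'o 0 |: [set 'o 2; 'o 3] = bits_set true false true true false false.
  by apply/setP; apply: ord6_cases; rewrite !inE.
have T014 : 'o 0 |: [set 'o 1; 'o 4] = bits_set true true false false true false.
  by apply/setP; apply: ord6_cases; rewrite !inE.
have T024 : 'o 0 |: [set 'o 2; 'o 4] = bits_set true false true false true false.
  by apply/setP; apply: ord6_cases; rewrite !inE.
have T012 : 'o 0 |: [set 'o 1; 'o 2] = bits_set true true true false false false.
  by apply/setP; apply: ord6_cases; rewrite !inE.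
have TI : I3 = bits_set true true true false false false.
  by apply/setP; apply: ord6_cases; rewrite !inE.
rewrite T034 T013 T023 T014 T024 T012 TI.
have {}b0 (c0 c1 c2 c3 c4 c5 : bool) :
    ~~ ((0 < c0 + c1 + c2)%N && (c0 + c1 + c2 + c3 + c4 + c5 == 3)%N) ->
    b (bits_set c0 c1 c2 c3 c4 c5) = 0.
  by move=> nS; apply: b0; rewrite bits_setI3 !card_bits_set !addn0.
have {}b1 (c0 c1 c2 c3 c4 c5 : bool) :
    (c0 + c1 + c2 == 1)%N && (c0 + c1 + c2 + c3 + c4 + c5 == 3)%N ->
    b (bits_set c0 c1 c2 c3 c4 c5) =
    ([&& c0, ~~ c1, ~~ c2, c3, c4 & ~~ c5])%:R.
  move=> nS; rewrite b1 ?bits_set_eq; last by rewrite /in_grade bits_setI3 !card_bits_set !addn0.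
  by case: c0 c1 c2 c3 c4 c5 {nS} => [] [] [] [] [] [].
have DE a c S : (a + c) S = a S + c S by rewrite ffunE.
have NE a S : (- a) S = - a S by rewrite ffunE.
have zE S : (0 : extW) S = 0 by rewrite ffunE.
apply/ffunP => S; rewrite !(DE, NE, zE, ext_scaleE, ebaseE) (bits_setE S) !bits_set_eq.
rewrite /p13 /p14 /p23 /p24 /p12.
case: ('o 0 \in S); case: ('o 1 \in S); case: ('o 2 \in S);
case: ('o 3 \in S); case: ('o 4 \in S); case: ('o 5 \in S); rewrite /=;
  by first [rewrite b0 //; ring | rewrite b1 //=; ring | rewrite n1; ring
     | rewrite n2; ring | rewrite n3; ring | rewrite n4; ring | rewrite n5; ring | ring].
Qed.

End DecomposableLift.

Section AdaptedFrame.
Variables (K : numFieldType).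
Local Notation W := 'rV[K]_6.
Local Notation extW := (ext K 6).
Local Notation e := (ebase K).
Implicit Types (a b c : extW) (S T I J : {set 'I_6}) (U V H : {vspace W}).
Implicit Types (A B E F G : {vspace extW}) (v w x : W) (s : seq W).
Local Notation "''o' k" := (@Ordinal 6 k isT) (at level 1, k at level 0).

Lemma dim_complement U V : complement U V -> \dim U = 3%N -> \dim V = 3%N.
Proof.
move=> [UV1 UV0] dU; have := dimv_disjoint_sum UV0.
by rewrite UV1 dU dimvf /dim /= mul1n => /eqP; rewrite (eqn_add2l 3 3) => /eqP.
Qed.

Lemma adapted_frame U V (xs ys : seq W) : complement U V -> \dim U = 3%N ->
  basis_of U xs -> basis_of V ys ->
  exists M : 'M[K]_6, [/\ M \in unitmx, forall i : 'I_6, row i M = (xs ++ ys)`_i,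
    U = row_space M I3 & V = row_space M (~: I3)].
Proof.
move=> UV dU bU bV; have dV := dim_complement UV dU; have [UV1 UV0] := UV.
have sx : size xs = 3%N by have := @vector.size_basis _ _ _ _ (in_tuple xs) bU; rewrite dU.
have sy : size ys = 3%N by have := @vector.size_basis _ _ _ _ (in_tuple ys) bV; rewrite dV.
have sxy : size (xs ++ ys) = 6%N by rewrite size_cat sx sy.
have sp : (<<xs ++ ys>> = fullv)%VS.
  by rewrite span_cat (span_basis bU) (span_basis bV).
have [M uM rM] := frame_exists sxy sp; exists M; split=> //.
  have [_] := mon_first sxy rM; rewrite sx (span_basis bU) => <-.
  by congr row_space; apply/setP => i; rewrite !inE.
have dim_le : (\dim (row_space M (~: I3)) <= \dim V)%N.
  by rewrite dV (leq_trans (dim_span _)) // size_map -cardE card_I3C.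
apply/eqP; rewrite eqEdim dim_le andbT -{1}(span_basis bV).
apply/span_subvP => y yin; have := nth_index 0 yin.
  have : (index y ys < size ys)%N by rewrite index_mem.
  rewrite sy.
  case: (index y ys) => [|[|[|//]]] _ <-; apply: memv_span; apply/mapP;
    [exists 'o 3|exists 'o 4|exists 'o 5];
  by rewrite ?mem_enum ?inE // rM nth_cat sx.
Qed.

Lemma wprod_in_extpow U s : {subset s <= U} -> wprod s \in extpow U (size s).
Proof.
elim: s => [_|v s IH vsU] /=; first exact: memv_line.
apply: memv_wedgev; first by rewrite mem_emb vsU ?mem_head.
by apply: IH => w ws; apply: vsU; rewrite inE ws orbT.
Qed.

(** The last two conditions say that [a] is orthogonal to the tangent space of the Segre cone at
    [x /\ v1 /\ v2]. This space is spanned by five monomials in a frame containing [x], [v1], [v2],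
    and their complements are the five index sets of [decomposable_coeffs]. *)
Lemma decomposable_lift U V a x v1 v2 : complement U V -> \dim U = 3%N ->
  x \in U -> x != 0 -> v1 \in V -> v2 \in V -> free [:: v1; v2] ->
  a \in extpow fullv 3 -> (forall b, b \in extpow U 3 -> wedge b a = 0) ->
  comp1 U V a = wprod [:: x; v1; v2] ->
  (forall w, w \in U -> wedge (wprod [:: w; v1; v2]) a [set: 'I_6] = 0) ->
  (forall w1 w2, w1 \in V -> w2 \in V ->
     wedge (wprod [:: x; w1; w2]) a [set: 'I_6] = 0) ->
  exists t y1 y2, [/\ t \in extpow U 3, y1 \in U, y2 \in U &
    a + t = wprod [:: x; v1 + y1; v2 + y2]].
Proof.
move=> UV dU xU x0 v1V v2V fv a3 ua ca C1 C2.
have [xs bU] : exists xs, basis_of U (x :: xs).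
  by apply: (basis_complete (s := [:: x])); rewrite ?seq1_free // span_seq1 -memvE.
have [ys bV] : exists ys, basis_of V (v1 :: v2 :: ys).
  apply: (basis_complete (s := [:: v1; v2])) => //; apply/span_subvP => y.
  by rewrite !inE => /orP [] /eqP ->.
have sx : size xs = 2%N.
  by have := @vector.size_basis _ _ _ _ (in_tuple (x :: xs)) bU; rewrite dU => -[].
have [M [uM rM UE VE]] := adapted_frame UV dU bU bV.
have r0 : row 'o 0 M = x by rewrite rM.
have r3 : row 'o 3 M = v1 by rewrite rM nth_cat /= sx.
have r4 : row 'o 4 M = v2 by rewrite rM nth_cat /= sx.
have rU (i : 'I_6) : (i < 3)%N -> row i M \in U.
  by move=> i3; rewrite UE row_in_space // inE.
have rV (i : 'I_6) : (2 < i)%N -> row i M \in V.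
  by move=> i3; rewrite VE row_in_space // !inE -leqNgt.
have gr (i : 'I_6) : gmap M (e [set i]) = vec (row i M) by rewrite -vec_delta gmap_vec -rowE.
have gtrip (i j k : 'I_6) : (i < j)%N -> (j < k)%N ->
    wprod [:: row i M; row j M; row k M] = gmap M (e (i |: (j |: [set k]))).
  by move=> ij jk; rewrite -ebase_trip // !gmap_wedge !gr /= wedge1r.
have aW := perp_W1 uM UE a3 ua.
have [b [g1 g2 g3 Ea]] := comp_split uM UE VE aW.
have deg3 w1 w2 w3 : wprod [:: w1; w2; w3] \in extpow fullv 3.
  by apply: (@wprod_in_extpow fullv [:: w1; w2; w3]) => w _; apply: memvf.
(* Multiplication by a monomial reads off the coefficient of [a] at the complementary index set. *)
have coef0 T : wedge (gmap M (e T)) a = 0 -> coeffs M a (~: T) = 0.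
  move=> /(congr1 (coeffs M)); rewrite coeffs_wedge // /coeffs gmapK // linear0.
  move=> /ffunP /(_ setT); rewrite wedge_ebase subsetT setTD [RHS]ffunE => /eqP.
  by rewrite mulf_eq0 signr_eq0 => /eqP.
have trip0 (i j k : 'I_6) : (i < j)%N -> (j < k)%N ->
    wedge (wprod [:: row i M; row j M; row k M]) a [set: 'I_6] = 0 ->
    coeffs M a (~: (i |: (j |: [set k]))) = 0.
  move=> ij jk E; apply: coef0; rewrite -gtrip //; exact: wedge_top0.
have gradeS i c S : (i <= 3)%N -> c \in grade U V i -> ~~ in_grade i S ->
    coeffs M c S = 0.
  by move=> i3; rewrite (grade_coord uM) // => /(coord_spaceP uM) cS /cS.
have [||||||| t [a1 [a2 [b1 [b2 E]]]]] := @decomposable_coeffs K (coeffs M a).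
- exact/(coord_spaceP uM).
- move=> S S1; rewrite Ea /coeffs !linearD /= -!/(coeffs M _) [LHS]ffunE [_ S]ffunE.
  rewrite (gradeS _ _ _ _ g2) // ?(gradeS _ _ _ _ g3) // ?addr0;
    try by move: S1; rewrite /in_grade => /andP [/eqP -> _].
  rewrite ca -r0 -r3 -r4 gtrip // /coeffs gmapK // ebaseE; congr ((S == _)%:R).
  by apply/setP; apply: ord6_cases; rewrite !inE.
- rewrite [bits_set _ _ _ _ _ _](_ : _ = ~: ('o 2 |: ('o 3 |: [set 'o 4]))).
    by apply: trip0 => //; rewrite r3 r4 C1 // rU.
  by apply/setP; apply: ord6_cases; rewrite !inE.
- rewrite [bits_set _ _ _ _ _ _](_ : _ = ~: ('o 1 |: ('o 3 |: [set 'o 4]))).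
    by apply: trip0 => //; rewrite r3 r4 C1 // rU.
  by apply/setP; apply: ord6_cases; rewrite !inE.
- rewrite [bits_set _ _ _ _ _ _](_ : _ = ~: ('o 0 |: ('o 3 |: [set 'o 4]))).
    by apply: trip0 => //; rewrite r3 r4 C1 // rU.
  by apply/setP; apply: ord6_cases; rewrite !inE.
- rewrite [bits_set _ _ _ _ _ _](_ : _ = ~: ('o 0 |: ('o 4 |: [set 'o 5]))).
    by apply: trip0 => //; rewrite r0 C2 // rV.
  by apply/setP; apply: ord6_cases; rewrite !inE.
- rewrite [bits_set _ _ _ _ _ _](_ : _ = ~: ('o 0 |: ('o 3 |: [set 'o 5]))).
    by apply: trip0 => //; rewrite r0 C2 // rV.
  by apply/setP; apply: ord6_cases; rewrite !inE.
exists (t *: gmap M (e I3)), (a1 *: row 'o 1 M + a2 *: row 'o 2 M),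
  (b1 *: row 'o 1 M + b2 *: row 'o 2 M); split.
- rewrite memvZ // UE extpow_row_space //; apply/(coord_spaceP uM) => T.
  rewrite /coeffs gmapK // ebaseE; case: (T =P I3) => // ->.
  by rewrite subxx card_I3.
- by rewrite memvD // memvZ // rU.
- by rewrite memvD // memvZ // rU.
have -> : a + t *: gmap M (e I3) = gmap M (coeffs M a + t *: e I3).
  by rewrite linearD linearZ /= coeffsK.
have gl (i : 'I_6) (k1 k2 : K) :
    gmap M (e [set i] + (k1 *: e [set 'o 1] + k2 *: e [set 'o 2])) =
    vec (row i M + (k1 *: row 'o 1 M + k2 *: row 'o 2 M)).
  rewrite 2!(linearD (gmap M)) 2!(linearZ_LR (gmap M)) /= !gr.
  by rewrite 2!(linearD (@vec K 6)) 2!(linearZ_LR (@vec K 6)).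
by rewrite E 2!gmap_wedge gr 2!gl /= wedge1r r0 r3 r4.
Qed.

End AdaptedFrame.

Section Points.
Variables (K : numFieldType).
Local Notation W := 'rV[K]_6.
Local Notation extW := (ext K 6).
Local Notation e := (ebase K).
Implicit Types (a b c : extW) (S T I J : {set 'I_6}) (U V H : {vspace W}).
Implicit Types (A B E F G : {vspace extW}) (v w x : W) (s : seq W).

Lemma free_pair U : (2 <= \dim U)%N ->
  exists v1 v2, [/\ v1 \in U, v2 \in U & free [:: v1; v2]].
Proof.
move=> dU; have : free (take 2 (vbasis U)).
  by apply: (@catl_free _ _ (drop 2 (vbasis U))); rewrite cat_take_drop (basis_free (vbasisP U)).
have : size (take 2 (vbasis U)) = 2%N by apply: size_takel; rewrite size_tuple.
have : {subset take 2 (vbasis U) <= U} by move=> v /mem_take; apply: vbasis_mem.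
case: (take 2 (vbasis U)) => [|v1 [|v2 []]] // sU _ fv.
by exists v1, v2; split=> //; apply: sU; rewrite !inE eqxx ?orbT.
Qed.

Lemma dim_add_plane U V v1 v2 : complement U V -> \dim U = 3%N ->
  v1 \in V -> v2 \in V -> free [:: v1; v2] -> \dim (U + <<[:: v1; v2]>>) = 5%N.
Proof.
move=> [UV1 UV0] dU v1V v2V fv; rewrite dimv_disjoint_sum ?dU; first by rewrite (eqP fv).
apply/eqP; rewrite -subv0 -UV0 capvS //; apply/span_subvP => w.
by rewrite !inE => /orP [] /eqP ->.
Qed.

Lemma span_lift U V x v1 v2 y1 y2 (s := [:: x; v1 + y1; v2 + y2]) :
  complement U V -> \dim U = 3%N -> x \in U -> x != 0 ->
  v1 \in V -> v2 \in V -> free [:: v1; v2] -> y1 \in U -> y2 \in U ->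
  free s /\ (<<s>> :&: U = <[x]>)%VS.
Proof.
move=> UV dU xU x0 v1V v2V fv y1U y2U; have dUv := dim_add_plane UV dU v1V v2V fv.
have Es : (<<s>> + U = U + <<[:: v1; v2]>>)%VS.
  apply/eqP; rewrite eqEsubv !subv_add addvSl addvSr andbT; apply/andP; split.
    apply/span_subvP => w; rewrite !inE => /or3P [] /eqP ->.
    - exact: (subvP (addvSl _ _)).
    - by rewrite addrC memv_add // memv_span ?inE ?eqxx.
    - by rewrite addrC memv_add // memv_span ?inE ?eqxx ?orbT.
  apply/span_subvP => w; rewrite !inE => /orP [] /eqP ->.
  - by rewrite -[v1](addrK y1) memv_add ?memvN // memv_span // !inE eqxx orbT.
  - by rewrite -[v2](addrK y2) memv_add ?memvN // memv_span // !inE eqxx !orbT.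
have xcap : (<[x]> <= <<s>> :&: U)%VS.
  by rewrite -memvE memv_cap xU memv_span // inE eqxx.
have := dimv_sum_cap <<s>> U; rewrite Es dUv dU => Ed.
have := dimvS xcap; rewrite dim_vline x0 => d1.
have d3 : (\dim <<s>> <= 3)%N by apply: (leq_trans (dim_span _)).
split; last apply/esym/eqP; rewrite ?eqEdim ?xcap ?dim_vline ?x0 /free /=;
  move: (\dim <<s>>) (\dim (<<s>> :&: U)) Ed d1 d3; clear; lia.
Qed.

Lemma free_lift U V v1 v2 y1 y2 s : complement U V -> \dim U = 3%N ->
  v1 \in V -> v2 \in V -> free [:: v1; v2] -> y1 \in U -> y2 \in U ->
  basis_of U s -> free [:: v2 + y2, v1 + y1 & s].
Proof.
move=> UV dU v1V v2V fv y1U y2U bU; set X := _ :: _.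
have sX : size X = 5%N.
  by have := @vector.size_basis _ _ _ _ (in_tuple s) bU; rewrite dU /X /= => E; rewrite -E.
have UX : (U <= <<X>>)%VS.
  by rewrite -(span_basis bU) sub_span // => w ws; rewrite !inE ws !orbT.
have sub : (U + <<[:: v1; v2]>> <= <<X>>)%VS.
  rewrite subv_add UX; apply/span_subvP => w; rewrite !inE => /orP [] /eqP ->.
  - rewrite -[v1](addrK y1) memvB //; last exact: (subvP UX).
    by rewrite memv_span // !inE eqxx orbT.
  - rewrite -[v2](addrK y2) memvB //; last exact: (subvP UX).
    by rewrite memv_span // !inE eqxx.
have d5 := dimvS sub; rewrite (dim_add_plane UV dU v1V v2V fv) in d5.
by rewrite /free eqn_leq dim_span sX d5.
Qed.

Lemma wedge_vec3_antisym v w a :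
  wedge (vec v) (wedge (vec w) a) = - wedge (vec w) (wedge (vec v) a).
Proof. by rewrite !wedgeA vec_anticomm -scaleN1r wedgeZl scaleN1r. Qed.

Lemma wedge_vec2_sq v a : wedge (vec v) (wedge (vec v) a) = 0.
Proof. by rewrite wedgeA vec_sq wedge0l. Qed.

Lemma wprod2E w1 w2 : wprod [:: w1; w2] = wedge (vec w1) (vec w2).
Proof. by rewrite /= wedge1r. Qed.

Lemma mem_grade1 U V x w1 w2 : x \in U -> w1 \in V -> w2 \in V ->
  wprod [:: x; w1; w2] \in grade U V 1.
Proof.
move=> xU w1V w2V; rewrite -[wprod _](_ : wedge (wprod [:: x]) (wprod [:: w1; w2]) = _).
  apply: memv_wedgev; apply: wprod_in_extpow => w; rewrite !inE; first by move/eqP->.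
  by move=> /orP [] /eqP ->.
by rewrite /= -wedgeA wedge1l.
Qed.

Lemma mem_grade2 U V x y w : x \in U -> y \in U -> w \in V ->
  wprod [:: x; y; w] \in grade U V 2.
Proof.
move=> xU yU wV; rewrite -[wprod _](_ : wedge (wprod [:: x; y]) (wprod [:: w]) = _).
  apply: memv_wedgev; apply: wprod_in_extpow => z; rewrite !inE; last by move/eqP->.
  by move=> /orP [] /eqP ->.
by rewrite wprod2E /= -wedgeA.
Qed.

Lemma comp1_wprod U V x v1 v2 y1 y2 : complement U V -> \dim U = 3%N ->
  x \in U -> v1 \in V -> v2 \in V -> y1 \in U -> y2 \in U ->
  comp1 U V (wprod [:: x; v1 + y1; v2 + y2]) = wprod [:: x; v1; v2].
Proof.
move=> UV dU xU v1V v2V y1U y2U.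
have [M [uM _ UE VE]] := adapted_frame UV dU (vbasisP U) (vbasisP V).
have -> : wprod [:: x; v1 + y1; v2 + y2] = wprod [:: x; v1; v2] +
    (wprod [:: x; y1; v2] - wprod [:: x; y2; v1]) + wprod [:: x; y1; y2].
  rewrite /= !wedge1r !(linearD (@vec K 6)) !(wedgeDl, wedgeDr).
  rewrite (vec_anticomm y2 v1) wedgeNr opprK.
  by rewrite -!addrA; congr (_ + _); rewrite addrCA.
apply: (comp1E uM UE VE); first exact: mem_grade1.
  by rewrite memvB // mem_grade2.
rewrite (grade3 uM UE VE); apply: (@wprod_in_extpow _ U [:: x; y1; y2]) => w.
by rewrite !inE => /or3P [] /eqP ->.
Qed.

Lemma wedge_hyperplane0 H a b : \dim H = 5%N ->
  a \in extpow H 3 -> b \in extpow H 3 -> wedge a b = 0.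
Proof.
move=> dH; have [M uM [_]] := frame_of_free (basis_free (vbasisP H)).
rewrite (span_basis (vbasisP H)) size_tuple dH => <-; rewrite !extpow_row_space //.
apply: wedge_coord_space0 => // S T /andP [SI /eqP S3] /andP [TI /eqP T3].
apply/negP => d; have : (#|S :|: T| <= #|initial_set 5|)%N.
  by rewrite subset_leq_card // subUset SI TI.
by rewrite card_first // cardsU (disjoint_setI0 d) cards0 subn0 S3 T3.
Qed.

Lemma wedge_ebase1_ann i S b : wedge (e [set i]) b = 0 -> i \notin S -> b S = 0.
Proof.
move=> /ffunP /(_ (i |: S)) + iS; rewrite wedge_ebase sub1set !inE eqxx /= setU1K //.
by rewrite [RHS]ffunE => /eqP; rewrite mulf_eq0 signr_eq0 => /eqP.
Qed.

(** The product with [a] maps [V] into the line [/\^3 V], so two independent vectors annihilate [a].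
    In a basis starting with them, a coefficient of [a] vanishes unless its index set contains
    both. *)
Lemma extpow2_decomposable V a : \dim V = 3%N -> a \in extpow V 2 -> a != 0 ->
  exists v1 v2, [/\ v1 \in V, v2 \in V, free [:: v1; v2] & a = wprod [:: v1; v2]].
Proof.
move=> dV aV a0; pose f := (linfun (wedgel a) \o linfun (@vec K 6))%VF.
have fE v : f v = wedge (vec v) a by rewrite comp_lfunE !lfunE.
have line : (\dim (extpow V 3) <= 1)%N.
  have := extpow_span (basis_free (vbasisP V)); rewrite (span_basis (vbasisP V)).
  have -> : size (vbasis V) = 3%N by rewrite size_tuple.
  by move=> E; rewrite E dim_vline leq_b1.
have fV : (f @: V <= extpow V 3)%VS.
  apply/subvP => _ /memv_imgP [v vV ->]; rewrite fE.
  by apply: memv_wedgev => //; rewrite mem_emb.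
pose Z := (V :&: lker f)%VS; have dZ : (2 <= \dim Z)%N.
  have := limg_ker_dim f V; rewrite -/Z dV; move: (leq_trans (dimvS fV) line).
  by move: (\dim Z) (\dim _) => m k; lia.
have [v1 [v2 [v1Z v2Z fv]]] := free_pair dZ.
have vV v : v \in Z -> v \in V by rewrite memv_cap => /andP [].
have va v : v \in Z -> wedge (vec v) a = 0.
  by rewrite memv_cap memv_ker fE => /andP [_ /eqP].
have [t bV] : exists t, basis_of V ([:: v1; v2] ++ t).
  apply: basis_complete => //; apply/span_subvP => v.
  by rewrite !inE => /orP [] /eqP ->; apply: vV.
have [M uM [_ sp]] := frame_of_free (basis_free bV).
have [t' bT] := basis_complete (basis_free bV) (subvf _).
have sT : size (([:: v1; v2] ++ t) ++ t') = 6%N.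
  have := @vector.size_basis _ _ _ _ (in_tuple (([:: v1; v2] ++ t) ++ t')) bT.
  by rewrite dimvf /dim /= mul1n.
have st : size ([:: v1; v2] ++ t) = 3%N.
  by have := @vector.size_basis _ _ _ _ (in_tuple ([:: v1; v2] ++ t)) bV; rewrite dV.
have {M uM sp} [M uM rM] := frame_exists sT (span_basis bT).
have [_ rV] := mon_first sT rM; rewrite st (span_basis bV) in rV.
have [mv _] : mon M (initial_set 2) = wprod [:: v1; v2] /\ row_space M (initial_set 2) = <<[:: v1; v2]>>%VS.
  exact: (@mon_first _ M [:: v1; v2] (t ++ t') sT rM).
have gr (i : 'I_6) : gmap M (e [set i]) = vec (row i M).
  by rewrite -vec_delta gmap_vec -rowE.
have ann (i : 'I_6) S : row i M \in Z -> i \notin S -> coeffs M a S = 0.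
  move=> iZ; apply: wedge_ebase1_ann.
  have -> : e [set i] = coeffs M (vec (row i M)) by rewrite -gr /coeffs gmapK.
  by rewrite -coeffs_wedge // va // /coeffs linear0.
have : a \in <[wprod [:: v1; v2]]>%VS.
  rewrite -mv -gmap_ebase -coord_space1; apply/(coord_spaceP uM) => S /= SE.
  have r0 := rM (@Ordinal 6 0 isT); have r1 := rM (@Ordinal 6 1 isT).
  have [S0|S0] := boolP ((@Ordinal 6 0 isT) \in S); last by apply: ann S0; rewrite r0.
  have [S1|S1] := boolP ((@Ordinal 6 1 isT) \in S); last by apply: ann S1; rewrite r1.
  move: aV; rewrite -rV extpow_row_space // => /(coord_spaceP uM); apply.
  apply: contra SE => /andP [_ /eqP S2]; rewrite eq_sym eqEcard S2 card_first // andbT.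
  apply/subsetP => i; rewrite inE => i2.
  by case: i i2 => [[|[|//]]] i6 _; rewrite (bool_irrelevance i6 isT).
move=> /vlineP [k Ek]; have k0 : k != 0.
  by apply: contraNneq a0 => k0; rewrite Ek k0 scale0r.
exists (k *: v1), v2; split; rewrite ?memvZ ?vV //.
  move: fv; rewrite !(free_cons _ [:: v2]) => /andP [v1n ->]; rewrite andbT.
  by apply: contra v1n => kv; rewrite -[v1](scalerK k0) memvZ.
by rewrite Ek /= linearZ /= wedgeZl.
Qed.

End Points.

(** * Five planes in a hyperplane *)

Section FivePlanes.
Variables (K : numFieldType).
Local Notation W := 'rV[K]_6.
Local Notation extW := (ext K 6).
Implicit Types (a b c : extW) (S T I J : {set 'I_6}) (U : {vspace W}).
Implicit Types (A B E F G : {vspace extW}) (v w x : W) (s : seq W).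

Lemma extpowS U U' k : (U <= U')%VS -> (extpow U k <= extpow U' k)%VS.
Proof.
move=> UU; elim: k => [|k IH] //; apply: wedgev_subP => a b.
move=> /embP [v vU ->] bU; apply: memv_wedgev; last exact: (subvP IH).
by rewrite mem_emb (subvP UU).
Qed.

Variables (H V : {vspace W}) (h : 'I_5 -> {vspace W}).
Hypotheses (dimH : \dim H = 5%N) (hH : forall i, (h i <= H)%VS)
  (h_inj : injective h) (hspanh : section_is (hspan h) h (fun _ => False)).
Let u := h ord_max.
Hypothesis UV : complement u V.

Let h_in_G i : in_G (hspan h) (h i).
Proof. by have [inG _ _] := hspanh; apply/inG; left; exists i. Qed.

Let in_G_h U : in_G (hspan h) U -> exists i, U = h i.
Proof. by have [inG _ _] := hspanh; move=> /inG []. Qed.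

Let dim_h i : \dim (h i) = 3%N. Proof. by have [] := h_in_G i. Qed.
Let dim_u : \dim u = 3%N. Proof. exact: dim_h. Qed.

Let hspan_H : (hspan h <= extpow H 3)%VS.
Proof. by apply/subv_sumP => i _; apply: extpowS. Qed.

Let hspan_wedge0 a b : a \in hspan h -> b \in hspan h -> wedge a b = 0.
Proof.
by move=> /(subvP hspan_H) aH /(subvP hspan_H); apply: (wedge_hyperplane0 dimH).
Qed.

Let u_hspan : (extpow u 3 <= hspan h)%VS. Proof. by have [] := h_in_G ord_max. Qed.

Let hspan3 : (hspan h <= extpow fullv 3)%VS.
Proof. by apply: (subv_trans hspan_H); apply: extpowS; apply: subvf. Qed.

Let smooth_u : (hspan h :&: Wfil u 2 = extpow u 3)%VS.
Proof. by have [_ _] := hspanh; apply. Qed.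

Lemma hyperplane_basis : exists v1 v2,
  [/\ v1 \in V, v2 \in V, v1 \in H, v2 \in H & free [:: v1; v2]].
Proof.
have [UV1 UV0] := UV; have dV := dim_complement UV dim_u.
pose Z := (V :&: H)%VS; have dZ : \dim Z = 2%N.
  have VH : (V + H = fullv)%VS.
    apply/eqP; rewrite eqEsubv subvf /= -{1}UV1 subv_add addvSl andbT.
    by apply: (subv_trans (hH _)); apply: addvSr.
  have := dimv_sum_cap V H; rewrite VH -/Z dV dimH dimvf /dim /= mul1n.
  by move: (\dim Z) => m; lia.
have [|v1 [v2 [v1Z v2Z fv]]] := @free_pair _ Z; first by rewrite dZ.
move: v1Z v2Z; rewrite !memv_cap => /andP [v1V v1H] /andP [v2V v2H].
by exists v1, v2.
Qed.

Section Basis.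
Variables v1 v2 : W.
Hypotheses (v1V : v1 \in V) (v2V : v2 \in V) (v1H : v1 \in H) (v2H : v2 \in H)
  (fv : free [:: v1; v2]).

Definition xpt i : W := vpick (h i :&: u)%VS.

(** Inside [H], of dimension 5, [h i] and [u] must meet. If they met in dimension at least 2, the
    trivector of [h i] would lie in [W_u^2], and smoothness at [u] would give [h i = u]. Hence
    [h i + u = H], and [v1], [v2] lift to [h i] modulo [u]. *)
Lemma plane_basis i : i != ord_max ->
  [/\ xpt i \in u, xpt i != 0, (h i :&: u = <[xpt i]>)%VS &
   exists y1 y2, [/\ y1 \in u, y2 \in u,
     h i = <<[:: xpt i; (v1 + y1)%R; (v2 + y2)%R]>>%VS &
     extpow (h i) 3 = <[wprod [:: xpt i; (v1 + y1)%R; (v2 + y2)%R]]>%VS]].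
Proof.
move=> iM; set Z := (h i :&: u)%VS.
have dsum : (\dim (h i + u) + \dim Z = 6)%N.
  by rewrite /Z dimv_sum_cap dim_h dim_u.
have hiuH : (h i + u <= H)%VS by rewrite subv_add !hH.
have dle := dimvS hiuH; rewrite dimH in dle.
have dZ1 : \dim Z = 1%N.
  apply/eqP; rewrite eqn_leq; apply/andP; split; last first.
    by move: (\dim (h i + u)) (\dim Z) dsum dle; clear; lia.
  rewrite leqNgt; apply/negP => dZ2; case/negP: iM; apply/eqP/h_inj.
  have [d1 [d2 [d1Z d2Z fd]]] := free_pair dZ2.
  move: d1Z d2Z; rewrite !memv_cap => /andP [d1h d1u] /andP [d2h d2u].
  have [t bh] : exists t, basis_of (h i) ([:: d1; d2] ++ t).
    by apply: basis_complete => //; apply/span_subvP => v; rewrite !inE => /orP [] /eqP ->.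
  have := @vector.size_basis _ _ _ _ (in_tuple ([:: d1; d2] ++ t)) bh.
  rewrite dim_h; case: t bh => [|d3 []] //= bh _.
  have E3 : extpow (h i) 3 = <[wprod [:: d1; d2; d3]]>%VS.
    by have := extpow_span (basis_free bh); rewrite (span_basis bh).
  have : wprod [:: d1; d2; d3] \in extpow u 3.
    rewrite -smooth_u memv_cap; apply/andP; split.
      have [_] := h_in_G i; rewrite E3; exact.
    rewrite -[wprod _](_ : wedge (wprod [:: d1; d2]) (wprod [:: d3]) = _).
      apply: memv_wedgev; apply: wprod_in_extpow => w; rewrite !inE; last by rewrite memvf.
      by move=> /orP [] /eqP ->.
    by rewrite wprod2E /= -wedgeA.
  rewrite memvE -E3 => sub; apply: extpow3_inj => //; apply/eqP.
  rewrite eqEdim sub E3 dim_vline (wprod_neq0 (basis_free bh)).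
  have := extpow_span (basis_free (vbasisP u)); rewrite (span_basis (vbasisP u)).
  have -> : size (vbasis u) = 3%N by rewrite size_tuple.
  by move=> E; rewrite E dim_vline leq_b1.
have hiuE : (h i + u = H)%VS.
  by apply/eqP; rewrite eqEdim hiuH dimH; move: dsum; rewrite dZ1 addn1 => -[->].
have Z0 : Z != 0%VS by rewrite -dimv_eq0 dZ1.
have x0 : xpt i != 0 by rewrite /xpt vpick0.
have xZ : xpt i \in Z by apply: memv_pick.
have ZE : Z = <[xpt i]>%VS.
  by apply/esym/eqP; rewrite eqEdim -memvE xZ dZ1 dim_vline x0.
move: (xZ); rewrite memv_cap => /andP [xh xu]; split=> //.
have lift v : v \in H -> exists2 y, y \in u & (v + y)%R \in h i.
  rewrite -hiuE => /memv_addP [w wh [y yu ->]]; exists (- y); first by rewrite memvN.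
  by rewrite addrK.
have [y1 y1u w1h] := lift _ v1H; have [y2 y2u w2h] := lift _ v2H.
have [fs _] := span_lift UV dim_u xu x0 v1V v2V fv y1u y2u.
have hE : h i = <<[:: xpt i; (v1 + y1)%R; (v2 + y2)%R]>>%VS.
  apply/esym/eqP; rewrite eqEdim (eqP fs) dim_h andbT; apply/span_subvP => w.
  by rewrite !inE => /or3P [] /eqP ->.
by exists y1, y2; split=> //; rewrite {1}hE; apply: (extpow_span fs).
Qed.

(** As [v1 /\ v2] represents the hyperplane [H] in [/\^2 V], this is the point [(x, H)] of the Segre
    variety. *)
Definition lift_pt x : extW := wprod [:: x; v1; v2].

Lemma lift_pt_linear : linear lift_pt.
Proof. by move=> k x y; rewrite /lift_pt /= linearP wedgeDl wedgeZl. Qed.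
HB.instance Definition _ := GRing.isLinear.Build K W extW _ lift_pt lift_pt_linear.

Lemma omegaP i : i != ord_max -> exists o, [/\ o \in hspan h,
  extpow (h i) 3 = <[o]>%VS, comp1 u V o = lift_pt (xpt i) & wedge (vec (xpt i)) o = 0].
Proof.
move=> iM; have [xu x0 _ [y1 [y2 [y1u y2u hE E3]]]] := plane_basis iM.
exists (wprod [:: xpt i; (v1 + y1)%R; (v2 + y2)%R]); split=> //.
- by have [_] := h_in_G i; rewrite E3 -memvE.
- exact: comp1_wprod.
- by rewrite /= wedgeA vec_sq wedge0l.
Qed.

Lemma comp1_ker a : a \in hspan h -> comp1 u V a = 0 -> a \in extpow u 3.
Proof.
move=> ah ca; rewrite -smooth_u memv_cap ah /=.
have [M [uM _ UE VE]] := adapted_frame UV dim_u (vbasisP u) (vbasisP V).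
have aW : a \in W1 M.
  apply: (perp_W1 uM UE (subvP hspan3 _ ah)) => b bu.
  by apply: hspan_wedge0 => //; apply: (subvP u_hspan).
have [a3 [_ g2 g3 ->]] := comp_split uM UE VE aW; rewrite ca add0r (Wfil2E uM UE).
apply: memvD; [move: g2|move: g3]; rewrite (grade_coord uM UE VE) //;
  by apply/subvP/sub_coord_space => // S /andP [/eqP -> ->].
Qed.

(** Otherwise the trivectors of [h i] and [h j] would differ, after scaling, by an element of
    [/\^3 u]. The product of [v1 + y1] and [v2 + z2] annihilates both trivectors but no nonzero
    element of [/\^3 u]; so the difference is 0 and [h i = h j]. *)
Lemma xpt_indep i j k : i != ord_max -> j != ord_max -> i != j ->
  xpt i <> k *: xpt j.
Proof.
move=> iM jM ij Ex; have [xu x0 _ [y1 [y2 [y1u y2u hiE iE3]]]] := plane_basis iM.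
have [xju xj0 _ [z1 [z2 [z1u z2u hjE jE3]]]] := plane_basis jM.
set oi := wprod _ in iE3; set oj := wprod _ in jE3.
have oih : oi \in hspan h by have [_] := h_in_G i; rewrite iE3 -memvE.
have ojh : oj \in hspan h by have [_] := h_in_G j; rewrite jE3 -memvE.
have k0 : k != 0 by apply: contraNneq x0 => k0; rewrite Ex k0 scale0r.
have : oi - k *: oj \in extpow u 3.
  apply: comp1_ker; first by rewrite memvB // memvZ.
  rewrite linearB linearZ /= !(comp1_wprod UV dim_u) // Ex.
  by rewrite -[wprod _]/(lift_pt _) linearZ subrr.
have Eu := extpow_span (basis_free (vbasisP u)); rewrite (span_basis (vbasisP u)) in Eu.
have su : size (vbasis u) = 3%N by rewrite size_tuple.
rewrite su in Eu; rewrite Eu => /vlineP [c Ec].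
have [c0|c0] := eqVneq c 0.
  case/eqP: ij; apply/h_inj/extpow3_inj => //; rewrite iE3 jE3.
  have -> : oi = k *: oj by apply/eqP; rewrite -subr_eq0 Ec c0 scale0r.
  apply/vspaceP => w; apply/vlineP/vlineP => -[l ->]; first by exists (l * k); rewrite scalerA.
  by exists (l / k); rewrite scalerA divfK.
have e1 : wedge (vec (v1 + y1)%R) oi = 0.
  by rewrite /oi /= wedge_vec3_antisym wedge_vec2_sq linear0 oppr0.
have e2 : wedge (vec (v2 + z2)%R) oj = 0.
  rewrite /oj /= wedge_vec3_antisym [wedge _ (wedge (vec (v1 + z1)) _)]wedge_vec3_antisym.
  by rewrite wedge_vec2_sq !(linear0, oppr0).
have E : wedge (vec (v2 + z2)%R) (wedge (vec (v1 + y1)%R) (oi - k *: oj)) = 0.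
  have -> : wedge (vec (v1 + y1)%R) (oi - k *: oj) = - (k *: wedge (vec (v1 + y1)%R) oj).
    by rewrite linearB linearZ /= e1 sub0r.
  by rewrite linearN linearZ /= wedge_vec3_antisym e2 linear0 !(oppr0, scaler0).
have fr := free_lift UV dim_u v1V v2V fv y1u z2u (vbasisP u).
move: E; rewrite Ec !linearZ /= => /eqP.
by rewrite scaler_eq0 (negbTE c0) -[wedge _ _]/(wprod [:: _, _ & vbasis u]) (negbTE (wprod_neq0 fr)).
Qed.

(** The quadrics vanish at [xpt i] and [xpt j]. A third zero [xpt k] on the same line would make
    them vanish along it, and each point of the line would lift to a plane in the section. *)
Lemma xpt_free i j k : i != ord_max -> j != ord_max -> k != ord_max ->
  i != j -> i != k -> j != k -> free [:: xpt k; xpt j; xpt i].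
Proof.
move=> iM jM kM ij ik jk.
have [xiu xi0 _ _] := plane_basis iM; have [xju xj0 _ _] := plane_basis jM.
have fji : free [:: xpt j; xpt i].
  rewrite free_cons seq1_free xi0 span_seq1 andbT; apply/negP => /vlineP [c].
  by apply: xpt_indep => //; rewrite eq_sym.
rewrite free_cons fji andbT; apply/negP => kin.
have [b [a Ek]] : exists b a : K, xpt k = b *: xpt j + a *: xpt i.
  move: kin; rewrite span_cons span_seq1 => /memv_addP [_ /vlineP [b ->] [_ /vlineP [a ->] ->]].
  by exists b, a.
have a0 : a != 0.
  apply/eqP => a0; move: Ek; rewrite a0 scale0r addr0.
  by apply: xpt_indep => //; rewrite eq_sym.
have b0 : b != 0.
  apply/eqP => b0; move: Ek; rewrite b0 scale0r add0r.
  by apply: xpt_indep => //; rewrite eq_sym.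
have [oi [oih iE ci xoi]] := omegaP iM; have [oj [ojh jE cj xoj]] := omegaP jM.
have [ok [okh kE ck xok]] := omegaP kM.
pose d := ok - (b *: oj + a *: oi).
have du : d \in extpow u 3.
  apply: comp1_ker; first by rewrite memvB // memvD // memvZ.
  by rewrite linearB linearD !linearZ /= ci cj ck Ek linearD !linearZ subrr.
have [M [uM _ UE VE]] := adapted_frame UV dim_u (vbasisP u) (vbasisP V).
pose Y w1 w2 x := wprod [:: x; w1; w2].
have YE w1 w2 (c : K) x y : Y w1 w2 (x + c *: y) = Y w1 w2 x + c *: Y w1 w2 y.
  by rewrite /Y /= linearD linearZ wedgeDl wedgeZl.
have Y0 w1 w2 x o : wedge (vec x) o = 0 -> wedge (Y w1 w2 x) o = 0.
  move=> xo; rewrite /Y /= wedge1r -!wedgeA wedge_vec3_antisym.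
  by rewrite [wedge (vec x) _]wedge_vec3_antisym xo !(linear0, linearN, oppr0).
(* The polar form, at [(xpt i, xpt j)], of the quadrics cut out on [u] by the
   Grassmannian vanishes. *)
have polar w1 w2 : w1 \in V -> w2 \in V ->
    wedge (Y w1 w2 (xpt j)) oi + wedge (Y w1 w2 (xpt i)) oj = 0.
  move=> w1V w2V; have Yd : wedge (Y w1 w2 (xpt k)) d = 0.
    apply: (wedge_grade0 uM UE VE (i := 1) (j := 3)) => //; last by rewrite (grade3 uM UE VE).
    by apply: mem_grade1 => //; have [] := plane_basis kM.
  have Ez : Y w1 w2 (b *: xpt j + a *: xpt i) = b *: Y w1 w2 (xpt j) + a *: Y w1 w2 (xpt i).
    by rewrite YE /Y /= linearZ wedgeZl.
  have := Y0 w1 w2 _ _ xok; have -> : ok = d + (b *: oj + a *: oi) by rewrite subrK.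
  rewrite linearD /= Yd add0r Ek Ez linearD !linearZ /= !wedgeDl !wedgeZl.
  rewrite (Y0 _ _ _ _ xoi) (Y0 _ _ _ _ xoj) !scaler0 add0r addr0 !scalerA [a * b]mulrC -scalerDr.
  by move=> /eqP; rewrite scaler_eq0 mulf_eq0 (negbTE a0) (negbTE b0) addrC => /eqP.
(* The parameters 0 to 5 give one point more than there are planes [h l]. *)
have pencil (c : 'I_6) : exists l : 'I_5,
    (h l :&: u = <[xpt i + (c%:R : K) *: xpt j]>)%VS.
  set x := xpt i + _; set o := oi + c%:R *: oj.
  have oh : o \in hspan h by rewrite memvD // memvZ.
  have x0 : x != 0.
    apply/eqP => E; apply: (@xpt_indep i j (- c%:R)) => //.
    by apply/eqP; rewrite scaleNr -addr_eq0; apply/eqP.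
  have xu : x \in u by rewrite memvD // memvZ.
  have [t [y1 [y2 [tu y1u y2u E]]]] : exists t y1 y2, [/\ t \in extpow u 3,
      y1 \in u, y2 \in u & o + t = wprod [:: x; (v1 + y1)%R; (v2 + y2)%R]].
    apply: (decomposable_lift UV dim_u xu x0 v1V v2V fv (subvP hspan3 _ oh)).
    - by move=> b1 b1u; apply: hspan_wedge0 => //; apply: (subvP u_hspan).
    - rewrite linearD linearZ /= ci cj -[RHS]/(lift_pt x).
      by rewrite /x linearD linearZ.
    (* Orthogonality along [u] holds because both trivectors lie in [/\^3 H]; orthogonality along
       [/\^2 V] is [polar]. *)
    - move=> w wu; rewrite (wedge_hyperplane0 dimH _ (subvP hspan_H _ oh)) ?ffunE //.
      apply: (@wprod_in_extpow _ H [:: w; v1; v2]) => w'.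
      by rewrite !inE => /or3P [] /eqP -> //; apply: (subvP (hH ord_max)).
    - move=> w1 w2 w1V w2V; rewrite -[wprod _]/(Y w1 w2 x) /x YE /o linearD linearZ /=.
      rewrite !wedgeDl !wedgeZl (Y0 _ _ _ _ xoi) (Y0 _ _ _ _ xoj) scaler0 addr0 add0r.
      by rewrite -scalerDr polar // scaler0 ffunE.
  have [fs capE] := span_lift UV dim_u xu x0 v1V v2V fv y1u y2u.
  have [|l El] := @in_G_h <<[:: x; (v1 + y1)%R; (v2 + y2)%R]>>%VS.
    split; first by rewrite (eqP fs).
    rewrite [extpow _ _](extpow_span fs) -memvE -E memvD //.
    exact: (subvP u_hspan).
  by exists l; rewrite -El.
have [f fP] := fin_all_exists pencil.
have f_inj : injective f.
  move=> c c' Ef; have := fP c; rewrite Ef fP => E.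
  have /vlineP [l El] : xpt i + c%:R *: xpt j \in <[xpt i + c'%:R *: xpt j]>%VS.
    by rewrite E memv_line.
  have {El} El : (1 - l) *: xpt i = (l * c'%:R - c%:R) *: xpt j.
    apply/rowP => m; have /rowP /(_ m) := El; rewrite !mxE => /eqP.
    rewrite -subr_eq0 => /eqP E0; apply/eqP; rewrite -subr_eq0 -E0; apply/eqP.
    ring.
  have [l1|l1] := eqVneq (1 - l) 0; last first.
    case: (@xpt_indep i j ((1 - l)^-1 * (l * c'%:R - c%:R))) => //.
    by rewrite -scalerA -El scalerA mulVf ?scale1r.
  have {l1} l1 : l = 1 by apply/esym/eqP; rewrite -subr_eq0 l1.
  move: El; rewrite l1 subrr scale0r mul1r => /esym/eqP.
  by rewrite scaler_eq0 (negbTE xj0) orbF subr_eq0 eqr_nat => /eqP/val_inj.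
by have := leq_card f f_inj; rewrite !card_ord.
Qed.

(** The trivector of [u] projects to 0 and those of the other planes to multiples of
    [lift_pt (xpt l)]; three of the [xpt l] already span [u]. *)
Lemma comp1_hspan : (comp1 u V @: hspan h)%VS = (linfun lift_pt @: u)%VS.
Proof.
have [i [j [k [iM jM kM [ij ik jk]]]]] : exists i j k : 'I_5,
    [/\ i != ord_max, j != ord_max, k != ord_max & [/\ i != j, i != k & j != k]].
  by exists (@Ordinal 5 0 isT), (@Ordinal 5 1 isT), (@Ordinal 5 2 isT).
have fx := xpt_free iM jM kM ij ik jk.
apply/eqP; rewrite eqEsubv; apply/andP; split.
  rewrite limg_sum; apply/subv_sumP => l _.
  have [->|lM] := eqVneq l ord_max.
    apply/subvP => _ /memv_imgP [a au ->].
    have [M [uM _ UE VE]] := adapted_frame UV dim_u (vbasisP u) (vbasisP V).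
    have -> : comp1 u V a = 0; last exact: mem0v.
    have := comp1E uM UE VE (mem0v (grade u V 1)) (mem0v (grade u V 2)) (a3 := a).
    by rewrite !add0r; apply; rewrite (grade3 uM UE VE).
  have [o [_ -> co _]] := omegaP lM; rewrite limg_line co -memvE -(lfunE lift_pt).
  by apply: memv_img; have [] := plane_basis lM.
have uE : u = <<[:: xpt k; xpt j; xpt i]>>%VS.
  apply/esym/eqP; rewrite eqEdim (eqP fx) dim_u andbT; apply/span_subvP => w.
  rewrite !inE => /or3P [] /eqP ->.
  - by have [] := plane_basis kM.
  - by have [] := plane_basis jM.
  - by have [] := plane_basis iM.
have key l : l != ord_max -> lift_pt (xpt l) \in (comp1 u V @: hspan h)%VS.
  by move=> lM; have [o [oh _ <- _]] := omegaP lM; apply: memv_img.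
rewrite [X in (_ @: X <= _)%VS]uE !span_cons span_nil addv0 !limgD !limg_line.
by rewrite !subv_add -!memvE !lfunE; apply/and3P; split; apply: key.
Qed.

End Basis.
End FivePlanes.

(** * The Verra threefold *)

Lemma lfun_section (K : fieldType) (vT wT : vectType K) (g : 'Hom(vT, wT))
    (A : {vspace vT}) :
  exists L : 'Hom(wT, vT), (forall s, L s \in A) /\
    forall s, s \in (g @: A)%VS -> g (L s) = s.
Proof.
exists (projv A \o (g \o projv A)^-1)%VF; split=> s.
  by rewrite comp_lfunE memv_proj.
rewrite -{1}(limg_proj A) -limg_comp => /limg_lfunVK.
by rewrite !comp_lfunE.
Qed.

(** * Coordinates on the two factors of the Segre variety *)

Section Coordinates.
Variable K : numFieldType.
Local Notation W := 'rV[K]_6.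
Local Notation extW := (ext K 6).
Implicit Types (E : {vspace extW}) (U V : {vspace W}).

Lemma pt_linear E : linear (pt E).
Proof.
move=> k x y; rewrite /pt scaler_sumr -big_split; apply: eq_bigr => i _ /=.
by rewrite !mxE scalerDl scalerA.
Qed.
HB.instance Definition _ E := GRing.isLinear.Build K 'rV[K]_3 extW _ (pt E)
  (pt_linear E).

Lemma mem_pt E x : \dim E = 3%N -> pt E x \in E.
Proof.
move=> dE; apply: memv_suml => i _; rewrite memvZ // vbasis_mem // mem_nth //.
by rewrite size_tuple dE.
Qed.

Lemma pt_inverse E : \dim E = 3%N ->
  exists c : extW -> 'rV[K]_3, forall a, a \in E -> pt E (c a) = a.
Proof.
move=> dE; have sz : size (vbasis E) == 3%N by rewrite size_tuple dE.
exists (fun a => \row_i coord (Tuple sz) i a) => a aE.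
rewrite [RHS](coord_span (X := Tuple sz)) ?[<<_>>%VS](span_basis (vbasisP E)) //.
by apply: eq_bigr => i _; rewrite mxE.
Qed.

Lemma pt_eq0 E x : \dim E = 3%N -> pt E x = 0 -> x = 0.
Proof.
move=> dE; have sz : size (vbasis E) == 3%N by rewrite size_tuple dE.
have fE : free (Tuple sz) by apply: (basis_free (vbasisP E)).
by move=> /(elimT (@vector.freeP _ _ 3 (Tuple sz)) fE) x0; apply/rowP => i; rewrite mxE x0.
Qed.

Lemma dim_emb U : \dim (emb U) = \dim U.
Proof.
rewrite emb_img limg_dim_eq //; apply/eqP; rewrite -subv0.
apply: (subv_trans (capvSr _ _)); rewrite subv0; apply/lker0P => v w.
by rewrite !lfunE => /vec_inj.
Qed.

Lemma dim_extpow2 U V : complement U V -> \dim U = 3%N -> \dim (extpow V 2) = 3%N.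
Proof.
move=> UV dU; have [M [uM _ _ ->]] := adapted_frame UV dU (vbasisP U) (vbasisP V).
rewrite extpow_row_space // dim_coord_space //.
by have := cards_draws (~: I3) 2; rewrite card_I3C cardsE => ->.
Qed.

End Coordinates.

Section VerraDivisor.
Variable K : numClosedFieldType.
Local Notation W := 'rV[K]_6.
Local Notation extW := (ext K 6).
Implicit Types (a b c : extW) (U : {vspace W}) (x y z w : 'rV[K]_3).

Variables (A : {vspace extW}) (H V : {vspace W}) (h : 'I_5 -> {vspace W}).
Hypotheses (HA : maximal_isotropic A) (dimH : \dim H = 5%N)
  (hH : forall i, (h i <= H)%VS) (h_inj : injective h)
  (hA : section_is A h (residual A H))
  (hspanh : section_is (hspan h) h (fun _ => False))
  (finF : finite_points (residual A H)).
Let u := h ord_max.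
Hypothesis UV : complement u V.

Let in_G_A i : in_G A (h i).
Proof. by have [inG _ _] := hA; apply/inG; left; exists i. Qed.
Let dim_u : \dim u = 3%N. Proof. by have [] := in_G_A ord_max. Qed.
Let u_A : (extpow u 3 <= A)%VS. Proof. by have [] := in_G_A ord_max. Qed.
Let smooth_u : smooth_at A u. Proof. by have [_ _] := hA; apply. Qed.
Let A3 : (A <= extpow fullv 3)%VS. Proof. by have [[]] := HA. Qed.
Let isoA a b : a \in A -> b \in A -> wedge a b = 0.
Proof. by have [[_ isoA] _] := HA; apply: isoA. Qed.
Let hspan_A : (hspan h <= A)%VS.
Proof. by apply/subv_sumP => i _; have [] := in_G_A i. Qed.

Lemma verra_divisor : exists F : {mpoly K[3 + 3]},
  unique (VA_section A u V) F /\
  [/\ \dim (Ph u V h) = 3%N,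
      (forall t, t \in Ph u V h -> t != 0%R -> in_VA u V F t)
    & rational_hypersurface F].
Proof.
have [M [uM _ UE VE]] := adapted_frame UV dim_u (vbasisP u) (vbasisP V).
have [AW surj] := lagrangian_surj uM UE VE HA u_A smooth_u.
have [v1 [v2 [v1V v2V v1H v2H fv]]] := hyperplane_basis dimH hH hspanh UV.
have PhE := comp1_hspan dimH hH h_inj hspanh UV v1V v2V v1H v2H fv.
have dx : \dim (emb u) = 3%N by rewrite dim_emb.
have dy := dim_extpow2 UV dim_u.
pose px := pt (emb u); pose py := pt (extpow V 2).
have [lift [lift_A lift_surj]] := lfun_section (comp1 u V) A.
have liftK s : s \in grade u V 1 -> comp1 u V (lift s) = s.
  by rewrite -surj; apply: lift_surj.
(* On [A] the first component determines the second: an element with first component 0 lies in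
   [A :&: Wfil u 2], which by smoothness is [/\^3 u], of grade 3. *)
have comp2_unique a b : a \in A -> b \in A -> comp1 u V a = comp1 u V b -> comp2 u V a = comp2 u V b.
  move=> aA bA Ec; apply/eqP; rewrite -subr_eq0 -linearB /=; apply/eqP.
  have abA : a - b \in A by rewrite memvB.
  have c10 : comp1 u V (a - b) = 0 by rewrite linearB /= Ec subrr.
  have [a3 [g1 g2 g3 Eab]] := comp_split uM UE VE (subvP AW _ abA).
  have : a - b \in extpow u 3.
    rewrite -smooth_u memv_cap abA /= (Wfil2E uM UE) Eab c10 add0r.
    apply: memvD; [move: g2|move: g3]; rewrite (grade_coord uM UE VE) //;
      by apply/subvP/sub_coord_space => // S /andP [/eqP -> ->].
  rewrite -(grade3 uM UE VE) => ab3.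
  have := comp2E uM UE VE (mem0v (grade u V 1)) (mem0v (grade u V 2)) ab3.
  by rewrite !add0r.
have pairing s a : s \in grade u V 1 -> a \in A -> wedge s (comp2 u V a) = wedge s a.
  move=> sg aA; have [a3 [g1 g2 g3 Ea]] := comp_split uM UE VE (subvP AW _ aA).
  rewrite [in RHS]Ea !linearD /= (wedge_grade0 uM UE VE _ _ _ sg g1) //.
  by rewrite (wedge_grade0 uM UE VE _ _ _ sg g3) // add0r addr0.
pose S x y := segre u V x y.
have S1 x y : S x y \in grade u V 1.
  apply: memv_wedgev; last exact: mem_pt.
  rewrite -[pt _ _]wedge1r; apply: memv_wedgev; [exact: mem_pt | exact: memv_line].
have SL k x x' y : S (k *: x + x') y = k *: S x y + S x' y.
  by rewrite /S /segre linearP wedgeDl wedgeZl.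
have SR k x y y' : S x (k *: y + y') = k *: S x y + S x y'.
  by rewrite /S /segre !linearP.
(* On the diagonal this is the section [a_1 /\ a_2], with the lift playing the role of [a]. *)
pose q x y z w := wedge (S x y) (comp2 u V (lift (S z w))) [set: 'I_6].
have qE x y z w : q x y z w = wedge (S x y) (lift (S z w)) [set: 'I_6].
  by rewrite /q pairing.
(* Isotropy gives [a_1 /\ b_2 + a_2 /\ b_1 = 0] for elements of [A], the other products being zero
   by grade; and trivectors anticommute. *)
have q_sym x y z w : q x y z w = q z w x y.
  have [a3 [_ g2 g3 Ea]] := comp_split uM UE VE (subvP AW _ (lift_A (S x y))).
  have [b3 [_ k2 k3 Eb]] := comp_split uM UE VE (subvP AW _ (lift_A (S z w))).
  have w2 : wedge (comp2 u V (lift (S x y))) (lift (S z w)) =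
      wedge (comp2 u V (lift (S x y))) (S z w).
    rewrite [in LHS]Eb liftK // !linearD /=.
    rewrite (wedge_grade0 uM UE VE _ _ _ g2 k2) // (wedge_grade0 uM UE VE _ _ _ g2 k3) //.
    by rewrite !addr0.
  have w3 : wedge a3 (lift (S z w)) = 0.
    rewrite [in LHS]Eb liftK // !linearD /=.
    rewrite (wedge_grade0 uM UE VE _ _ _ g3 (S1 z w)) // (wedge_grade0 uM UE VE _ _ _ g3 k2) //.
    by rewrite (wedge_grade0 uM UE VE _ _ _ g3 k3) // !addr0.
  have E0 : wedge (S x y) (lift (S z w)) +
      wedge (comp2 u V (lift (S x y))) (lift (S z w)) = 0.
    have Ea' : lift (S x y) = S x y + comp2 u V (lift (S x y)) + a3.
      by rewrite [LHS]Ea liftK.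
    by rewrite -wedgeDl -[LHS]addr0 -w3 -wedgeDl -Ea' isoA.
  have k2' := grade_degree3 uM UE VE (isT : (2 <= 3)%N) g2.
  have k1' := grade_degree3 uM UE VE (isT : (1 <= 3)%N) (S1 z w).
  move/eqP: E0; rewrite w2 (wedge3_antisym k2' k1') subr_eq0 => /eqP E0.
  by rewrite /q (pairing _ _ (S1 x y) (lift_A _)) E0.
have qx (a : K) x x' y z w : q (a *: x + x') y z w = a * q x y z w + q x' y z w.
  by rewrite /q SL wedgeDl wedgeZl [LHS]ffunE ext_scaleE.
have qy (a : K) x y y' z w : q x (a *: y + y') z w = a * q x y z w + q x y' z w.
  by rewrite /q SR wedgeDl wedgeZl [LHS]ffunE ext_scaleE.
have y0V : wprod [:: v1; v2] \in extpow V 2.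
  by apply: (@wprod_in_extpow _ V [:: v1; v2]) => w; rewrite !inE => /orP [] /eqP ->.
have [cx cxK] := pt_inverse dx; have [cy cyK] := pt_inverse dy.
(* [eta] holds the coordinates of the point [H] of the net of hyperplanes through [u]. *)
pose eta := cy (wprod [:: v1; v2]); have Eeta : py eta = wprod [:: v1; v2] := cyK _ y0V.
have eta0 : eta != 0.
  apply: contraNneq (wprod_neq0 fv) => E; by rewrite -Eeta E /py linear0.
have Seta x v : px x = vec v -> S x eta = lift_pt v1 v2 v.
  by move=> E; rewrite /S /segre -/(px x) -/(py eta) E Eeta.
(* Over [(z, eta)] the lift may be taken in [<h>], hence in [/\^3 H], which also contains the Segre
   point over [(x, eta)]. *)
have q_eta x z : q x eta z eta = 0.
  have /embP [v vu Ev] := mem_pt x dx; have /embP [w wu Ew] := mem_pt z dx.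
  have [a ah Ea] : exists2 a, a \in hspan h & comp1 u V a = S z eta.
    have : S z eta \in (comp1 u V @: hspan h)%VS.
      rewrite PhE (Seta _ _ Ew); apply/memv_imgP; exists w => //.
      by rewrite lfunE.
    by move=> /memv_imgP [a ah ->]; exists a.
  have aA := subvP hspan_A _ ah.
  rewrite /q (comp2_unique _ a) ?liftK // pairing // (Seta _ _ Ev).
  rewrite (wedge_hyperplane0 dimH) ?ffunE //.
    apply: (@wprod_in_extpow _ H [:: v; v1; v2]) => w'.
    by rewrite !inE => /or3P [] /eqP -> //; apply: (subvP (hH ord_max)).
  move: ah; apply/subvP/subv_sumP => i _; exact: extpowS.
have [planes planesP] : exists r : seq {vspace W}, forall U, in_G A U -> U \in r.
  have [r rP] := finF; exists (codom h ++ r) => U; have [inG _ _] := hA.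
  by rewrite mem_cat => /inG [[i ->]|/rP ->]; rewrite ?codom_f ?orbT.
(* For a plane meeting [u] in one point, [vpick] returns that point; the entries from other planes
   are harmless. *)
pose ds := [seq cx (vec (vpick (U :&: u)%VS)) | U <- planes].
(* The two vanishing conditions are the hypotheses of [decomposable_lift]; the plane it yields
   belongs to P(A).G and meets [u] in the point [x] alone. *)
have sing x y : x != 0 -> y != 0 -> (forall z, q z y x y = 0) ->
    (forall z, q x z x y = 0) -> exists2 d, d \in ds & exists c : K, x = c *: d.
  move=> x0 y0 qz1 qz2; have /embP [wx wxu Ewx] := mem_pt x dx.
  have wx0 : wx != 0.
    by apply: contraNneq x0 => E; apply/eqP/(pt_eq0 dx); rewrite Ewx E linear0.
  have py0 : py y != 0 by apply: contraNneq y0 => E; apply/eqP/(pt_eq0 dy).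
  have [t1 [t2 [t1V t2V ft Et]]] :=
    extpow2_decomposable (dim_complement UV dim_u) (mem_pt y dy) py0.
  have aA := lift_A (S x y).
  have [t [y1 [y2 [tu y1u y2u E]]]] : exists t (y1 y2 : W), [/\ t \in extpow u 3,
      y1 \in u, y2 \in u & lift (S x y) + t = wprod [:: wx; t1 + y1; t2 + y2]].
    apply: (decomposable_lift UV dim_u wxu wx0 t1V t2V ft (subvP A3 _ aA)).
    - by move=> b bu; apply: isoA => //; apply: (subvP u_A).
    - by rewrite liftK // /S /segre Ewx Et.
    - move=> v vu; have := qz1 (cx (vec v)).
      by rewrite qE /S /segre cxK ?mem_emb // Et.
    - move=> r1 r2 r1V r2V; have := qz2 (cy (wprod [:: r1; r2])).
      rewrite qE /S /segre cyK ?Ewx //.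
      apply: (@wprod_in_extpow _ V [:: r1; r2]) => v.
      by rewrite !inE => /orP [] /eqP ->.
  have [fs capE] := span_lift UV dim_u wxu wx0 t1V t2V ft y1u y2u.
  set U' := <<_>>%VS in capE; have U'in : U' \in planes.
    apply: planesP; split; first by rewrite (eqP fs).
    rewrite [extpow _ _](extpow_span fs) -memvE -E memvD //.
    exact: (subvP u_A).
  set p := vpick (U' :&: u)%VS; have : p \in <[wx]>%VS by rewrite -capE memv_pick.
  move=> /vlineP [l El]; have l0 : l != 0.
    have : p != 0 by rewrite vpick0 capE -dimv_eq0 dim_vline wx0.
    by apply: contraNneq => l0; rewrite El l0 scale0r.
  exists (cx (vec p)); first by apply/mapP; exists U'.
  exists l^-1; apply/eqP; rewrite -subr_eq0; apply/eqP/(pt_eq0 dx).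
  have Ep : vec p = l *: vec wx by rewrite El linearZ.
  have pu : vec p \in emb u by rewrite Ep memvZ // mem_emb.
  by rewrite linearB linearZ /= Ewx (cxK _ pu) Ep scalerA mulVf // scale1r subrr.
have [F [bF evF ratF]] := conic_bundle_rational qx qy q_sym eta0 q_eta sing.
have lift_mem x y : lift (S x y) \in A by [].
exists F; split; last split => //.
- split.
    split=> // x y a aA Ea; rewrite evF /q -[S x y]Ea.
    by rewrite (comp2_unique _ a) // liftK // Ea.
  (* Every Segre point has a lift in [A], so the values of the section are prescribed everywhere. *)
  move=> F' [bF' evF']; apply: mpoly_ev_inj => v; rewrite -(hsubmxK v).
  by rewrite evF /q (evF' _ _ (lift (S (lsubmx v) (rsubmx v)))) ?liftK.
- rewrite /Ph PhE limg_dim_eq //; apply/eqP; rewrite -subv0; apply/subvP => v.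
  rewrite memv_cap memv_ker lfunE memv0 => /andP [vu]; apply: contraTT => v0.
  have [fs _] := span_lift UV dim_u vu v0 v1V v2V fv (mem0v u) (mem0v u).
  by have := wprod_neq0 fs; rewrite !addr0.
move=> t; rewrite /Ph PhE => /memv_imgP [v vu ->] t0.
pose x := cx (vec v); have Ex : px x = vec v by rewrite /px cxK // mem_emb.
exists x, eta; split=> //.
- apply: contraNneq t0 => x0; move: Ex; rewrite x0 /px linear0 => /esym v0.
  by rewrite lfunE /= /lift_pt /= v0 wedge0l.
- by rewrite lfunE /= -(Seta x v).
- by rewrite evF.
Qed.

End VerraDivisor.

(** [phi] is injective on [W_Y], so it maps the distinct planes [P i] to distinct planes. *)
Lemma del_pezzo_tuple_planes (K : fieldType) (H : {vspace 'rV[K]_6})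
    (h : 'I_5 -> {vspace 'rV[K]_6}) :
  del_pezzo_tuple H h -> (forall i, h i <= H)%VS /\ injective h.
Proof.
move=> [Y [WY [phi [P [_ _ [ker0 ->] [P_inj _ PW _] hE]]]]].
split=> [i|i j]; first by rewrite hE limgS.
rewrite !hE => E; apply/P_inj/eqP; rewrite eqEsubv.
have sub k l : (phi @: P k = phi @: P l)%VS -> (P k <= P l)%VS.
  move=> Ekl; apply/subvP => v vk.
  have : phi v \in (phi @: P l)%VS by rewrite -Ekl memv_img.
  move=> /memv_imgP [w wl Ew]; suff -> : v = w by [].
  apply/eqP; rewrite -subr_eq0 -memv0 -ker0 memv_cap memv_ker linearB /= Ew subrr.
  by rewrite eqxx andbT memvB // (subvP (PW _) _ vk, subvP (PW _) _ wl).
by rewrite (sub _ _ E) (sub _ _ (esym E)).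
Qed.

Theorem theorem6p9 (R : realType)
    (A : {vspace ext (complex R) 6})
    (H : {vspace 'rV[complex R]_6})
    (h : 'I_5 -> {vspace 'rV[complex R]_6})
    (V : {vspace 'rV[complex R]_6})
    (HA : maximal_isotropic A)
    (dimH : \dim H = 5%N)
    (hDP : del_pezzo_tuple H h)
    (hA : section_is A h (residual A H))
    (hspanh : section_is (hspan h) h (fun _ => False))
    (finF : finite_points (residual A H))
    (u := h ord_max)
    (UV : complement u V) :
  exists F : {mpoly (complex R)[3 + 3]},
    unique (VA_section A u V) F /\
    [/\ \dim (Ph u V h) = 3%N,
        (forall t, t \in Ph u V h -> t != 0%R -> in_VA u V F t)
      & rational_hypersurface F].
Proof.
have [hH h_inj] := del_pezzo_tuple_planes hDP.
exact: (@verra_divisor (complex R) A H V h HA dimH hH h_inj hA hspanh finF UV).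
Qed.
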